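(* Let $M$ be Minkowski space, $\mathcal{H}$ a complex Hilbert space, and $a\mapsto U(a)$ a strongly continuous unitary representation on $\mathcal{H}$ of the translation group of $M$ such that for every future-directed timelike unit vector $a$ the generator $H(a)$ of $t\mapsto U(ta)$ is bounded below (spectrum condition). Fix a family $\mathcal{S}$ of parallel spacelike hyperplanes foliating $M$ (closed under translations), and for each $S\in\mathcal{S}$ a family $\mathcal{F}(S)$ of subsets of $S$ (''spatial sets'') containing a covering family of bounded subsets of $S$, with $\mathcal{F}(S+a)=\{\Delta+a:\Delta\in\mathcal{F}(S)\}$ for all $a\in M$. Let $\Delta\mapsto E_\Delta$ assign to each spatial set an effect on $\mathcal{H}$, satisfying: (1) Translation covariance: $U(a)E_\Delta U(a)^{*}=E_{\Delta+a}$ for all $a\in M$ and all spatial sets $\Delta$; (2') Localizability (probabilistic form): for each $S\in\mathcal{S}$, all $\Delta_1,\Delta_2\in\mathcal{F}(S)$ with $\Delta_1\cap\Delta_2=\emptyset$, and every unit vector $\varphi\in\mathcal{H}$, if $\langle\varphi|E_{\Delta_1}\varphi\rangle=1$ then $\langle\varphi|E_{\Delta_2}\varphi\rangle=0$; (3) Local commutativity: for $S_1,S_2\in\mathcal{S}$, $\Delta_1\in\mathcal{F}(S_1)$, $\Delta_2\in\mathcal{F}(S_2)$ spacelike separated, $E_{\Delta_1}E_{\Delta_2}=E_{\Delta_2}E_{\Delta_1}$. Then $P^{(1)}_\Delta=0$ for every bounded spatial set $\Delta$, i.e. no effect $E_\Delta$ with $\Delta$ bounded has eigenvalue $1$.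
   Context: An effect is a bounded operator $E$ on $\mathcal{H}$ with $0\le E\le I$. For an effect $E_\Delta$, $P^{(1)}_\Delta$ and $P^{(0)}_\Delta$ denote the spectral projections of $E_\Delta$ onto its eigenspaces for eigenvalues $1$ and $0$ respectively (i.e. onto $\ker(I-E_\Delta)$ and $\ker E_\Delta$). Two subsets $\Delta_1,\Delta_2\subset M$ are spacelike separated if $x-y$ is spacelike for all $x\in\Delta_1$, $y\in\Delta_2$. A subset of a hyperplane $S$ is bounded if it is bounded in the Euclidean metric induced on $S$. *)

(* Defs.v *)
From Stdlib Require Import Reals.
Open Scope R_scope.

Record Cplx := mkC { Cre : R; Cim : R }.
Definition Czero : Cplx := mkC 0 0.
Definition Cone : Cplx := mkC 1 0.
Definition Ci : Cplx := mkC 0 1.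
Definition RtoC (r : R) : Cplx := mkC r 0.
Definition Cadd (a b : Cplx) : Cplx := mkC (Cre a + Cre b) (Cim a + Cim b).
Definition Cmul (a b : Cplx) : Cplx :=
  mkC (Cre a * Cre b - Cim a * Cim b) (Cre a * Cim b + Cim a * Cre b).
Definition Cconj (a : Cplx) : Cplx := mkC (Cre a) (- Cim a).

(* Inner product is conjugate-linear in the first and linear in the second
   argument (physics convention <phi|psi>). *)
Record HilbertSpace := {
  hcar :> Type;
  hzero : hcar;
  hadd : hcar -> hcar -> hcar;
  hopp : hcar -> hcar;
  hscal : Cplx -> hcar -> hcar;
  hinner : hcar -> hcar -> Cplx;
  hadd_assoc : forall x y z, hadd x (hadd y z) = hadd (hadd x y) z;
  hadd_comm : forall x y, hadd x y = hadd y x;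
  hadd_0 : forall x, hadd hzero x = x;
  hadd_opp : forall x, hadd x (hopp x) = hzero;
  hscal_assoc : forall a b x, hscal a (hscal b x) = hscal (Cmul a b) x;
  hscal_1 : forall x, hscal Cone x = x;
  hscal_addr : forall a x y, hscal a (hadd x y) = hadd (hscal a x) (hscal a y);
  hscal_addl : forall a b x, hscal (Cadd a b) x = hadd (hscal a x) (hscal b x);
  hinner_addr : forall x y z, hinner x (hadd y z) = Cadd (hinner x y) (hinner x z);
  hinner_scalr : forall a x y, hinner x (hscal a y) = Cmul a (hinner x y);
  hinner_conj : forall x y, hinner y x = Cconj (hinner x y);
  hinner_pos : forall x, 0 <= Cre (hinner x x);
  hinner_def : forall x, hinner x x = Czero -> x = hzero;
  hcomplete : forall u : nat -> hcar,
    (forall eps, eps > 0 -> exists N, forall m n, (m >= N)%nat -> (n >= N)%nat ->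
        sqrt (Cre (hinner (hadd (u m) (hopp (u n))) (hadd (u m) (hopp (u n))))) < eps) ->
    exists l, forall eps, eps > 0 -> exists N, forall n, (n >= N)%nat ->
        sqrt (Cre (hinner (hadd (u n) (hopp l)) (hadd (u n) (hopp l)))) < eps
}.

Arguments hzero {h}.
Arguments hadd {h}.
Arguments hopp {h}.
Arguments hscal {h}.
Arguments hinner {h}.

Section Ops.
Context {H : HilbertSpace}.

Definition hsub (x y : H) : H := hadd x (hopp y).
Definition hnorm (x : H) : R := sqrt (Cre (hinner x x)).

Definition is_linear (T : H -> H) : Prop :=
  (forall x y, T (hadd x y) = hadd (T x) (T y)) /\
  (forall a x, T (hscal a x) = hscal a (T x)).

Definition is_bounded (T : H -> H) : Prop :=
  exists K, forall x, hnorm (T x) <= K * hnorm x.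

Definition is_adjoint (T Tstar : H -> H) : Prop :=
  forall x y, hinner (Tstar x) y = hinner x (T y).

Definition is_unitary (T : H -> H) : Prop :=
  is_linear T /\ (forall x y, hinner (T x) (T y) = hinner x y) /\
  (forall y, exists x, T x = y).

Definition is_effect (E : H -> H) : Prop :=
  is_linear E /\ is_bounded E /\ is_adjoint E E /\
  (forall x, 0 <= Cre (hinner x (E x)) <= Cre (hinner x x)).
End Ops.

Record M := mkM { Mt : R; Mx1 : R; Mx2 : R; Mx3 : R }.
Definition M0 : M := mkM 0 0 0 0.
Definition Madd (a b : M) : M :=
  mkM (Mt a + Mt b) (Mx1 a + Mx1 b) (Mx2 a + Mx2 b) (Mx3 a + Mx3 b).
Definition Msub (a b : M) : M :=
  mkM (Mt a - Mt b) (Mx1 a - Mx1 b) (Mx2 a - Mx2 b) (Mx3 a - Mx3 b).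
Definition Mscal (r : R) (a : M) : M :=
  mkM (r * Mt a) (r * Mx1 a) (r * Mx2 a) (r * Mx3 a).
Definition mink (a b : M) : R :=
  Mt a * Mt b - Mx1 a * Mx1 b - Mx2 a * Mx2 b - Mx3 a * Mx3 b.
Definition Mnorm (a : M) : R :=
  sqrt (Mt a * Mt a + Mx1 a * Mx1 a + Mx2 a * Mx2 a + Mx3 a * Mx3 a).

Definition timelike (a : M) : Prop := mink a a > 0.
Definition spacelike (a : M) : Prop := mink a a < 0.
Definition future_timelike_unit (a : M) : Prop := mink a a = 1 /\ Mt a > 0.

Definition Mset := M -> Prop.
Definition translate (D : Mset) (a : M) : Mset := fun x => D (Msub x a).
Definition disjoint (D1 D2 : Mset) : Prop := forall x, ~ (D1 x /\ D2 x).
Definition spacelike_separated (D1 D2 : Mset) : Prop :=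
  forall x y, D1 x -> D2 y -> spacelike (Msub x y).

(* The foliation by parallel spacelike hyperplanes with (timelike) normal n:
   hyperplane n c = { x | mink n x = c }. *)
Definition hyperplane (n : M) (c : R) : Mset := fun x => mink n x = c.

(* Boundedness in the Euclidean metric induced on a spacelike hyperplane
   (the negative of the Minkowski form, positive definite there). *)
Definition bounded_in_hyperplane (D : Mset) : Prop :=
  exists B, forall x y, D x -> D y -> - mink (Msub x y) (Msub x y) <= B.

Section Rep.
Context {H : HilbertSpace}.

Definition unitary_rep (U : M -> H -> H) : Prop :=
  (forall a, is_unitary (U a)) /\
  (forall x, U M0 x = x) /\
  (forall a b x, U (Madd a b) x = U a (U b x)).

Definition strongly_continuous (U : M -> H -> H) : Prop :=
  forall x a eps, eps > 0 -> exists delta, delta > 0 /\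
    forall b, Mnorm (Msub b a) < delta -> hnorm (hsub (U b x) (U a x)) < eps.

(* generator H(a) of t |-> U(t a) = exp(i t H(a)):
   phi in dom H(a) and H(a) phi = psi  iff
   (U(t a) phi - phi)/t --> i psi  as t -> 0. *)
Definition generator (U : M -> H -> H) (a : M) (phi psi : H) : Prop :=
  forall eps, eps > 0 -> exists delta, delta > 0 /\
    forall t, t <> 0 -> Rabs t < delta ->
      hnorm (hsub (hscal (RtoC (/ t)) (hsub (U (Mscal t a) phi) phi))
                  (hscal Ci psi)) < eps.

Definition generator_bounded_below (U : M -> H -> H) (a : M) : Prop :=
  exists c, forall phi psi, generator U a phi psi ->
    Cre (hinner phi psi) >= c * Cre (hinner phi phi).

Definition spectrum_condition (U : M -> H -> H) : Prop :=
  forall a, future_timelike_unit a -> generator_bounded_below U a.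
End Rep.

(* Main.v *)
Require Import Defs.
From Stdlib Require Import Reals Lra Lia List ClassicalEpsilon FunctionalExtensionality PropExtensionality.
From Coquelicot Require Import Coquelicot.
Open Scope R_scope.

(* Let P be the projection onto ker (1 - E_D) and Q the same projection for the
   translate D + b, where b is parallel to the hyperplane and long compared with
   the diameter of D.  Localizability gives P Q = 0, and local commutativity makes
   V(-t) P V(t) commute with Q for small t, where V(t) = U(t a) and a is any
   future timelike unit vector.  Borchers' lemma then yields P V(t) Q = 0 for
   small t: for vectors x, y in the range of exp(-r G), G the generator of V,
   the function f(z) = <V(z) x, P_1 ... P_n V(z) Q y>, with P_i = V(-a_i) P V(a_i),
   continues to the upper half plane; moving Q to the left shows that it also
   continues to the lower one, so it is analytic near 0, where it has the n zeros
   - a_i and is bounded independently of n.  By a Schwarz lemma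
   |f(0)| <= C q^n with q < 1, and letting all a_i tend to c and n tend to
   infinity gives P_c Q = 0.  Hence <phi, U(t a + b) phi> = 0 for phi in ran P
   and small t, thus for all t by analyticity.  Every far point of the future time axis
   has the form t a + b, so <phi, U(t e) phi> vanishes for large t, hence
   for all t, and t = 0 gives phi = 0.

   The spectral theorem is avoided: with A_h the average of V over [0, h], the
   operator A_h^* G A_h is bounded, symmetric and bounded below like G, and
   V(z) = exp(i z G) is a limit, locally uniform on Im z >= 0, of the vector
   polynomials (1 + i z A_h^* G A_h / N)^N w.  Cauchy's formula is thus only
   needed for uniform limits of polynomials, where primitives are explicit. *)

(** The vectors x, y are regularised because Q does not preserve vectors on which the group
    continues analytically. For x, y in the range of exp(-r G) both orbits extend a distance r below
    the real axis, but behind Q only upward continuation survives. In the antilinear slot V is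
    evaluated at conj z, so the room r of x pays for moving up; once Q stands on the other side, y
    pays for moving down. One zero of f at - c would say nothing about f(0). The P_i are
    contractions, so any number of them can be inserted at no cost to the bound, and V(-c) P V(c) is
    idempotent, so they collapse to a single factor in the limit. Until then the a_i stay distinct,
    because zeros are divided out one simple zero at a time. The time interval on which
    commutativity holds and the lower bound of the generator both depend on the direction a. This is
    harmless: for each a separately the vanishing is continued to all times before the directions
    are varied. *)

Ltac cring := apply injective_projections; simpl; ring.
Ltac rneq := let E := fresh in intros E; apply RtoC_inj in E; lra.
Tactic Notation "le_trans" uconstr(t) := eapply Rle_trans; [apply t |].

(** * Algebra of the inner product *)

Section Hilbert.
Context {H : HilbertSpace}.
Implicit Types x y z v : H.

(** The inner product is moved to the complex numbers of Coquelicot, where [ring] and [field]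
    work. *)
Definition ip x y : C := (Cre (hinner x y), Cim (hinner x y)).
Definition sc (a : C) x : H := hscal (mkC (fst a) (snd a)) x.

Lemma ip_addr x y z : ip x (hadd y z) = (ip x y + ip x z)%C.
Proof. unfold ip; rewrite hinner_addr; reflexivity. Qed.

Lemma ip_conj x y : ip y x = Cconj (ip x y).
Proof. unfold ip; rewrite hinner_conj; reflexivity. Qed.

Lemma ip_addl x y z : ip (hadd y z) x = (ip y x + ip z x)%C.
Proof.
  rewrite ip_conj, ip_addr, Cplus_conj, <- !ip_conj; reflexivity.
Qed.

Lemma ip_scr a x y : ip x (sc a y) = (a * ip x y)%C.
Proof. unfold ip, sc; rewrite hinner_scalr; reflexivity. Qed.

Lemma ip_scl a x y : ip (sc a x) y = (Cconj a * ip x y)%C.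
Proof. rewrite ip_conj, ip_scr, Cmult_conj, <- ip_conj; reflexivity. Qed.

Lemma ip_0r x : ip x hzero = 0%C.
Proof.
  assert (E : ip x hzero = (ip x hzero + ip x hzero)%C).
  { rewrite <- ip_addr, hadd_0; reflexivity. }
  replace (ip x hzero) with ((ip x hzero + ip x hzero) - ip x hzero)%C by ring.
  rewrite <- E; ring.
Qed.

Lemma ip_0l x : ip hzero x = 0%C.
Proof. rewrite ip_conj, ip_0r; cring. Qed.

Lemma ip_oppr x y : ip x (hopp y) = (- ip x y)%C.
Proof.
  assert (E : (ip x y + ip x (hopp y))%C = 0%C).
  { rewrite <- ip_addr, hadd_opp; apply ip_0r. }
  replace (ip x (hopp y)) with ((ip x y + ip x (hopp y)) - ip x y)%C by ring.
  rewrite E; ring.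
Qed.

Lemma ip_oppl x y : ip (hopp x) y = (- ip x y)%C.
Proof. rewrite ip_conj, ip_oppr, Copp_conj, <- ip_conj; reflexivity. Qed.

Lemma ip_subr x y z : ip x (hsub y z) = (ip x y - ip x z)%C.
Proof. unfold hsub; rewrite ip_addr, ip_oppr; reflexivity. Qed.

Lemma ip_subl x y z : ip (hsub y z) x = (ip y x - ip z x)%C.
Proof. unfold hsub; rewrite ip_addl, ip_oppl; reflexivity. Qed.

Lemma ip_xx x : ip x x = RtoC (Re (ip x x)).
Proof.
  assert (E := ip_conj x x).
  destruct (ip x x) as [a b]; simpl in *.
  injection E; intros; apply injective_projections; simpl; [reflexivity | lra].
Qed.

Lemma ip_xx_im x : Im (ip x x) = 0.
Proof. rewrite ip_xx; reflexivity. Qed.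

Lemma ip_pos x : 0 <= Re (ip x x).
Proof. apply hinner_pos. Qed.

Lemma ip_def x : Re (ip x x) = 0 -> x = hzero.
Proof.
  intros E; apply hinner_def.
  assert (F := ip_xx_im x); unfold ip in *; simpl in *.
  destruct (hinner x x) as [a b]; simpl in *; subst; reflexivity.
Qed.

Lemma hadd_0r x : hadd x hzero = x.
Proof. rewrite hadd_comm; apply hadd_0. Qed.

Lemma hsub_eq x y : hsub x y = hzero -> x = y.
Proof.
  unfold hsub; intros E.
  rewrite <- (hadd_0r x), <- (hadd_opp H y), (hadd_comm H y), hadd_assoc, E.
  apply hadd_0.
Qed.

Lemma ip_ext x y : (forall v, ip v x = ip v y) -> x = y.
Proof.
  intros E; apply hsub_eq, ip_def.
  rewrite ip_subr, E; set (a := ip _ y); destruct a; simpl; ring.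
Qed.
End Hilbert.

                                                                             
                                     
(** A linear identity between vectors is tested by pairing with an arbitrary vector, which turns it
    into a ring identity over the complex numbers; [vec] does this. *)
Ltac ipsimp :=
  rewrite ?ip_addr, ?ip_addl, ?ip_subr, ?ip_subl, ?ip_oppr, ?ip_oppl,
    ?ip_0r, ?ip_0l, ?ip_scr, ?ip_scl.
Ltac ipall := repeat (progress ipsimp).
Ltac vec := apply ip_ext; let v := fresh "v" in intro v; ipall; try ring.

(** * Norm, linear operators and strong limits *)

Section Norm.
Context {H : HilbertSpace}.
Implicit Types x y z : H.

Lemma hnorm_pos x : 0 <= hnorm x.
Proof. apply sqrt_pos. Qed.

Lemma hnorm_sqr x : hnorm x * hnorm x = Re (ip x x).
Proof. apply sqrt_sqrt, ip_pos. Qed.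

Lemma hnorm_0 : hnorm (@hzero H) = 0.
Proof.
  assert (E := hnorm_sqr (@hzero H)); rewrite ip_0r in E; simpl in E; nra.
Qed.

Lemma hnorm_eq0 x : hnorm x = 0 -> x = hzero.
Proof. intros E; apply ip_def; rewrite <- hnorm_sqr, E; ring. Qed.

Lemma hnorm_le x b : 0 <= b -> Re (ip x x) <= b * b -> hnorm x <= b.
Proof.
  intros Hb E; rewrite <- hnorm_sqr in E.
  generalize (hnorm_pos x); nra.
Qed.

Lemma Cmod_sqr (a : C) : Cmod a * Cmod a = fst a * fst a + snd a * snd a.
Proof. unfold Cmod; rewrite sqrt_sqrt; [ring | nra]. Qed.

Lemma cauchy_schwarz x y : Cmod (ip x y) <= hnorm x * hnorm y.
Proof.
  assert (Hx := hnorm_sqr x); assert (Hy := hnorm_sqr y).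
  assert (Px := hnorm_pos x); assert (Py := hnorm_pos y).
  assert (E := Cmod_sqr (ip x y)); assert (Pm := Cmod_ge_0 (ip x y)).
  destruct (Req_dec (hnorm y) 0) as [Z | NZ].
  { apply hnorm_eq0 in Z; subst y; rewrite ip_0r, Cmod_0, hnorm_0; lra. }
                                                   
  (* Multiplying the usual projection residue by |y|^2 avoids division; |w|^2 is |y|^2 times the
     Cauchy-Schwarz defect. *)
  set (w := hsub (sc (RtoC (Re (ip y y))) x) (sc (ip y x) y)).
  assert (P := ip_pos w); unfold w in P.
  rewrite ip_subl, !ip_subr, !ip_scl, !ip_scr in P.
  rewrite (ip_conj x y) in P.
  rewrite (ip_xx x), (ip_xx y) in P.
  rewrite <- Hx, <- Hy in P.
  set (m := ip x y) in *; destruct m as [a b]; simpl in *.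
  assert (Q : 0 <= (hnorm y * hnorm y) * ((hnorm x * hnorm y) * (hnorm x * hnorm y) - (a * a + b * b))).
  { ring_simplify; ring_simplify in P; lra. }
  assert (0 < hnorm y * hnorm y) by nra.
  assert (0 <= hnorm x * hnorm y) by nra.
  assert (a * a + b * b <= (hnorm x * hnorm y) * (hnorm x * hnorm y)) by nra.
  nra.
Qed.

Lemma hnorm_add x y : hnorm (hadd x y) <= hnorm x + hnorm y.
Proof.
  assert (Px := hnorm_pos x); assert (Py := hnorm_pos y).
  apply hnorm_le; [lra |].
  rewrite ip_addl, !ip_addr, (ip_conj x y).
  assert (Hx := hnorm_sqr x); assert (Hy := hnorm_sqr y).
  assert (CS := cauchy_schwarz x y).
  assert (HR := re_le_Cmod (ip x y)); apply Rabs_le_between in HR.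
  destruct (ip x y), (ip x x), (ip y y); simpl in *; nra.
Qed.

Lemma hnorm_sc a x : hnorm (sc a x) = Cmod a * hnorm x.
Proof.
  assert (Hx := hnorm_sqr x); assert (Hy := hnorm_sqr (sc a x)).
  rewrite ip_scl, ip_scr, (ip_xx x), <- Hx in Hy.
  assert (E := Cmod_sqr a); assert (Pm := Cmod_ge_0 a).
  assert (Px := hnorm_pos x); assert (Py := hnorm_pos (sc a x)).
  destruct a as [a b]; simpl in *.
  assert (E2 : hnorm (sc (a, b) x) * hnorm (sc (a, b) x)
     = (Cmod (a, b) * hnorm x) * (Cmod (a, b) * hnorm x)).
  { rewrite Hy.
    transitivity ((Cmod (a, b) * Cmod (a, b)) * (hnorm x * hnorm x)); [rewrite E |]; ring. }
  assert (0 <= Cmod (a, b) * hnorm x) by nra.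
  apply Rsqr_inj; auto.
Qed.

Lemma hnorm_opp x : hnorm (hopp x) = hnorm x.
Proof.
  replace (hopp x) with (sc (RtoC (- (1))) x) by (rewrite RtoC_opp; vec).
  rewrite hnorm_sc.
  rewrite Cmod_R, Rabs_Ropp, Rabs_R1; ring.
Qed.

Lemma hnorm_sub x y : hnorm (hsub x y) <= hnorm x + hnorm y.
Proof. unfold hsub; rewrite <- (hnorm_opp y); apply hnorm_add. Qed.

Lemma hnorm_sub_comm x y : hnorm (hsub x y) = hnorm (hsub y x).
Proof. rewrite <- hnorm_opp; f_equal; vec. Qed.

Lemma hnorm_sub_tri y x z : hnorm (hsub x z) <= hnorm (hsub x y) + hnorm (hsub y z).
Proof.
  replace (hsub x z) with (hadd (hsub x y) (hsub y z)) by vec.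
  apply hnorm_add.
Qed.

Lemma hnorm_le_sub x y : hnorm x <= hnorm y + hnorm (hsub x y).
Proof.
  replace x with (hadd y (hsub x y)) at 1 by vec.
  apply hnorm_add.
Qed.

Lemma hnorm_sub_small x y : (forall eps, 0 < eps -> hnorm (hsub x y) <= eps) -> x = y.
Proof.
  intros E; apply hsub_eq, hnorm_eq0.
  destruct (Req_dec (hnorm (hsub x y)) 0) as [Z | NZ]; [exact Z |].
  assert (P := hnorm_pos (hsub x y)).
  assert (Q := E (hnorm (hsub x y) / 2) ltac:(lra)); lra.
Qed.

Definition lin (T : H -> H) : Prop :=
  (forall x y, T (hadd x y) = hadd (T x) (T y)) /\ (forall a x, T (sc a x) = sc a (T x)).

Definition bnd (K : R) (T : H -> H) : Prop := forall x, hnorm (T x) <= K * hnorm x.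

Definition selfadj (T : H -> H) : Prop := forall x y, ip (T x) y = ip x (T y).

Lemma lin_of_linear T : Defs.is_linear T -> lin T.
Proof. intros [L1 L2]; split; [exact L1 | intros a x; apply L2]. Qed.

Lemma lin_opp T x : lin T -> T (hopp x) = hopp (T x).
Proof.
  intros [_ L]; replace (hopp x) with (sc (- (1))%C x) by vec.
  rewrite L; vec.
Qed.

Lemma lin_sub T x y : lin T -> T (hsub x y) = hsub (T x) (T y).
Proof. intros L; unfold hsub; rewrite (proj1 L), lin_opp; auto. Qed.

Lemma lin_0 T : lin T -> T hzero = hzero.
Proof.
  intros L; replace (@hzero H) with (sc 0%C (@hzero H)) by vec.
  rewrite (proj2 L); vec.
Qed.

Lemma lin_comp S T : lin S -> lin T -> lin (fun x => S (T x)).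
Proof.
  intros [S1 S2] [T1 T2]; split; intros.
  - rewrite T1, S1; reflexivity.
  - rewrite T2, S2; reflexivity.
Qed.

Lemma sc_1 x : sc 1%C x = x.
Proof. vec. Qed.

Definition hlim (u : nat -> H) (l : H) : Prop :=
  forall eps, 0 < eps -> exists N, forall n, (N <= n)%nat -> hnorm (hsub (u n) l) < eps.

Lemma hlim_complete (u : nat -> H) :
  (forall eps, 0 < eps -> exists N, forall m n, (N <= m)%nat -> (N <= n)%nat ->
     hnorm (hsub (u m) (u n)) < eps) -> exists l, hlim u l.
Proof.
  intros Cu.
  destruct (hcomplete H u) as [l Hl].
  - intros eps He; destruct (Cu eps He) as [N HN]; exists N; intros m n Hm Hn.
    apply HN; lia.
  - exists l; intros eps He; destruct (Hl eps He) as [N HN]; exists N; intros n Hn.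
    apply HN; lia.
Qed.

Lemma hlim_unique u l1 l2 : hlim u l1 -> hlim u l2 -> l1 = l2.
Proof.
  intros L1 L2; apply hnorm_sub_small; intros eps He.
  destruct (L1 (eps / 2) ltac:(lra)) as [N1 H1].
  destruct (L2 (eps / 2) ltac:(lra)) as [N2 H2].
  assert (A := H1 (N1 + N2)%nat ltac:(lia)); assert (B := H2 (N1 + N2)%nat ltac:(lia)).
  assert (T := hnorm_sub_tri (u (N1 + N2)%nat) l1 l2).
  rewrite (hnorm_sub_comm l1 (u _)) in T; lra.
Qed.

Lemma hlim_lin T K u l : lin T -> bnd K T -> hlim u l -> hlim (fun n => T (u n)) (T l).
Proof.
  intros L B Hu eps He.
  assert (PK := Rabs_pos K).
  destruct (Hu (eps / (Rabs K + 1))) as [N HN].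
  { apply Rdiv_lt_0_compat; lra. }
  exists N; intros n Hn; rewrite <- lin_sub by exact L.
  assert (A := HN n Hn); apply (Rmult_lt_compat_r (Rabs K + 1)) in A; [| lra].
  unfold Rdiv in A; rewrite Rmult_assoc, Rinv_l, Rmult_1_r in A by lra.
  assert (Bn := B (hsub (u n) l)); assert (Pn := hnorm_pos (hsub (u n) l)).
  assert (AK := Rle_abs K).
  assert (K * hnorm (hsub (u n) l) <= Rabs K * hnorm (hsub (u n) l)) by (apply Rmult_le_compat_r; auto).
  lra.
Qed.

Lemma hlim_add (u v : nat -> H) x y : hlim u x -> hlim v y -> hlim (fun n => hadd (u n) (v n)) (hadd x y).
Proof.
  intros Hu Hv eps He.
  destruct (Hu (eps / 2) ltac:(lra)) as [N1 H1].
  destruct (Hv (eps / 2) ltac:(lra)) as [N2 H2].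
  exists (N1 + N2)%nat; intros n Hn.
  assert (A := H1 n ltac:(lia)); assert (B := H2 n ltac:(lia)).
  replace (hsub (hadd (u n) (v n)) (hadd x y)) with (hadd (hsub (u n) x) (hsub (v n) y)) by vec.
  assert (T := hnorm_add (hsub (u n) x) (hsub (v n) y)); lra.
Qed.

Lemma hlim_ext (u v : nat -> H) l : (forall n, u n = v n) -> hlim u l -> hlim v l.
Proof. intros E Hu eps He; destruct (Hu eps He) as [N HN]; exists N; intros; rewrite <- E; auto. Qed.

Lemma hlim_sc a u x : hlim u x -> hlim (fun n => sc a (u n)) (sc a x).
Proof.
  apply (hlim_lin (sc a) (Cmod a)).
  - split; intros; vec.
  - intros v; rewrite hnorm_sc; lra.
Qed.

Lemma hlim_norm_le u l b : hlim u l -> (forall n, hnorm (u n) <= b) -> hnorm l <= b.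
Proof.
  intros Hu Hb; apply Rnot_lt_le; intros Hlt.
  destruct (Hu (hnorm l - b) ltac:(lra)) as [N HN].
  assert (A := HN N ltac:(lia)); assert (B := Hb N).
  assert (T := hnorm_le_sub l (u N)); rewrite hnorm_sub_comm in T; lra.
Qed.

(** Serves to carry self-adjointness from the powers of an effect to their strong limit. *)
Lemma hlim_ip_eq (u v : nat -> H) x y w z : hlim u x -> hlim v y ->
  (forall n, ip (u n) w = ip z (v n)) -> ip x w = ip z y.
Proof.
  intros Hu Hv E.
  assert (D : Cmod (ip x w - ip z y) = 0).
  { assert (P := Cmod_ge_0 (ip x w - ip z y)); destruct P as [P | P]; [exfalso | lra].
    assert (Pw := hnorm_pos w); assert (Pz := hnorm_pos z).
    set (d := Cmod (ip x w - ip z y)) in *.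
    assert (Pe : 0 < d / (hnorm w + hnorm z + 1)) by (apply Rdiv_lt_0_compat; lra).
    destruct (Hu _ Pe) as [N1 H1]; destruct (Hv _ Pe) as [N2 H2].
    specialize (H1 (N1 + N2)%nat ltac:(lia)); specialize (H2 (N1 + N2)%nat ltac:(lia)).
    set (n := (N1 + N2)%nat) in *.
    assert (Q : (ip x w - ip z y = - ip (hsub (u n) x) w + ip z (hsub (v n) y))%C).
    { rewrite ip_subl, ip_subr, E; ring. }
    assert (B : d <= hnorm (hsub (u n) x) * hnorm w + hnorm z * hnorm (hsub (v n) y)).
    { unfold d; rewrite Q; le_trans Cmod_triangle.
      rewrite Cmod_opp; apply Rplus_le_compat; apply cauchy_schwarz. }
    set (e := d / (hnorm w + hnorm z + 1)) in *.
    assert (De : d = e * (hnorm w + hnorm z + 1)) by (unfold e; field; lra).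
    nra. }
  apply Cmod_eq_0 in D.
  replace (ip x w) with ((ip x w - ip z y) + ip z y)%C by ring.
  rewrite D; ring.
Qed.
End Norm.

                                                    

(** * Componentwise calculus of complex functions of a real variable *)

Definition cder (f : R -> C) (t : R) (d : C) : Prop :=
  is_derive (fun s => Re (f s)) t (Re d) /\ is_derive (fun s => Im (f s)) t (Im d).

Definition ctsC (f : R -> C) (t : R) : Prop :=
  continuity_pt (fun s => Re (f s)) t /\ continuity_pt (fun s => Im (f s)) t.

Definition isCI (f : R -> C) (a b : R) (I : C) : Prop :=
  is_RInt (fun s => Re (f s)) a b (Re I) /\ is_RInt (fun s => Im (f s)) a b (Im I).

Lemma Cmod_le_abs (z : C) : Cmod z <= Rabs (Re z) + Rabs (Im z).
Proof.
  assert (E := Cmod_sqr z); assert (P := Cmod_ge_0 z).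
  assert (P1 := Rabs_pos (Re z)); assert (P2 := Rabs_pos (Im z)).
  assert (S1 : Rabs (Re z) * Rabs (Re z) = fst z * fst z) by (rewrite <- Rabs_mult; apply Rabs_pos_eq, Rle_0_sqr).
  assert (S2 : Rabs (Im z) * Rabs (Im z) = snd z * snd z) by (rewrite <- Rabs_mult; apply Rabs_pos_eq, Rle_0_sqr).
  nra.
Qed.

Lemma im_le_Cmod (z : C) : Rabs (Im z) <= Cmod z.
Proof.
  assert (E := Cmod_sqr z); assert (P := Cmod_ge_0 z).
  apply Rabs_le; destruct z as [a b]; simpl in *; nra.
Qed.

Lemma Cmod_Ci : Cmod Ci = 1.
Proof. assert (E := Cmod_sqr Ci); assert (Q := Cmod_ge_0 Ci); simpl in E; nra. Qed.

Lemma pure_im_Cmod (c : R) : 0 <= c -> Cmod (0, c) = c.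
Proof.
  intros Hc; assert (E := Cmod_sqr (0, c)); assert (Q := Cmod_ge_0 (0, c)); simpl in E; nra.
Qed.

Lemma cder_eq f t d d' : cder f t d -> d = d' -> cder f t d'.
Proof. intros; subst; auto. Qed.

Lemma cder_ext f g t d : (forall s, f s = g s) -> cder f t d -> cder g t d.
Proof. intros E; replace g with f by (apply functional_extensionality, E); auto. Qed.

Lemma cder_const c t : cder (fun _ => c) t 0%C.
Proof. split; apply @is_derive_const. Qed.

Lemma cder_add f g t d e : cder f t d -> cder g t e -> cder (fun s => (f s + g s)%C) t (d + e)%C.
Proof. intros [A B] [A' B']; split; apply @is_derive_plus; auto. Qed.

Lemma is_derive_mult_R (f g : R -> R) t d e : is_derive f t d -> is_derive g t e ->
  is_derive (fun s => f s * g s) t (d * g t + f t * e).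
Proof. intros; apply @is_derive_mult; auto; intros; apply Rmult_comm. Qed.

Lemma cder_mul f g t d e : cder f t d -> cder g t e ->
  cder (fun s => (f s * g s)%C) t (d * g t + f t * e)%C.
Proof.
  intros [A B] [A' B']; split; simpl.
  - eapply is_derive_ext; [intros s; reflexivity |].
    evar_last.
    + apply @is_derive_minus; apply is_derive_mult_R; eauto.
    + unfold minus, plus, opp, Re, Im; simpl; ring.
  - evar_last.
    + apply @is_derive_plus; apply is_derive_mult_R; eauto.
    + unfold plus, Re, Im; simpl; ring.
Qed.

Lemma cder_pow f t d n : cder f t d ->
  cder (fun s => (f s ^ S n)%C) t (RtoC (INR (S n)) * f t ^ n * d)%C.
Proof.
  intros Hf; induction n.
  - eapply cder_eq; [eapply cder_ext; [| exact Hf]; intros; simpl; ring |].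
    simpl; ring.
  - eapply cder_eq.
    + eapply cder_ext; [| apply (cder_mul _ _ _ _ _ Hf IHn)]; intros; simpl; ring.
    + rewrite (S_INR (S n)), RtoC_plus; simpl Cpow; ring.
Qed.

Definition cis (t : R) : C := (cos t, sin t).

Lemma cder_cis t : cder cis t (Ci * cis t)%C.
Proof.
  split; simpl.
  - evar_last; [apply is_derive_Reals, derivable_pt_lim_cos |]; ring.
  - evar_last; [apply is_derive_Reals, derivable_pt_lim_sin |]; ring.
Qed.

Lemma cder_lin t : cder (fun s => RtoC s) t 1%C.
Proof. split; simpl; [apply @is_derive_id | apply @is_derive_const]. Qed.

Lemma ctsC_cder f t d : cder f t d -> ctsC f t.
Proof.
  intros [A B]; split; apply continuity_pt_filterlim; apply @ex_derive_continuous; eexists; eauto.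
Qed.

Lemma ctsC_const c t : ctsC (fun _ => c) t.
Proof. eapply ctsC_cder, cder_const. Qed.

Lemma ctsC_add f g t : ctsC f t -> ctsC g t -> ctsC (fun s => (f s + g s)%C) t.
Proof. intros [A B] [A' B']; split; simpl; apply continuity_pt_plus; auto. Qed.

Lemma ctsC_mul f g t : ctsC f t -> ctsC g t -> ctsC (fun s => (f s * g s)%C) t.
Proof.
  intros [A B] [A' B']; split; simpl.
  - apply (continuity_pt_minus (fun s => Re (f s) * Re (g s)) (fun s => Im (f s) * Im (g s))); apply continuity_pt_mult; auto.
  - apply (continuity_pt_plus (fun s => Re (f s) * Im (g s)) (fun s => Im (f s) * Re (g s))); apply continuity_pt_mult; auto.
Qed.

Lemma ctsC_sub f g t : ctsC f t -> ctsC g t -> ctsC (fun s => (f s - g s)%C) t.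
Proof.
  intros [A B] [A' B']; split; simpl; apply continuity_pt_minus; auto.
Qed.

Lemma Cneq0_sqr (z : C) : z <> 0%C -> fst z * fst z + snd z * snd z <> 0.
Proof.
  intros N E; apply N; apply injective_projections; simpl; apply Rsqr_0_uniq; unfold Rsqr; nra.
Qed.

Lemma ctsC_inv f t : ctsC f t -> f t <> 0%C -> ctsC (fun s => (/ f s)%C) t.
Proof.
  intros [A B] N; apply Cneq0_sqr in N.
  assert (D : continuity_pt (fun s => Re (f s) * Re (f s) + Im (f s) * Im (f s)) t)
    by (apply continuity_pt_plus; apply continuity_pt_mult; auto).
  assert (D' : continuity_pt (fun s => Re (f s) ^ 2 + Im (f s) ^ 2) t).
  { eapply continuity_pt_ext; [| exact D]; intros; simpl; ring. }
  split; simpl; unfold Rdiv.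
  - apply continuity_pt_mult; [exact A |].
    apply (continuity_pt_inv (fun s => Re (f s) ^ 2 + Im (f s) ^ 2)); [exact D' |].
    simpl; rewrite !Rmult_1_r; exact N.
  - apply continuity_pt_mult; [apply continuity_pt_opp; exact B |].
    apply (continuity_pt_inv (fun s => Re (f s) ^ 2 + Im (f s) ^ 2)); [exact D' |].
    simpl; rewrite !Rmult_1_r; exact N.
Qed.

Lemma ctsC_RtoC t : ctsC (fun s => RtoC s) t.
Proof. eapply ctsC_cder, cder_lin. Qed.

Lemma continuity_pt_eps (f : R -> R) t : continuity_pt f t <->
  forall eps, 0 < eps -> exists d, 0 < d /\ forall s, Rabs (s - t) < d -> Rabs (f s - f t) < eps.
Proof.
  split.
  - intros Cf eps He; destruct (Cf eps He) as [d [Hd D]]; exists d; split; [exact Hd |].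
    intros s Hs; destruct (Req_dec t s) as [-> | N].
    + rewrite Rminus_diag, Rabs_R0; exact He.
    + apply (D s); repeat split; auto.
  - intros E eps He; destruct (E eps He) as [d [Hd D]]; exists d; split; [exact Hd |].
    intros s [_ Hs]; apply D, Hs.
Qed.

Lemma ctsC_eps f t : ctsC f t <->
  forall eps, 0 < eps -> exists d, 0 < d /\ forall s, Rabs (s - t) < d -> Cmod (f s - f t) < eps.
Proof.
  split.
  - intros [A B] eps He; rewrite continuity_pt_eps in A, B.
    destruct (A (eps / 2) ltac:(lra)) as [d1 [P1 D1]].
    destruct (B (eps / 2) ltac:(lra)) as [d2 [P2 D2]].
    exists (Rmin d1 d2); split; [apply Rmin_glb_lt; auto |].
    intros s Hs; eapply Rle_lt_trans; [apply Cmod_le_abs |].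
    assert (M1 := Rmin_l d1 d2); assert (M2 := Rmin_r d1 d2).
    specialize (D1 s ltac:(lra)); specialize (D2 s ltac:(lra)).
    change (Re (f s - f t)) with (Re (f s) - Re (f t)).
    change (Im (f s - f t)) with (Im (f s) - Im (f t)).
    lra.
  - intros E; split; apply continuity_pt_eps; intros eps He;
      destruct (E eps He) as [d [Hd D]]; exists d; split; auto; intros s Hs;
      eapply Rle_lt_trans; [| apply (D s Hs) | | apply (D s Hs)].
    + apply (re_le_Cmod (f s - f t)).
    + apply (im_le_Cmod (f s - f t)).
Qed.

Lemma isCI_unique f a b I J : isCI f a b I -> isCI f a b J -> I = J.
Proof.
  intros [A B] [A' B']; apply injective_projections.
  - change (Re I = Re J); rewrite <- (is_RInt_unique _ _ _ _ A); apply (is_RInt_unique _ _ _ _ A').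
  - change (Im I = Im J); rewrite <- (is_RInt_unique _ _ _ _ B); apply (is_RInt_unique _ _ _ _ B').
Qed.

Lemma isCI_ext f g a b I : a <= b -> (forall s, a < s < b -> f s = g s) -> isCI f a b I -> isCI g a b I.
Proof.
  intros Hab E [A B]; split.
  - refine (is_RInt_ext _ _ _ _ _ _ A); intros s Hs.
    rewrite Rmin_left, Rmax_right in Hs by auto; rewrite E; auto.
  - refine (is_RInt_ext _ _ _ _ _ _ B); intros s Hs.
    rewrite Rmin_left, Rmax_right in Hs by auto; rewrite E; auto.
Qed.

Lemma isCI_eq f a b I J : isCI f a b I -> I = J -> isCI f a b J.
Proof. intros; subst; auto. Qed.

Lemma isCI_add f g a b I J : isCI f a b I -> isCI g a b J -> isCI (fun s => (f s + g s)%C) a b (I + J)%C.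
Proof. intros [A B] [A' B']; split; simpl; apply @is_RInt_plus; auto. Qed.

Lemma isCI_scal c f a b I : isCI f a b I -> isCI (fun s => (c * f s)%C) a b (c * I)%C.
Proof.
  intros [A B]; split; simpl.
  - apply @is_RInt_minus; apply @is_RInt_scal; auto.
  - apply @is_RInt_plus; apply @is_RInt_scal; auto.
Qed.

Lemma isCI_sub f g a b I J : isCI f a b I -> isCI g a b J -> isCI (fun s => (f s - g s)%C) a b (I - J)%C.
Proof. intros [A B] [A' B']; split; simpl; apply @is_RInt_minus; auto. Qed.

Lemma isCI_chasles f a b c I J : isCI f a b I -> isCI f b c J -> isCI f a c (I + J)%C.
Proof. intros [A B] [A' B']; split; simpl; eapply @is_RInt_Chasles; eauto. Qed.

(** The factor 2 comes from bounding real and imaginary parts separately; all uses tolerate a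
    constant. *)
Lemma isCI_bound f a b I K : a <= b -> isCI f a b I ->
  (forall s, a <= s <= b -> Cmod (f s) <= K) -> Cmod I <= 2 * ((b - a) * K).
Proof.
  intros Hab [A B] HK; le_trans Cmod_le_abs.
  assert (X : Rabs (Re I) <= (b - a) * K).
  { apply (norm_RInt_le_const (V := R_NormedModule) _ _ _ _ _ Hab) with (2 := A).
    intros s Hs; eapply Rle_trans; [apply re_le_Cmod | auto]. }
  assert (Y : Rabs (Im I) <= (b - a) * K).
  { apply (norm_RInt_le_const (V := R_NormedModule) _ _ _ _ _ Hab) with (2 := B).
    intros s Hs; eapply Rle_trans; [apply im_le_Cmod | auto]. }
  lra.
Qed.

Lemma isCI_ex f a b : a <= b -> (forall s, a <= s <= b -> ctsC f s) -> exists I, isCI f a b I.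
Proof.
  intros Hab Cf.
  assert (A : ex_RInt (fun s => Re (f s)) a b).
  { apply @ex_RInt_continuous; intros s; rewrite Rmin_left, Rmax_right by auto; intros Hs.
    apply continuity_pt_filterlim, Cf, Hs. }
  assert (B : ex_RInt (fun s => Im (f s)) a b).
  { apply @ex_RInt_continuous; intros s; rewrite Rmin_left, Rmax_right by auto; intros Hs.
    apply continuity_pt_filterlim, Cf, Hs. }
  destruct A as [A HA], B as [B HB]; exists (A, B); split; auto.
Qed.

Lemma isCI_cder f d a b : a <= b -> (forall s, a <= s <= b -> cder f s (d s)) ->
  (forall s, a <= s <= b -> ctsC d s) -> isCI d a b (f b - f a)%C.
Proof.
  intros Hab Df Cd; split.
  - apply (is_RInt_derive (V := R_CompleteNormedModule) (fun s => Re (f s)));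
      rewrite Rmin_left, Rmax_right by auto; intros s Hs.
    + apply Df, Hs.
    + apply continuity_pt_filterlim, Cd, Hs.
  - apply (is_RInt_derive (V := R_CompleteNormedModule) (fun s => Im (f s)));
      rewrite Rmin_left, Rmax_right by auto; intros s Hs.
    + apply Df, Hs.
    + apply continuity_pt_filterlim, Cd, Hs.
Qed.

                                                                               
                                                                 
Lemma isCI_ex_unif (g : R -> C) a b : a <= b ->
  (forall eps, 0 < eps -> exists h, (forall s, ctsC h s) /\
     forall s, a <= s <= b -> Cmod (g s - h s) <= eps) ->
  exists I, isCI g a b I.
Proof.
  intros Hab Hg.
  (* [ctsC] is two-sided continuity, whereas [g] is controlled only on [a, b]; composing with the
     clamp extends it continuously past the endpoints. *)
  set (cl := fun s => Rmax a (Rmin b s)).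
  assert (Hcl : forall s, a <= cl s <= b).
  { intros s; unfold cl, Rmax, Rmin; repeat destruct Rle_dec; lra. }
  assert (Hcl1 : forall s t, Rabs (cl s - cl t) <= Rabs (s - t)).
  { intros s t; unfold cl, Rmax, Rmin; repeat destruct Rle_dec;
      unfold Rabs; repeat destruct Rcase_abs; lra. }
  assert (Hcl2 : forall s, a <= s <= b -> cl s = s).
  { intros s; unfold cl, Rmax, Rmin; repeat destruct Rle_dec; lra. }
  destruct (isCI_ex (fun s => g (cl s)) a b Hab) as [I HI].
  - intros t _; apply ctsC_eps; intros eps He.
    destruct (Hg (eps / 4) ltac:(lra)) as [h [Ch Hh]].
    destruct (proj1 (ctsC_eps h (cl t)) (Ch (cl t)) (eps / 4) ltac:(lra)) as [d [Hd D]].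
    exists d; split; auto; intros s Hs.
    replace (g (cl s) - g (cl t))%C with
      ((g (cl s) - h (cl s)) + (h (cl s) - h (cl t)) + - (g (cl t) - h (cl t)))%C by ring.
    assert (X := Hh _ (Hcl s)); assert (Y := Hh _ (Hcl t)).
    assert (Z := D (cl s) (Rle_lt_trans _ _ _ (Hcl1 s t) Hs)).
    eapply Rle_lt_trans; [apply Cmod_triangle |]; rewrite Cmod_opp.
    eapply Rle_lt_trans; [apply Rplus_le_compat_r, Cmod_triangle |]; lra.
  - exists I; eapply isCI_ext; [exact Hab | | exact HI].
    intros s Hs; simpl; rewrite Hcl2; auto; lra.
Qed.

                                                    

(** * Complex polynomials and their divided differences *)

Inductive Pol : (C -> C) -> Prop :=
| Pol_const c : Pol (fun _ => c)
| Pol_id : Pol (fun z => z)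
| Pol_add p q : Pol p -> Pol q -> Pol (fun z => (p z + q z)%C)
| Pol_mul p q : Pol p -> Pol q -> Pol (fun z => (p z * q z)%C).

(** Powers of z - a: in this form division by z - a and integration are both explicit. *)
Inductive MPol (a : C) : (C -> C) -> Prop :=
| MPol_mono c n : MPol a (fun z => (c * (z - a) ^ n)%C)
| MPol_add p q : MPol a p -> MPol a q -> MPol a (fun z => (p z + q z)%C).

Lemma MPol_ext a p q : (forall z, p z = q z) -> MPol a p -> MPol a q.
Proof. intros E; replace q with p by (apply functional_extensionality, E); auto. Qed.

Lemma MPol_mul a p q : MPol a p -> MPol a q -> MPol a (fun z => (p z * q z)%C).
Proof.
  intros Hp Hq; induction Hp as [c n | p1 p2 H1 IH1 H2 IH2].
  - induction Hq as [d m | q1 q2 H1 IH1 H2 IH2].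
    + apply MPol_ext with (2 := MPol_mono a (c * d)%C (n + m)).
      intros z; rewrite Cpow_add_r; ring.
    + apply MPol_ext with (2 := MPol_add _ _ _ IH1 IH2); intros; ring.
  - apply MPol_ext with (2 := MPol_add _ _ _ IH1 IH2); intros; ring.
Qed.

Lemma MPol_of_Pol a p : Pol p -> MPol a p.
Proof.
  induction 1 as [c | | p q _ IHp _ IHq | p q _ IHp _ IHq].
  - apply MPol_ext with (2 := MPol_mono a c 0); intros; simpl; ring.
  - apply MPol_ext with (2 := MPol_add _ _ _ (MPol_mono a 1%C 1) (MPol_mono a a 0)).
    intros; simpl; ring.
  - apply MPol_add; auto.
  - apply MPol_mul; auto.
Qed.

Lemma Pol_comp p q : Pol p -> Pol q -> Pol (fun z => p (q z)).
Proof.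
  intros Hp Hq; induction Hp as [c | | p1 p2 _ IH1 _ IH2 | p1 p2 _ IH1 _ IH2].
  - apply Pol_const.
  - exact Hq.
  - apply (Pol_add _ _ IH1 IH2).
  - apply (Pol_mul _ _ IH1 IH2).
Qed.

Lemma Pol_ext p q : (forall z, p z = q z) -> Pol p -> Pol q.
Proof. intros E; replace q with p by (apply functional_extensionality, E); auto. Qed.

Lemma Pol_conj p : Pol p -> Pol (fun z => Cconj (p (Cconj z))).
Proof.
  induction 1 as [c | | p q _ IHp _ IHq | p q _ IHp _ IHq].
  - apply Pol_const.
  - apply Pol_ext with (2 := Pol_id); intros; rewrite Cconj_conj; auto.
  - apply Pol_ext with (2 := Pol_add _ _ IHp IHq); intros; rewrite Cplus_conj; auto.
  - apply Pol_ext with (2 := Pol_mul _ _ IHp IHq); intros; rewrite Cmult_conj; auto.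
Qed.

Lemma Pol_cts p : Pol p -> forall a eps, 0 < eps ->
  exists d, 0 < d /\ forall z, Cmod (z - a) < d -> Cmod (p z - p a) < eps.
Proof.
  induction 1 as [c | | p q _ IHp _ IHq | p q _ IHp _ IHq]; intros a eps He.
  - exists 1; split; [lra |]; intros; replace (c - c)%C with (RtoC 0) by ring; rewrite Cmod_0; auto.
  - exists eps; auto.
  - destruct (IHp a (eps / 2) ltac:(lra)) as [d1 [P1 D1]].
    destruct (IHq a (eps / 2) ltac:(lra)) as [d2 [P2 D2]].
    exists (Rmin d1 d2); split; [apply Rmin_glb_lt; auto |]; intros z Hz.
    assert (M1 := Rmin_l d1 d2); assert (M2 := Rmin_r d1 d2).
    specialize (D1 z ltac:(lra)); specialize (D2 z ltac:(lra)).
    replace (p z + q z - (p a + q a))%C with ((p z - p a) + (q z - q a))%C by ring.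
    eapply Rle_lt_trans; [apply Cmod_triangle |]; lra.
  - set (A := Cmod (p a) + Cmod (q a) + 1).
    assert (Pp := Cmod_ge_0 (p a)); assert (Pq := Cmod_ge_0 (q a)).
    assert (PA : 0 < A) by (unfold A; lra).
    set (e := Rmin 1 (eps / (2 * A))).
    assert (Pe : 0 < e) by (apply Rmin_glb_lt; [lra | apply Rdiv_lt_0_compat; lra]).
    assert (e1 : e <= 1) by apply Rmin_l.
    assert (e2 : e * A <= eps / 2).
    { assert (Q : e <= eps / (2 * A)) by apply Rmin_r.
      apply (Rmult_le_compat_r A) in Q; [| lra].
      replace (eps / (2 * A) * A) with (eps / 2) in Q by (field; lra); auto. }
    destruct (IHp a e Pe) as [d1 [P1 D1]].
    destruct (IHq a e Pe) as [d2 [P2 D2]].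
    exists (Rmin d1 d2); split; [apply Rmin_glb_lt; auto |]; intros z Hz.
    assert (M1 := Rmin_l d1 d2); assert (M2 := Rmin_r d1 d2).
    specialize (D1 z ltac:(lra)); specialize (D2 z ltac:(lra)).
    replace (p z * q z - p a * q a)%C with
      ((p z - p a) * (q z - q a) + (p z - p a) * q a + p a * (q z - q a))%C by ring.
    assert (X := Cmod_ge_0 (p z - p a)); assert (Y := Cmod_ge_0 (q z - q a)).
    eapply Rle_lt_trans; [apply Cmod_triangle |].
    eapply Rle_lt_trans; [apply Rplus_le_compat_r, Cmod_triangle |].
    rewrite !Cmod_mult; unfold A in e2; nra.
Qed.

Lemma Pol_ctsC p f t : Pol p -> ctsC f t -> ctsC (fun s => p (f s)) t.
Proof.
  intros Hp Hf; induction Hp as [c | | p1 p2 _ IH1 _ IH2 | p1 p2 _ IH1 _ IH2].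
  - apply ctsC_const.
  - exact Hf.
  - apply (ctsC_add _ _ _ IH1 IH2).
  - apply (ctsC_mul _ _ _ IH1 IH2).
Qed.

                                                                                
                                                                      
(** This takes the place of Cauchy's theorem: the integral of (p(w) - p(a)) / (w - a) along a curve
    depends on its endpoints only. For c (z - a)^(n+1) the primitive is c (z - a)^(n+1) / (n+1).
    Stating it along curves avoids complex differentiation. *)
Lemma divided_difference_primitive a p : MPol a p -> exists P : C -> C,
  forall f t d, cder f t d -> f t <> a ->
    cder (fun s => P (f s)) t ((p (f t) - p a) * / (f t - a) * d)%C.
Proof.
  induction 1 as [c n | p q _ [P HP] _ [Q HQ]].
  - destruct n as [| n].
    + exists (fun _ => 0%C); intros f t d Hf N.
      eapply cder_eq; [apply cder_const |]; simpl; ring.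
    + exists (fun z => (c * / RtoC (INR (S n)) * (z - a) ^ S n)%C); intros f t d Hf N.
      assert (N0 : (f t - a)%C <> 0%C) by (intros E; apply N; rewrite <- (Cplus_0_l a), <- E; ring).
      assert (NS : RtoC (INR (S n)) <> 0%C).
      { intros E; apply RtoC_inj in E; 
        rewrite S_INR in E; generalize (pos_INR n); lra. }
      eapply cder_eq.
      * apply cder_mul; [apply cder_const |].
        apply cder_pow, cder_add; [exact Hf | apply cder_const].
      * replace ((a - a) ^ S n)%C with (RtoC 0) by (simpl; ring).
        unfold Cminus; simpl Cpow; field; auto.
  - exists (fun z => (P z + Q z)%C); intros f t d Hf N.
    eapply cder_eq; [apply cder_add; [apply HP | apply HQ]; eauto |].
    simpl; ring.
Qed.

(** The working substitute for continuous on D and holomorphic inside: uniform limit of polynomials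
    on D. *)
Definition approx (D : C -> Prop) (u : C -> C) : Prop :=
  forall eps, 0 < eps -> exists p, Pol p /\ forall z, D z -> Cmod (u z - p z) <= eps.

Definition upper_disc (R : R) (z : C) : Prop := Cmod z <= R /\ 0 <= Im z.
Definition lower_disc (R : R) (z : C) : Prop := Cmod z <= R /\ Im z <= 0.

Lemma approx_cts D u a : approx D u -> D a -> forall eps, 0 < eps ->
  exists d, 0 < d /\ forall z, D z -> Cmod (z - a) < d -> Cmod (u z - u a) < eps.
Proof.
  intros Hu Da eps He.
  destruct (Hu (eps / 4) ltac:(lra)) as [p [Pp Hp]].
  destruct (Pol_cts p Pp a (eps / 4) ltac:(lra)) as [d [Pd Hd]].
  exists d; split; auto; intros z Dz Hz.
  replace (u z - u a)%C with ((u z - p z) + (p z - p a) + - (u a - p a))%C by ring.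
  assert (X := Hp z Dz); assert (Y := Hp a Da); assert (Z := Hd z Hz).
  eapply Rle_lt_trans; [apply Cmod_triangle |]; rewrite Cmod_opp.
  eapply Rle_lt_trans; [apply Rplus_le_compat_r, Cmod_triangle |]; lra.
Qed.

Lemma approx_sub (D D' : C -> Prop) u : (forall z, D z -> D' z) -> approx D' u -> approx D u.
Proof. intros S Hu eps He; destruct (Hu eps He) as [p [Pp Hp]]; exists p; auto. Qed.

Lemma approx_zero D : approx D (fun _ => 0%C).
Proof.
  intros eps He; exists (fun _ => 0%C); split; [apply Pol_const |]; intros.
  replace (0 - 0)%C with (RtoC 0) by ring; rewrite Cmod_0; lra.
Qed.

Lemma approx_comp (D D' : C -> Prop) u q : Pol q -> (forall z, D z -> D' (q z)) ->
  approx D' u -> approx D (fun z => u (q z)).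
Proof.
  intros Pq S Hu eps He; destruct (Hu eps He) as [p [Pp Hp]].
  exists (fun z => p (q z)); split; [apply Pol_comp; auto | auto].
Qed.

Lemma approx_conj (D D' : C -> Prop) u : (forall z, D z -> D' (Cconj z)) -> approx D' u ->
  approx D (fun z => Cconj (u (Cconj z))).
Proof.
  intros S Hu eps He; destruct (Hu eps He) as [p [Pp Hp]].
  exists (fun z => Cconj (p (Cconj z))); split; [apply Pol_conj; auto |].
  intros z Dz; rewrite <- Cminus_conj, Cmod_conj; auto.
Qed.

Lemma approx_bounded (D : C -> Prop) r u : 0 <= r -> (forall z, D z -> Cmod z <= r) -> approx D u ->
  exists K, forall z, D z -> Cmod (u z) <= K.
Proof.
  intros Hr HD Hu; destruct (Hu 1 ltac:(lra)) as [p [Pp Hp]].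
  assert (B : exists K, forall z, Cmod z <= r -> Cmod (p z) <= K).
  { clear Hp; induction Pp as [c | | p q _ [K HK] _ [L HL] | p q _ [K HK] _ [L HL]].
    - exists (Cmod c); intros; lra.
    - exists r; auto.
    - exists (K + L); intros z Hz; le_trans Cmod_triangle.
      apply Rplus_le_compat; auto.
    - exists (K * L); intros z Hz; rewrite Cmod_mult.
      apply Rmult_le_compat; auto using Cmod_ge_0. }
  destruct B as [K HK]; exists (1 + K); intros z Hz.
  replace (u z) with ((u z - p z) + p z)%C by ring.
  le_trans Cmod_triangle.
  apply Rplus_le_compat; [apply Hp | apply HK, HD]; auto.
Qed.

                                                                 

(** * Cauchy's formula for two half-disc functions that agree on the real diameter *)

Section Glue.
Variables (r : R) (u l : C -> C).
Hypothesis Hr : 0 < r.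
Hypothesis Hu : approx (upper_disc r) u.
Hypothesis Hl : approx (lower_disc r) l.

Definition arc (t : R) : C := (RtoC r * cis t)%C.

Lemma Cmod_cis t : Cmod (cis t) = 1.
Proof.
  assert (E := Cmod_sqr (cis t)); assert (P := Cmod_ge_0 (cis t)).
  assert (S := sin2_cos2 t); unfold Rsqr in S; simpl in E; nra.
Qed.

Lemma Cmod_arc t : Cmod (arc t) = r.
Proof. unfold arc; rewrite Cmod_mult, Cmod_cis, Cmod_R, Rabs_pos_eq; lra. Qed.

Lemma arc_neq t a : Cmod a < r -> arc t <> a.
Proof. intros Ha E; rewrite <- E, Cmod_arc in Ha; lra. Qed.

Lemma arc_sub_neq0 t a : Cmod a < r -> (arc t - a)%C <> 0%C.
Proof.
  intros Ha E; apply (arc_neq t a Ha).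
  rewrite <- (Cplus_0_l a), <- E; ring.
Qed.

Lemma arc_sub_ge t a : r - Cmod a <= Cmod (arc t - a).
Proof.
  assert (T := Cmod_triangle (arc t - a) a).
  replace (arc t - a + a)%C with (arc t) in T by ring; rewrite Cmod_arc in T; lra.
Qed.

Lemma Cmod_inv_le (z : C) b : 0 < b -> b <= Cmod z -> Cmod (/ z) <= / b.
Proof.
  intros Hb Hz; rewrite Cmod_inv.
  - apply Rinv_le_contravar; auto.
  - intros E; rewrite E, Cmod_0 in Hz; lra.
Qed.

Lemma cder_arc t : cder arc t (Ci * arc t)%C.
Proof.
  unfold arc; eapply cder_eq; [apply cder_mul; [apply cder_const | apply cder_cis] |]; cbv beta; ring.
Qed.

Lemma ctsC_arc t : ctsC arc t.
Proof. eapply ctsC_cder, cder_arc. Qed.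

Lemma ctsC_ker a t : Cmod a < r -> ctsC (fun s => (/ (arc s - a))%C) t.
Proof.
  intros Ha; apply ctsC_inv.
  - apply ctsC_sub; [apply ctsC_arc | apply ctsC_const].
  - apply arc_sub_neq0, Ha.
Qed.

Ltac cts := repeat (first [apply ctsC_arc | apply ctsC_RtoC | apply ctsC_const
  | apply ctsC_mul | apply ctsC_sub | apply ctsC_ker; assumption | apply Pol_ctsC; [assumption |] ]).

Lemma arc_upper t : 0 <= t <= PI -> 0 <= Im (arc t).
Proof.
  intros Ht; unfold arc; simpl.
  assert (P : 0 <= sin t) by (apply sin_ge_0; lra); nra.
Qed.

Lemma arc_lower t : PI <= t <= 2 * PI -> Im (arc t) <= 0.
Proof.
  intros Ht; unfold arc; simpl.
  assert (P : sin t <= 0) by (apply sin_le_0; lra); nra.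
Qed.

Lemma arc_0 : arc 0 = RtoC r.
Proof. unfold arc, cis; rewrite cos_0, sin_0; cring. Qed.
Lemma arc_PI : arc PI = RtoC (- r).
Proof. unfold arc, cis; rewrite cos_PI, sin_PI; cring. Qed.
Lemma arc_2PI : arc (2 * PI) = RtoC r.
Proof. unfold arc, cis; rewrite cos_2PI, sin_2PI; cring. Qed.

Definition glued (t : R) : C := if Rle_dec t PI then u (arc t) else l (arc t).

Lemma glued_bound K : (forall z, upper_disc r z -> Cmod (u z) <= K) ->
  (forall z, lower_disc r z -> Cmod (l z) <= K) ->
  forall t, 0 <= t <= 2 * PI -> Cmod (glued t) <= K.
Proof.
  intros Ku Kl t Ht; unfold glued; destruct Rle_dec.
  - apply Ku; split; [rewrite Cmod_arc; lra | apply arc_upper; lra].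
  - apply Kl; split; [rewrite Cmod_arc; lra | apply arc_lower; lra].
Qed.

Lemma ctsC_bounded k a b : a <= b -> (forall t, ctsC k t) ->
  exists K, 0 < K /\ forall t, a <= t <= b -> Cmod (k t) <= K.
Proof.
  intros Hab Ck.
  destruct (continuity_ab_maj (fun t => Rabs (Re (k t)) + Rabs (Im (k t))) a b Hab) as [m [Hm _]].
  { intros t _; apply (continuity_pt_plus (fun t => Rabs (Re (k t))) (fun t => Rabs (Im (k t))));
      [apply (continuity_pt_comp (fun t => Re (k t)) Rabs) | apply (continuity_pt_comp (fun t => Im (k t)) Rabs)];
      try apply Rcontinuity_abs; apply Ck. }
  exists (Rabs (Re (k m)) + Rabs (Im (k m)) + 1); split.
  - assert (A := Rabs_pos (Re (k m))); assert (B := Rabs_pos (Im (k m))); lra.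
  - intros t Ht; le_trans Cmod_le_abs.
    specialize (Hm t Ht); simpl in Hm; lra.
Qed.

Lemma isCI_ex_approx (D : C -> Prop) f k a b : a <= b -> approx D f -> (forall t, a <= t <= b -> D (arc t)) ->
  (forall t, ctsC k t) -> exists I, isCI (fun t => (f (arc t) * k t)%C) a b I.
Proof.
  intros Hab Hf HD Ck; apply isCI_ex_unif; [exact Hab |]; intros eps He.
  destruct (ctsC_bounded k a b Hab Ck) as [K [PK HK]].
  destruct (Hf (eps / K)) as [p [Pp Hp]]; [apply Rdiv_lt_0_compat; lra |].
  exists (fun t => (p (arc t) * k t)%C); split.
  - intros s; apply ctsC_mul; auto; apply Pol_ctsC; auto using ctsC_arc.
  - intros s Hs; replace (f (arc s) * k s - p (arc s) * k s)%C with ((f (arc s) - p (arc s)) * k s)%C by ring.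
    rewrite Cmod_mult; assert (X := Hp _ (HD s Hs)); assert (Y := HK s Hs).
    replace eps with (eps / K * K) by (field; lra).
    apply Rmult_le_compat; auto using Cmod_ge_0.
Qed.

Lemma PI2_le : PI <= 2 * PI.
Proof. generalize PI_RGT_0; lra. Qed.
Lemma PI_le0 : 0 <= PI.
Proof. generalize PI_RGT_0; lra. Qed.

Lemma arc_in_upper t : 0 <= t <= PI -> upper_disc r (arc t).
Proof. intros; split; [rewrite Cmod_arc; lra | apply arc_upper; auto]. Qed.
Lemma arc_in_lower t : PI <= t <= 2 * PI -> lower_disc r (arc t).
Proof. intros; split; [rewrite Cmod_arc; lra | apply arc_lower; auto]. Qed.

Lemma glued_split k I J : isCI (fun t => (u (arc t) * k t)%C) 0 PI I ->
  isCI (fun t => (l (arc t) * k t)%C) PI (2 * PI) J ->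
  isCI (fun t => (glued t * k t)%C) 0 (2 * PI) (I + J)%C.
Proof.
  intros HI HJ; apply isCI_chasles with PI.
  - eapply isCI_ext; [apply PI_le0 | | exact HI]; intros s Hs; unfold glued.
    destruct Rle_dec; [reflexivity | lra].
  - eapply isCI_ext; [apply PI2_le | | exact HJ]; intros s Hs; unfold glued.
    destruct Rle_dec; [lra | reflexivity].
Qed.

Lemma glued_ex k : (forall t, ctsC k t) -> exists I, isCI (fun t => (glued t * k t)%C) 0 (2 * PI) I.
Proof.
  intros Ck.
  destruct (isCI_ex_approx _ _ k 0 PI PI_le0 Hu arc_in_upper Ck) as [I HI].
  destruct (isCI_ex_approx _ _ k PI (2 * PI) PI2_le Hl arc_in_lower Ck) as [J HJ].
  exists (I + J)%C; apply glued_split; auto.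
Qed.

(** The dilation with centre a and ratio s; it maps the large arc to a small one around a and
    preserves dz / (z - a). *)
Definition ray (a : R) (s : R) (z : C) : C := (RtoC a + RtoC s * (z - RtoC a))%C.

(** The point a lies on the boundary of the half-disc, so a small half-circle around it is cut out.
    On the large arc f is close to p, on the small one f is close to f(a). The integral of the
    divided difference over each arc is a difference of values of P, and what remains of P are its
    increments along the two real segments joining the arcs. *)
Lemma cauchy_half (D : C -> Prop) f b c (a s eps : R) p P I W :
  0 <= b -> b <= c -> c <= b + PI ->
  Rabs a < r -> 0 < s <= 1 -> 0 < eps ->
  (forall t, b <= t <= c -> D (arc t) /\ D (ray a s (arc t))) -> D (RtoC a) ->
  (forall z, D z -> Cmod (f z - p z) <= eps) ->
  (forall t, b <= t <= c -> Cmod (f (ray a s (arc t)) - f (RtoC a)) <= eps) ->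
  Pol p ->
  (forall g t d, cder g t d -> g t <> RtoC a ->
    cder (fun s => P (g s)) t ((p (g t) - p (RtoC a)) * / (g t - RtoC a) * d)%C) ->
  isCI (fun t => (f (arc t) * (arc t * / (arc t - a)))%C) b c I ->
  isCI (fun t => (arc t * / (arc t - a))%C) b c W ->
  Cmod (Ci * (I - f (RtoC a) * W) - ((P (arc c) - P (arc b)) - (P (ray a s (arc c)) - P (ray a s (arc b)))))
    <= 10 * PI * (r * / (r - Rabs a)) * eps.
Proof.
  intros Hb Hbc Hc Ha Hs He HD Da Hp Hf Pp HP HI HW.
  assert (Ha' : Cmod (RtoC a) < r) by (rewrite Cmod_R; exact Ha).
  assert (PIp := PI_RGT_0).
  assert (Pk : 0 < / (r - Rabs a)) by (apply Rinv_0_lt_compat; lra).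
  assert (Hker : forall t, Cmod (/ (arc t - a)) <= / (r - Rabs a)).
  { intros t; apply Cmod_inv_le; [lra |]; rewrite <- Cmod_R; apply arc_sub_ge. }
  assert (HsC : RtoC s <> 0%C) by rneq.
  assert (HX1 : isCI (fun t => ((p (arc t) - p (RtoC a)) * / (arc t - RtoC a) * (Ci * arc t))%C) b c
      (P (arc c) - P (arc b))%C).
  { apply (isCI_cder (fun t => P (arc t))); [exact Hbc | |].
    - intros t _; apply HP; [apply cder_arc | apply arc_neq; auto].
    - intros t _; cts. }
  assert (HX2 : isCI (fun t => ((p (ray a s (arc t)) - p (RtoC a)) * / (ray a s (arc t) - RtoC a)
       * (RtoC s * (Ci * arc t)))%C) b c
      (P (ray a s (arc c)) - P (ray a s (arc b)))%C).
  { assert (Hn : forall t, (ray a s (arc t) - RtoC a)%C = (RtoC s * (arc t - RtoC a))%C)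
      by (intros; unfold ray; ring).
    assert (Hn0 : forall t, (ray a s (arc t) - RtoC a)%C <> 0%C).
    { intros t; rewrite Hn; apply Cmult_neq_0; [exact HsC | apply arc_sub_neq0; auto]. }
    assert (Hcr : forall t, cder (fun t => ray a s (arc t)) t (RtoC s * (Ci * arc t))%C).
    { intros t; unfold ray, Cminus; eapply cder_eq.
      - apply cder_add; [apply cder_const |]; apply cder_mul; [apply cder_const |].
        apply cder_add; [apply cder_arc | apply cder_const].
      - cbv beta; ring. }
    apply (isCI_cder (fun t => P (ray a s (arc t)))); [exact Hbc | |].
    - intros t _; apply (HP (fun t => ray a s (arc t))); [apply Hcr |].
      intros E; apply (Hn0 t); rewrite E; ring.
    - intros t _; apply ctsC_mul; [apply ctsC_mul |].
      + apply ctsC_sub; [apply (Pol_ctsC p (fun t => ray a s (arc t))); auto | apply ctsC_const].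
        eapply ctsC_cder, Hcr.
      + apply (ctsC_inv (fun t => ray a s (arc t) - RtoC a)%C); [| apply Hn0].
        apply ctsC_sub; [eapply ctsC_cder, Hcr | apply ctsC_const].
      + apply ctsC_mul; [apply ctsC_const |].
        apply ctsC_mul; [apply ctsC_const | apply ctsC_arc]. }
  assert (HB : isCI (fun t => (Ci * (f (arc t) * (arc t * / (arc t - a)) - f (RtoC a) * (arc t * / (arc t - a)))
      - ((p (arc t) - p (RtoC a)) * / (arc t - RtoC a) * (Ci * arc t)
       - (p (ray a s (arc t)) - p (RtoC a)) * / (ray a s (arc t) - RtoC a) * (RtoC s * (Ci * arc t))))%C) b c
     (Ci * (I - f (RtoC a) * W) - ((P (arc c) - P (arc b)) - (P (ray a s (arc c)) - P (ray a s (arc b)))))%C).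
  { apply isCI_sub; [| apply isCI_sub; assumption].
    apply isCI_scal, isCI_sub; [exact HI | apply isCI_scal, HW]. }
  le_trans (isCI_bound _ _ _ _ (5 * eps * (r * / (r - Rabs a))) Hbc HB).
  - intros t Ht.
    replace (ray a s (arc t) - RtoC a)%C with (RtoC s * (arc t - RtoC a))%C by (unfold ray; ring).
    assert (N := arc_sub_neq0 t (RtoC a) Ha').
    replace (Ci * (f (arc t) * (arc t * / (arc t - a)) - f (RtoC a) * (arc t * / (arc t - a))) -
     ((p (arc t) - p (RtoC a)) * / (arc t - a) * (Ci * arc t) -
      (p (ray a s (arc t)) - p (RtoC a)) * / (s * (arc t - a)) * (s * (Ci * arc t))))%C
    with (((f (arc t) - p (arc t)) + (f (ray a s (arc t)) - f (RtoC a)) + - (f (ray a s (arc t)) - p (ray a s (arc t))))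
        * (Ci * (arc t * / (arc t - a))))%C by (field; auto).
    rewrite !Cmod_mult, Cmod_Ci, Cmod_arc.
    assert (X1 := Hp _ (proj1 (HD t Ht))); assert (X2 := Hp _ (proj2 (HD t Ht))).
    assert (X3 := Hf t Ht); assert (X4 := Hker t).
    assert (T : Cmod ((f (arc t) - p (arc t)) + (f (ray a s (arc t)) - f (RtoC a)) + - (f (ray a s (arc t)) - p (ray a s (arc t)))) <= 5 * eps).
    { le_trans Cmod_triangle; rewrite Cmod_opp.
      eapply Rle_trans; [apply Rplus_le_compat_r, Cmod_triangle |]; lra. }
    apply Rmult_le_compat; [apply Cmod_ge_0 | | exact T |].
    + assert (Z := Cmod_ge_0 (/ (arc t - a))); nra.
    + rewrite Rmult_1_l; apply Rmult_le_compat_l; lra.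
  - assert (0 < r * / (r - Rabs a)) by (apply Rmult_lt_0_compat; lra).
    assert (0 <= eps * (r * / (r - Rabs a))) by nra.
    nra.
Qed.

(** Along the segment the kernel grows like 1/t down to t = s, so p and q must agree to within d s,
    and not just d, for their primitives to have increments within a multiple of d. *)
Lemma ray_primitive_bound (a x s d : R) (p q P Q : C -> C) :
  0 < s <= 1 -> 0 <= d -> x <> a -> Pol p -> Pol q ->
  (forall g t d, cder g t d -> g t <> RtoC a ->
    cder (fun s => P (g s)) t ((p (g t) - p (RtoC a)) * / (g t - RtoC a) * d)%C) ->
  (forall g t d, cder g t d -> g t <> RtoC a ->
    cder (fun s => Q (g s)) t ((q (g t) - q (RtoC a)) * / (g t - RtoC a) * d)%C) ->
  (forall t, 0 <= t <= 1 -> Cmod (p (a + t * (x - a))%R - q (a + t * (x - a))%R) <= d * s) ->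
  Cmod ((P (RtoC x) - Q (RtoC x)) - (P (ray a s (RtoC x)) - Q (ray a s (RtoC x)))) <= 4 * d.
Proof.
  intros Hs Hd Hx Pp Pq HP HQ HD.
  assert (Hr' : forall t, ray a t (RtoC x) = RtoC (a + t * (x - a))).
  { intros t; unfold ray; rewrite RtoC_plus, RtoC_mult, RtoC_minus; reflexivity. }
  assert (Hcr : forall t, cder (fun t => ray a t (RtoC x)) t (RtoC x - RtoC a)%C).
  { intros t; unfold ray, Cminus; eapply cder_eq.
    - apply cder_add; [apply cder_const |]; apply cder_mul; [apply cder_lin | apply cder_const].
    - cbv beta; ring. }
  assert (Hne : forall t, s <= t <= 1 -> ray a t (RtoC x) <> RtoC a).
  { intros t Ht E; rewrite Hr' in E; apply RtoC_inj in E.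
    assert (F : t * (x - a) = 0) by lra; apply Rmult_integral in F; lra. }
  assert (HI : isCI (fun t => (((p (ray a t (RtoC x)) - p (RtoC a)) * / (ray a t (RtoC x) - RtoC a) * (RtoC x - RtoC a))
       - ((q (ray a t (RtoC x)) - q (RtoC a)) * / (ray a t (RtoC x) - RtoC a) * (RtoC x - RtoC a)))%C) s 1
     ((P (ray a 1 (RtoC x)) - P (ray a s (RtoC x))) - (Q (ray a 1 (RtoC x)) - Q (ray a s (RtoC x))))%C).
  { assert (Hc : forall t, ctsC (fun t => ray a t (RtoC x)) t) by (intros; eapply ctsC_cder, Hcr).
    assert (Hker : forall t, s <= t <= 1 -> ctsC (fun t => (/ (ray a t (RtoC x) - RtoC a))%C) t).
    { intros t Ht; apply (ctsC_inv (fun t => ray a t (RtoC x) - RtoC a)%C).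
      - apply ctsC_sub; [apply Hc | apply ctsC_const].
      - intros E; apply (Hne t Ht); rewrite <- (Cplus_0_l (RtoC a)), <- E; ring. }
    apply isCI_sub.
    - apply (isCI_cder (fun t => P (ray a t (RtoC x)))); [lra | |].
      + intros t Ht; apply (HP (fun t => ray a t (RtoC x))); auto.
      + intros t Ht; apply ctsC_mul; [apply ctsC_mul; [| auto] | apply ctsC_const].
        apply ctsC_sub; [apply (Pol_ctsC p (fun t => ray a t (RtoC x))); auto | apply ctsC_const].
    - apply (isCI_cder (fun t => Q (ray a t (RtoC x)))); [lra | |].
      + intros t Ht; apply (HQ (fun t => ray a t (RtoC x))); auto.
      + intros t Ht; apply ctsC_mul; [apply ctsC_mul; [| auto] | apply ctsC_const].
        apply ctsC_sub; [apply (Pol_ctsC q (fun t => ray a t (RtoC x))); auto | apply ctsC_const]. }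
  replace (ray a 1 (RtoC x)) with (RtoC x) in HI by (unfold ray; ring).
  match goal with |- Cmod ?X <= _ => replace X with
    ((P (RtoC x) - P (ray a s (RtoC x))) - (Q (RtoC x) - Q (ray a s (RtoC x))))%C by ring end.
  le_trans (isCI_bound _ _ _ _ (2 * d) (proj2 Hs) HI).
  - intros t Ht; assert (N := Hne t Ht).
    assert (N0 : (RtoC x - RtoC a)%C <> 0%C).
    { rewrite <- RtoC_minus; intros E; apply RtoC_inj in E; lra. }
    assert (Nt : RtoC t <> 0%C) by rneq.
    replace (ray a t (RtoC x) - RtoC a)%C with (RtoC t * (RtoC x - RtoC a))%C by (unfold ray; ring).
    match goal with |- Cmod ?X <= _ => replace X with
      (((p (ray a t (RtoC x)) - q (ray a t (RtoC x))) + - (p (RtoC a) - q (RtoC a))) * / RtoC t)%C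
      by (field; auto) end.
    rewrite Cmod_mult, Cmod_inv by exact Nt.
    rewrite Cmod_R, (Rabs_pos_eq t) by lra.
    assert (X1 := HD t ltac:(lra)); rewrite <- Hr' in X1.
    assert (X2 := HD 0 ltac:(lra)); replace (a + 0 * (x - a)) with a in X2 by ring.
    assert (T : Cmod ((p (ray a t (RtoC x)) - q (ray a t (RtoC x))) + - (p (RtoC a) - q (RtoC a))) <= 2 * d * s).
    { le_trans Cmod_triangle; rewrite Cmod_opp; lra. }
    apply Rle_trans with (2 * d * s * / s); [| right; field; lra].
    apply Rmult_le_compat; [apply Cmod_ge_0 | left; apply Rinv_0_lt_compat; lra | exact T |].
    apply Rinv_le_contravar; lra.
  - nra.
Qed.

Lemma upper_disc_ray (a : R) s z : Rabs a <= r -> 0 < s <= 1 -> upper_disc r z -> upper_disc r (ray a s z).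
Proof.
  intros Ha Hs [Hz1 Hz2]; split.
  - replace (ray a s z) with (RtoC (1 - s) * RtoC a + RtoC s * z)%C
      by (unfold ray; rewrite RtoC_minus; ring).
    le_trans Cmod_triangle.
    rewrite !Cmod_mult, !Cmod_R, (Rabs_pos_eq s), (Rabs_pos_eq (1 - s)) by lra.
    assert (X := Cmod_ge_0 z); assert (Y := Rabs_pos a); nra.
  - unfold ray; destruct z; simpl in *; nra.
Qed.

Lemma lower_disc_ray (a : R) s z : Rabs a <= r -> 0 < s <= 1 -> lower_disc r z -> lower_disc r (ray a s z).
Proof.
  intros Ha Hs [Hz1 Hz2].
  destruct (upper_disc_ray a s (Cconj z) Ha Hs) as [A B].
  { split; [rewrite Cmod_conj; auto | destruct z; simpl in *; lra]. }
  replace (ray a s (Cconj z)) with (Cconj (ray a s z)) in A, B.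
  - rewrite Cmod_conj in A; split; [exact A |].
    destruct (ray a s z); simpl in *; lra.
  - unfold ray; rewrite Cplus_conj, Cmult_conj, Cminus_conj.
    cring.
Qed.

Lemma Cmod_small_eq0 (z : C) K : 0 <= K -> (forall eps, 0 < eps < 1 -> Cmod z <= K * eps) -> z = 0%C.
Proof.
  intros HK E; apply Cmod_eq_0.
  assert (P := Cmod_ge_0 z); destruct P as [P | P]; [exfalso | lra].
  set (m := Cmod z) in *.
  assert (F := E (m / (2 * (K + 1) * (m + 1)))).
  assert (D1 : 0 < 2 * (K + 1) * (m + 1)) by nra.
  assert (Q : 0 < m / (2 * (K + 1) * (m + 1)) < 1).
  { split; [apply Rdiv_lt_0_compat; lra |].
    apply Rmult_lt_reg_r with (2 * (K + 1) * (m + 1)); [lra |].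
    unfold Rdiv; rewrite Rmult_assoc, Rinv_l, Rmult_1_r by lra; nra. }
  specialize (F Q); destruct Q as [Q1 Q2].
  set (e := m / (2 * (K + 1) * (m + 1))) in *.
  assert (Em : m = e * (2 * (K + 1) * (m + 1))) by (unfold e; field; lra).
  assert (e * (2 * (K + 1) * (m + 1)) >= e * (2 * (K + 1))) by (apply Rle_ge, Rmult_le_compat_l; nra).
  nra.
Qed.

Lemma ray_close (D : C -> Prop) f (a : R) : Rabs a < r -> approx D f -> D (RtoC a) ->
  (forall s z, 0 < s <= 1 -> D z -> D (ray a s z)) -> forall eps, 0 < eps ->
  exists s0, 0 < s0 <= 1 /\ forall s z, 0 < s <= s0 -> D z -> Cmod z <= r ->
    Cmod (f (ray a s z) - f (RtoC a)) <= eps.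
Proof.
  intros Ha Hf Da HD eps He.
  destruct (approx_cts D f (RtoC a) Hf Da eps He) as [d [Hd Hcts]].
  exists (Rmin 1 (d / (4 * r))).
  assert (Q : 0 < d / (4 * r)) by (apply Rdiv_lt_0_compat; lra).
  assert (M1 := Rmin_l 1 (d / (4 * r))); assert (M2 := Rmin_r 1 (d / (4 * r))).
  split; [split; [apply Rmin_glb_lt; lra | lra] |].
  intros s z Hs Dz Hz; left; apply Hcts; [apply HD; auto; lra |].
  replace (ray a s z - RtoC a)%C with (RtoC s * (z - RtoC a))%C by (unfold ray; ring).
  rewrite Cmod_mult, Cmod_R, Rabs_pos_eq by lra.
  assert (T : Cmod (z - RtoC a) <= 2 * r).
  { le_trans Cmod_triangle; rewrite Cmod_opp, Cmod_R; lra. }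
  assert (s * (4 * r) <= d).
  { apply Rle_trans with (d / (4 * r) * (4 * r)); [| right; field; lra].
    apply Rmult_le_compat_r; lra. }
  nra.
Qed.

Hypothesis Hul : forall x : R, Rabs x <= r -> u (RtoC x) = l (RtoC x).

Lemma real_in_upper (x : R) : Rabs x <= r -> upper_disc r (RtoC x).
Proof. intros; split; [rewrite Cmod_R; auto | simpl; lra]. Qed.
Lemma real_in_lower (x : R) : Rabs x <= r -> lower_disc r (RtoC x).
Proof. intros; split; [rewrite Cmod_R; auto | simpl; lra]. Qed.

                                                                               
                                                                              
                                                            
(** The segment increments left over by the two halves run in opposite directions and cancel up to
    approximation, since u = l on the real axis. The kernel integral [W] is not evaluated: at a node
    it is multiplied by a zero of u, and at the centre its integrand is constant. *)
Lemma cauchy_glued (a : R) I W : Rabs a < r ->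
  isCI (fun t => (glued t * (arc t * / (arc t - a)))%C) 0 (2 * PI) I ->
  isCI (fun t => (arc t * / (arc t - a))%C) 0 (2 * PI) W ->
  I = (u (RtoC a) * W)%C.
Proof.
  intros Ha HI HW.
  assert (Ha' : Cmod (RtoC a) < r) by (rewrite Cmod_R; exact Ha).
  assert (Ck : forall t, ctsC (fun t => (arc t * / (arc t - a))%C) t).
  { intros t; cts. }
  destruct (isCI_ex_approx _ _ _ 0 PI PI_le0 Hu arc_in_upper Ck) as [Iu HIu].
  destruct (isCI_ex_approx _ _ _ PI (2 * PI) PI2_le Hl arc_in_lower Ck) as [Il HIl].
  destruct (isCI_ex _ 0 PI PI_le0 (fun t _ => Ck t)) as [Wu HWu].
  destruct (isCI_ex _ PI (2 * PI) PI2_le (fun t _ => Ck t)) as [Wl HWl].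
  rewrite (isCI_unique _ _ _ _ _ HI (glued_split _ _ _ HIu HIl)).
  rewrite (isCI_unique _ _ _ _ _ HW (isCI_chasles _ _ _ _ _ _ HWu HWl)).
  assert (Pi := PI_RGT_0).
  assert (Pk : 0 < / (r - Rabs a)) by (apply Rinv_0_lt_compat; lra).
  set (kap := r * / (r - Rabs a)).
  assert (Pkap : 0 < kap) by (apply Rmult_lt_0_compat; lra).
  assert (Z : (Ci * ((Iu - u (RtoC a) * Wu) + (Il - l (RtoC a) * Wl)))%C = 0%C).
  (* Each half contributes 10 pi kap and each of the two segments contributes 8. *)
  { apply Cmod_small_eq0 with (20 * PI * kap + 16); [nra |]; intros eps He.
    assert (Da : Rabs a <= r) by lra.
    destruct (ray_close _ _ a Ha Hu (real_in_upper a Da)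
      (fun s z Hs Hz => upper_disc_ray a s z Da Hs Hz) eps ltac:(lra)) as [su [Hsu Cu]].
    destruct (ray_close _ _ a Ha Hl (real_in_lower a Da)
      (fun s z Hs Hz => lower_disc_ray a s z Da Hs Hz) eps ltac:(lra)) as [sl [Hsl Cl]].
    set (s := Rmin su sl).
    assert (Ps : 0 < s) by (apply Rmin_glb_lt; lra).
    assert (Ps1 : s <= su) by apply Rmin_l; assert (Ps2 : s <= sl) by apply Rmin_r.
    assert (Hs : 0 < s <= 1) by lra.
    (* The accuracy is tied to s to beat the 1/s of the kernel near a; hence s is fixed before p and
       q. *)
    destruct (Hu (eps * s)) as [p [Pp Hp]]; [nra |].
    destruct (Hl (eps * s)) as [q [Pq Hq]]; [nra |].
    destruct (divided_difference_primitive (RtoC a) p (MPol_of_Pol _ _ Pp)) as [P HP].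
    destruct (divided_difference_primitive (RtoC a) q (MPol_of_Pol _ _ Pq)) as [Q HQ].
    assert (Hse : eps * s <= eps) by nra.
    assert (Eu : Cmod (Ci * (Iu - u (RtoC a) * Wu) - ((P (arc PI) - P (arc 0)) -
        (P (ray a s (arc PI)) - P (ray a s (arc 0))))) <= 10 * PI * kap * eps).
    { apply (cauchy_half (upper_disc r) u 0 PI a s eps p P Iu Wu); auto; try lra.
      - intros t Ht; split; [| apply upper_disc_ray; auto]; apply arc_in_upper, Ht.
      - apply real_in_upper, Da.
      - intros z Hz; apply Rle_trans with (2 := Hse); auto.
      - intros t Ht; apply Cu; [lra | apply arc_in_upper, Ht | rewrite Cmod_arc; lra]. }
    assert (El : Cmod (Ci * (Il - l (RtoC a) * Wl) - ((Q (arc (2 * PI)) - Q (arc PI)) -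
        (Q (ray a s (arc (2 * PI))) - Q (ray a s (arc PI))))) <= 10 * PI * kap * eps).
    { apply (cauchy_half (lower_disc r) l PI (2 * PI) a s eps q Q Il Wl); auto; try lra.
      - intros t Ht; split; [| apply lower_disc_ray; auto]; apply arc_in_lower, Ht.
      - apply real_in_lower, Da.
      - intros z Hz; apply Rle_trans with (2 := Hse); auto.
      - intros t Ht; apply Cl; [lra | apply arc_in_lower, Ht | rewrite Cmod_arc; lra]. }
    assert (B : forall x : R, Rabs x <= r -> x <> a ->
      Cmod ((P (RtoC x) - Q (RtoC x)) - (P (ray a s (RtoC x)) - Q (ray a s (RtoC x)))) <= 4 * (2 * eps)).
    { intros x Hx Nx; apply (ray_primitive_bound a x s (2 * eps) p q P Q Hs ltac:(lra) Nx Pp Pq HP HQ).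
      intros t Ht.
      assert (Hy : Rabs (a + t * (x - a)) <= r).
      { apply Rabs_le_between in Da; apply Rabs_le_between in Hx; apply Rabs_le_between; nra. }
      set (y := a + t * (x - a)) in *.
      replace (p (RtoC y) - q (RtoC y))%C with (- (u (RtoC y) - p (RtoC y)) + (l (RtoC y) - q (RtoC y)))%C
        by (rewrite (Hul y Hy); ring).
      le_trans Cmod_triangle; rewrite Cmod_opp.
      assert (A1 := Hp _ (real_in_upper y Hy)); assert (A2 := Hq _ (real_in_lower y Hy)); lra. }
    assert (B1 := B r ltac:(rewrite Rabs_pos_eq; lra) ltac:(intros ->; rewrite Rabs_pos_eq in Ha; lra)).
    assert (B2 := B (- r) ltac:(rewrite Rabs_Ropp, Rabs_pos_eq; lra)
      ltac:(intros <-; rewrite Rabs_Ropp, Rabs_pos_eq in Ha; lra)).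
    rewrite arc_0, arc_PI in Eu; rewrite arc_PI, arc_2PI in El.
    match type of Eu with Cmod ?X <= _ => set (xu := X) in * end.
    match type of El with Cmod ?X <= _ => set (xl := X) in * end.
    match type of B1 with Cmod ?X <= _ => set (x1 := X) in * end.
    match type of B2 with Cmod ?X <= _ => set (x2 := X) in * end.
    replace (Ci * ((Iu - u (RtoC a) * Wu) + (Il - l (RtoC a) * Wl)))%C with (xu + xl + - x1 + x2)%C
      by (unfold xu, xl, x1, x2; ring).
    le_trans Cmod_triangle.
    eapply Rle_trans; [apply Rplus_le_compat_r, Cmod_triangle |].
    eapply Rle_trans; [apply Rplus_le_compat_r, Rplus_le_compat_r, Cmod_triangle |].
    rewrite Cmod_opp; lra. }
  rewrite <- (Hul a) in Z by lra.
  assert (E : (Iu + Il - u (RtoC a) * (Wu + Wl))%C = 0%C).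
  { transitivity (- Ci * (Ci * ((Iu - u (RtoC a) * Wu) + (Il - u (RtoC a) * Wl))))%C.
    - replace (Iu + Il - u (RtoC a) * (Wu + Wl))%C with
        (- (Ci * Ci) * (Iu + Il - u (RtoC a) * (Wu + Wl)))%C; [ring |].
      replace (Ci * Ci)%C with (- (1))%C; [ring |].
      cring.
    - rewrite Z; ring. }
  replace (Iu + Il)%C with ((Iu + Il - u (RtoC a) * (Wu + Wl)) + u (RtoC a) * (Wu + Wl))%C by ring.
  rewrite E; ring.
Qed.

(** * Dividing out real zeros, and a Schwarz lemma *)

Definition nodes (l0 : list R) (z : C) : C :=
  fold_right (fun (a : R) w => ((z - RtoC a) * w)%C) (RtoC 1) l0.

Lemma nodes_arc_neq0 l0 t : (forall a, In a l0 -> Rabs a < r) -> nodes l0 (arc t) <> 0%C.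
Proof.
  intros H0; induction l0 as [| a l0 IH]; simpl.
  - intros E; apply RtoC_inj in E; lra.
  - apply Cmult_neq_0; [apply arc_sub_neq0; rewrite Cmod_R; apply H0; left; auto |].
    apply IH; intros; apply H0; right; auto.
Qed.

Lemma nodes_real_neq0 l0 (a : R) : ~ In a l0 -> nodes l0 (RtoC a) <> 0%C.
Proof.
  induction l0 as [| b l0 IH]; simpl; intros N.
  - intros E; apply RtoC_inj in E; lra.
  - apply Cmult_neq_0; [| apply IH; auto].
    rewrite <- RtoC_minus; intros E; apply RtoC_inj in E; apply N; left; lra.
Qed.

Lemma ctsC_nodes l0 t : ctsC (fun t => nodes l0 (arc t)) t.
Proof.
  induction l0 as [| b l0 IH]; simpl; [apply ctsC_const |].
  apply ctsC_mul; [apply ctsC_sub; [apply ctsC_arc | apply ctsC_const] | exact IH].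
Qed.

(** With dz = i z dt on the circle, this is up to the factor i the form dz / ((z - c) prod (z - a))
    of Newton's interpolation remainder. *)
Definition newton_kernel l0 (c : C) (t : R) : C := (arc t * / (arc t - c) * / nodes l0 (arc t))%C.

Lemma ctsC_newton_kernel l0 c t : (forall a, In a l0 -> Rabs a < r) -> Cmod c < r ->
  ctsC (newton_kernel l0 c) t.
Proof.
  intros H0 Hc; unfold newton_kernel; apply ctsC_mul.
  - cts.
  - apply ctsC_inv; [apply ctsC_nodes | apply nodes_arc_neq0, H0].
Qed.

                                                                                                
                                                              
(** Partial fractions: (c - a) / ((z - c)(z - a)) = 1/(z - c) - 1/(z - a). By induction the integral
    of the second term, times the remaining node polynomial at a, is the Cauchy integral at a, which
    vanishes with u(a); distinctness of the nodes makes that polynomial nonzero. Cauchy's formula is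
    thus used only at the real nodes, and c may be any point of the disc. *)
Lemma newton_zeros l0 : NoDup l0 -> (forall a, In a l0 -> Rabs a < r /\ u (RtoC a) = 0%C) ->
  forall c I0 I, Cmod c < r ->
  isCI (fun t => (glued t * (arc t * / (arc t - c)))%C) 0 (2 * PI) I0 ->
  isCI (fun t => (glued t * newton_kernel l0 c t)%C) 0 (2 * PI) I ->
  I0 = (nodes l0 c * I)%C.
Proof.
  induction l0 as [| a l0 IH]; intros ND H0 c I0 I Hc HI0 HI.
  - simpl; rewrite Cmult_1_l; apply (isCI_unique _ _ _ _ _ HI0).
    eapply isCI_ext; [| | exact HI]; [generalize PI_RGT_0; lra |].
    intros s _; unfold newton_kernel; simpl; f_equal.
    assert (N := arc_sub_neq0 s c Hc); field; auto.
  - inversion ND as [| ? ? Na NDl]; subst.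
    destruct (H0 a (or_introl eq_refl)) as [Ha Ua].
    assert (Ha' : Cmod (RtoC a) < r) by (rewrite Cmod_R; exact Ha).
    assert (Hl0 : forall b, In b l0 -> Rabs b < r) by (intros b Hb; apply H0; right; auto).
    destruct (glued_ex (newton_kernel l0 c)) as [Jc HJc];
      [intros; apply ctsC_newton_kernel; auto |].
    destruct (glued_ex (newton_kernel l0 (RtoC a))) as [Ja HJa];
      [intros; apply ctsC_newton_kernel; auto |].
    destruct (glued_ex (fun t => arc t * / (arc t - RtoC a))%C) as [Ia HIa];
      [intros; cts |].
    destruct (isCI_ex (fun t => arc t * / (arc t - RtoC a))%C 0 (2 * PI)) as [W HW];
      [generalize PI_RGT_0; lra | intros; cts |].
    assert (IHl := IH NDl (fun b Hb => H0 b (or_intror Hb))).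
    assert (Ja0 : Ja = 0%C).
    { assert (E := cauchy_glued a Ia W Ha HIa HW).
      rewrite (IHl (RtoC a) Ia Ja Ha' HIa HJa), Ua, Cmult_0_l in E.
      destruct (Ceq_dec Ja 0%C) as [| N]; auto; exfalso.
      revert E; apply Cmult_neq_0; auto; apply nodes_real_neq0, Na. }
    rewrite (IHl c I0 Jc Hc HI0 HJc); simpl.
    assert (E : ((c - RtoC a) * I = Jc - Ja)%C).
    { eapply isCI_unique; [apply isCI_scal, HI |].
      eapply isCI_ext; [| | apply isCI_sub; [exact HJc | exact HJa]]; [generalize PI_RGT_0; lra |].
      intros s _; unfold newton_kernel; simpl.
      assert (N1 := arc_sub_neq0 s c Hc); assert (N2 := arc_sub_neq0 s (RtoC a) Ha').
      assert (N3 := nodes_arc_neq0 l0 s Hl0).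
      field; auto. }
    rewrite Ja0 in E.
    replace Jc with ((c - RtoC a) * I)%C; [ring |].
    rewrite E; ring.
Qed.

Lemma Cmod_nodes_le l0 c b : 0 <= b -> (forall a, In a l0 -> Cmod (c - RtoC a) <= b) ->
  Cmod (nodes l0 c) <= b ^ length l0.
Proof.
  intros Hb H0; induction l0 as [| a l0 IH]; simpl; [rewrite Cmod_1; lra |].
  rewrite Cmod_mult; apply Rmult_le_compat; auto using Cmod_ge_0.
  - apply H0; left; auto.
  - apply IH; intros; apply H0; right; auto.
Qed.

Lemma Cmod_nodes_ge l0 c b : 0 <= b -> (forall a, In a l0 -> b <= Cmod (c - RtoC a)) ->
  b ^ length l0 <= Cmod (nodes l0 c).
Proof.
  intros Hb H0; induction l0 as [| a l0 IH]; simpl; [rewrite Cmod_1; lra |].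
  rewrite Cmod_mult; apply Rmult_le_compat; auto using pow_le.
  - apply H0; left; auto.
  - apply IH; intros; apply H0; right; auto.
Qed.

(** On the circle every node is at distance at least r - rho, while c is within |c| + rho of it, so
    each zero gains the quotient of these two lengths. *)
Lemma newton_integral_bound l0 K rho c I0 : 0 <= rho < r -> Cmod c < r ->
  NoDup l0 -> (forall a, In a l0 -> Rabs a <= rho /\ u (RtoC a) = 0%C) ->
  (forall z, upper_disc r z -> Cmod (u z) <= K) -> (forall z, lower_disc r z -> Cmod (l z) <= K) ->
  isCI (fun t => (glued t * (arc t * / (arc t - c)))%C) 0 (2 * PI) I0 ->
  Cmod I0 <= 4 * PI * K * (r * / (r - Cmod c)) * ((Cmod c + rho) / (r - rho)) ^ length l0.
Proof.
  intros Hrho Hc ND H0 Ku Kl HI0.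
  assert (Pi := PI_RGT_0).
  assert (Hl0 : forall a, In a l0 -> Rabs a < r) by (intros a Ha; destruct (H0 a Ha); lra).
  destruct (glued_ex (newton_kernel l0 c)) as [I HI]; [intros; apply ctsC_newton_kernel; auto |].
  rewrite (newton_zeros l0 ND (fun a Ha => conj (Hl0 a Ha) (proj2 (H0 a Ha))) c I0 I Hc HI0 HI).
  assert (PK : 0 <= K).
  { eapply Rle_trans; [apply Cmod_ge_0 | apply (Ku (RtoC 0))].
    apply real_in_upper; rewrite Rabs_R0; lra. }
  assert (Pc := Cmod_ge_0 c).
  assert (Pn : 0 < (r - rho) ^ length l0) by (apply pow_lt; lra).
  assert (Pk : 0 < / (r - Cmod c)) by (apply Rinv_0_lt_compat; lra).
  assert (B1 : Cmod (nodes l0 c) <= (Cmod c + rho) ^ length l0).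
  { apply Cmod_nodes_le; [lra |]; intros a Ha; destruct (H0 a Ha).
    le_trans Cmod_triangle; rewrite Cmod_opp, Cmod_R; lra. }
  assert (B2 : Cmod I <= 2 * ((2 * PI - 0) * (K * (r * / (r - Cmod c) * / (r - rho) ^ length l0)))).
  { apply (isCI_bound _ 0 (2 * PI) I _ ltac:(lra) HI); intros t Ht.
    rewrite Cmod_mult; apply Rmult_le_compat; auto using Cmod_ge_0.
    - apply glued_bound; auto.
    - unfold newton_kernel; rewrite !Cmod_mult, Cmod_arc.
      apply Rmult_le_compat; auto using Cmod_ge_0.
      + apply Rmult_le_pos; [lra | apply Cmod_ge_0].
      + apply Rmult_le_compat_l; [lra |]; apply Cmod_inv_le; [lra | apply arc_sub_ge].
      + apply Cmod_inv_le; [exact Pn |]; apply Cmod_nodes_ge; [lra |].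
        intros a Ha; eapply Rle_trans; [| apply arc_sub_ge]; rewrite Cmod_R; destruct (H0 a Ha); lra. }
  rewrite Cmod_mult; unfold Rdiv; rewrite Rpow_mult_distr, pow_inv.
  replace (4 * PI * K * (r * / (r - Cmod c)) * ((Cmod c + rho) ^ length l0 * / (r - rho) ^ length l0))
    with ((Cmod c + rho) ^ length l0 * (2 * ((2 * PI - 0) * (K * (r * / (r - Cmod c) * / (r - rho) ^ length l0))))) by ring.
  apply Rmult_le_compat; auto using Cmod_ge_0.
Qed.

Lemma center_bound l0 K rho : 0 <= rho < r ->
  NoDup l0 -> (forall a, In a l0 -> Rabs a <= rho /\ u (RtoC a) = 0%C) ->
  (forall z, upper_disc r z -> Cmod (u z) <= K) -> (forall z, lower_disc r z -> Cmod (l z) <= K) ->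
  Cmod (u (RtoC 0)) <= 2 * K * (rho / (r - rho)) ^ length l0.
Proof.
  intros Hrho ND H0 Ku Kl.
  assert (Pi := PI_RGT_0).
  assert (H0r : Cmod (RtoC 0) < r) by (rewrite Cmod_0; lra).
  assert (Ck : forall t, ctsC (fun t => (arc t * / (arc t - RtoC 0))%C) t).
  { intros t; cts. }
  destruct (glued_ex _ Ck) as [I0 HI0].
  assert (HW : isCI (fun t => (arc t * / (arc t - RtoC 0))%C) 0 (2 * PI) (RtoC (2 * PI))).
  { eapply isCI_ext with (f := fun _ => RtoC 1); [lra | |].
    - intros s _; assert (N := arc_sub_neq0 s _ H0r).
      replace (arc s - RtoC 0)%C with (arc s) in * by ring.
      rewrite Cinv_r; auto.
    - eapply isCI_eq; [apply isCI_cder with (f := fun t => RtoC t) |].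
      + lra.
      + intros; apply cder_lin.
      + intros; apply ctsC_const.
      + cbv beta; ring. }
  assert (E := cauchy_glued 0 I0 _ ltac:(rewrite Rabs_R0; lra) HI0 HW).
  assert (B := newton_integral_bound l0 K rho (RtoC 0) I0 Hrho H0r ND H0 Ku Kl HI0).
  rewrite E, Cmod_mult, Cmod_R, Cmod_0, (Rabs_pos_eq (2 * PI)), Rplus_0_l, Rminus_0_r, Rinv_r in B by lra.
  apply Rmult_le_reg_r with (2 * PI); [lra |].
  eapply Rle_trans; [exact B |]; right; ring.
Qed.
End Glue.

(** * Identity theorems by inserting arbitrarily many zeros *)

Lemma geometric_zero (x A q : R) : 0 <= x -> 0 <= q < 1 -> (forall n, x <= A * q ^ n) -> x = 0.
Proof.
  intros Hx Hq E; destruct Hx as [Hx | Hx]; [exfalso | auto].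
  assert (PA : 0 < Rabs A + 1) by (generalize (Rabs_pos A); lra).
  destruct (pow_lt_1_zero q ltac:(rewrite Rabs_pos_eq; lra) (x / (Rabs A + 1))) as [N HN].
  { apply Rdiv_lt_0_compat; lra. }
  specialize (HN N (le_n N)); specialize (E N).
  rewrite Rabs_pos_eq in HN by (apply pow_le; lra).
  apply (Rmult_lt_compat_r (Rabs A + 1)) in HN; [| lra].
  replace (x / (Rabs A + 1) * (Rabs A + 1)) with x in HN by (field; lra).
  assert (P := pow_le q N (proj1 Hq)); assert (L := Rle_abs A); nra.
Qed.

Lemma distinct_points (a b : R) n : a < b ->
  exists l, NoDup l /\ length l = n /\ forall x, In x l -> a < x < b.
Proof.
  intros Hab.
  (* The offset 2 keeps the first point strictly below b. *)
  set (f := fun i => a + (b - a) / INR (i + 2)).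
  exists (map f (seq 0 n)).
  assert (Hp : forall i, 0 < INR (i + 2)) by (intros i; apply lt_0_INR; lia).
  repeat split.
  - apply NoDup_map_NoDup_ForallPairs; [| apply seq_NoDup].
    intros i j _ _ E; unfold f in E.
    assert (Hi := Hp i); assert (Hj := Hp j).
    assert (E' : / INR (i + 2) = / INR (j + 2)).
    { apply Rmult_eq_reg_l with (b - a); [unfold Rdiv in E; lra | lra]. }
    apply (f_equal Rinv) in E'; rewrite !Rinv_inv in E'; apply INR_eq in E'; lia.
  - rewrite length_map, length_seq; reflexivity.
  - apply in_map_iff in H as [i [<- _]]; unfold f.
    assert (0 < (b - a) / INR (i + 2)) by (apply Rdiv_lt_0_compat; auto; lra); lra.
  - apply in_map_iff in H as [i [<- _]]; unfold f.
    assert (2 <= INR (i + 2)) by (replace 2 with (INR 2) by reflexivity; apply le_INR; lia).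
    apply Rplus_lt_reg_l with (- a).
    apply Rmult_lt_reg_r with (INR (i + 2)); [auto |].
    replace ((- a + (a + (b - a) / INR (i + 2))) * INR (i + 2)) with (b - a) by (field; lra).
    nra.
Qed.

Definition disc (r : R) (z : C) : Prop := Cmod z <= r.

(** Gluing f to itself makes the Schwarz bound available with any number of zeros from (a, b); the
    factors 2 in the hypotheses make rho / (r - rho) smaller than 1. *)
Lemma center_zero r f (a b : R) : approx (disc r) f -> a < b -> 2 * Rabs a < r -> 2 * Rabs b < r ->
  (forall x : R, a < x < b -> f (RtoC x) = 0%C) -> f (RtoC 0) = 0%C.
Proof.
  intros Hf Hab Ha Hb Hz.
  assert (Pa := Rabs_pos a); assert (Pb := Rabs_pos b).
  destruct (approx_bounded (disc r) r f ltac:(lra) (fun z Hz => Hz) Hf) as [K HK].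
  set (rho := Rmax (Rabs a) (Rabs b)).
  assert (M1 : Rabs a <= rho) by apply Rmax_l; assert (M2 : Rabs b <= rho) by apply Rmax_r.
  assert (M3 : 2 * rho < r) by (unfold rho, Rmax; destruct Rle_dec; lra).
  apply Cmod_eq_0, geometric_zero with (2 * K) (rho / (r - rho)); [apply Cmod_ge_0 | |].
  - split; [apply Rdiv_le_0_compat; lra |].
    apply Rmult_lt_reg_r with (r - rho); [lra |].
    unfold Rdiv; rewrite Rmult_assoc, Rinv_l by lra; lra.
  - intros n; destruct (distinct_points a b n Hab) as [l0 [ND [Ln Hl]]]; rewrite <- Ln.
    apply (center_bound r f f); auto; try lra.
    + apply approx_sub with (2 := Hf); intros z [H _]; exact H.
    + apply approx_sub with (2 := Hf); intros z [H _]; exact H.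
    + intros x Hx; specialize (Hl x Hx); split; [| auto].
      apply Rabs_le_between in M1; apply Rabs_le_between in M2; apply Rabs_le_between; lra.
    + intros z [H _]; auto.
    + intros z [H _]; auto.
Qed.

(** Cauchy's formula on the boundary of the half-disc, where the diameter contributes nothing
    because u vanishes on it. The weight W is really 2 pi i, but only W <> 0 is needed, and this
    follows from a sign. *)
Lemma half_disc_cauchy r u c I : 0 < c < r -> approx (upper_disc r) u ->
  (forall x : R, Rabs x <= r -> u (RtoC x) = 0%C) ->
  isCI (fun t => (u (arc r t) * (arc r t * / (arc r t - (0, c))))%C) 0 PI I ->
  exists W : C, W <> 0%C /\ (Ci * I)%C = (u (0, c) * W)%C.
Proof.
  intros Hc Hu Hz HI.
  assert (Pi := PI_RGT_0).
  assert (HCc := pure_im_Cmod c ltac:(lra)).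
  assert (Hc' : Cmod (0, c) < r) by lra.
  assert (Hr : 0 < r) by lra.
  set (k := fun t => (arc r t * / (arc r t - (0, c)))%C).
  set (m := fun t : R => (/ (RtoC t - (0, c)))%C).
  assert (Hm0 : forall t, (RtoC t - (0, c))%C <> 0%C).
  { intros t E; apply (f_equal Im) in E; simpl in E; lra. }
  assert (Ck : forall t, ctsC k t) by (intros t; apply ctsC_mul; [apply ctsC_arc | apply ctsC_ker; auto]).
  assert (Cm : forall t, ctsC m t).
  { intros t; apply ctsC_inv; [| apply Hm0].
    apply ctsC_sub; [apply ctsC_RtoC | apply ctsC_const]. }
  destruct (isCI_ex k 0 PI) as [A HA]; [lra | auto |].
  destruct (isCI_ex m (- r) r) as [B HB]; [lra | auto |].
  exists (Ci * A + B)%C; split.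
  -                                                      
    (* The imaginary part of W is Re A + Im B; the arc part is positive and the diameter part
       nonnegative. *)
    assert (PA : 0 < Re A).
    { assert (L : 0 < (r - c) / (r + c)) by (apply Rdiv_lt_0_compat; lra).
      apply Rlt_le_trans with ((r - c) / (r + c) * (PI - 0)); [nra |].
      apply (is_RInt_le (fun _ => (r - c) / (r + c)) (fun t => Re (k t)) 0 PI); [lra | | apply HA |].
      - evar_last; [apply @is_RInt_const |]; unfold scal, mult; simpl; unfold mult; simpl; ring.
      - intros t _; unfold k.
        assert (N := arc_sub_neq0 r Hr t _ Hc').
        assert (E := Cmod_sqr (arc r t)); rewrite (Cmod_arc r Hr) in E.
        apply Cneq0_sqr in N.
        destruct (arc r t) as [x y]; simpl in *.
        set (d := (x + - 0) * (x + - 0) + (y + - c) * (y + - c)) in *.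
        assert (Pd0 : 0 <= d) by (apply Rplus_le_le_0_compat; apply Rle_0_sqr).
        assert (Pd : 0 < d) by (destruct Pd0 as [| Pd0]; [auto | exfalso; apply N; auto]).
        match goal with |- _ <= ?X => replace X with ((r * r - c * y) / d)
          by (rewrite E; unfold d in *; field; lra) end.
        apply Rmult_le_reg_r with d; [auto |].
        replace ((r * r - c * y) / d * d) with (r * r - c * y) by (field; lra).
        apply Rmult_le_reg_r with (r + c); [lra |].
        replace ((r - c) / (r + c) * d * (r + c)) with ((r - c) * d) by (field; lra).
        assert (Ed : d = r * r - 2 * c * y + c * c) by (unfold d; rewrite E; ring).
        assert (Hy2 : y * y <= r * r) by (generalize (Rle_0_sqr x); unfold Rsqr; lra).
        assert (Hy : - r <= y <= r) by (split; apply Rnot_lt_le; intros ?; nra).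
        rewrite Ed.
        (* The gap in the inequality is affine in y, and 2 r times it is the expression in [A3], the
           interpolation between its nonnegative values at y = r and y = - r. *)
        assert (A1 : 0 <= (r + y) * ((3 * r - c) * (r - c))) by (repeat apply Rmult_le_pos; lra).
        assert (A2 : 0 <= (r - y) * ((r + c) * (r + c))) by (repeat apply Rmult_le_pos; lra).
        assert (A3 : 0 <= c * ((r + y) * ((3 * r - c) * (r - c)) + (r - y) * ((r + c) * (r + c))))
          by (apply Rmult_le_pos; lra).
        apply Rmult_le_reg_l with (2 * r); [lra |]; lra. }
    assert (PB : 0 <= Im B).
    { apply (is_RInt_ge_0 (fun t => Im (m t)) (- r) r); [lra | apply HB |].
      intros t _; unfold m; simpl.
      apply Rdiv_le_0_compat; nra. }
    intros E; apply (f_equal Im) in E; simpl in E; unfold Re, Im in *; lra.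
  - assert (Z : (Ci * I - u (0, c) * (Ci * A + B))%C = 0%C).
    { assert (Pk : 0 < / (r - c)) by (apply Rinv_0_lt_compat; lra).
      assert (PQ : 0 < r * / (r - c)) by (apply Rmult_lt_0_compat; lra).
      assert (Pc : 0 < / c) by (apply Rinv_0_lt_compat; lra).
      apply Cmod_small_eq0 with (4 * PI * (r * / (r - c)) + 8 * r * / c);
        [assert (0 < r * / c) by nra; nra |].
      intros eps He.
      destruct (Hu eps ltac:(lra)) as [p [Pp Hp]].
      destruct (divided_difference_primitive (0, c) p (MPol_of_Pol _ _ Pp)) as [P HP].
      assert (HX : isCI (fun t => ((p (arc r t) - p (0, c)) * / (arc r t - (0, c)) * (Ci * arc r t))%C) 0 PI
        (P (arc r PI) - P (arc r 0))%C).
      { apply (isCI_cder (fun t => P (arc r t))); [lra | |].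
        - intros t _; apply HP; [apply cder_arc | apply arc_neq; auto].
        - intros t _; apply ctsC_mul; [apply ctsC_mul; [| apply ctsC_ker; auto] |].
          + apply ctsC_sub; [apply Pol_ctsC; auto using ctsC_arc | apply ctsC_const].
          + apply ctsC_mul; [apply ctsC_const | apply ctsC_arc]. }
      assert (HY : isCI (fun t => ((p (RtoC t) - p (0, c)) * / (RtoC t - (0, c)) * 1)%C) (- r) r
        (P (RtoC r) - P (RtoC (- r)))%C).
      { apply (isCI_cder (fun t : R => P (RtoC t))); [lra | |].
        - intros t _; apply (HP (fun t : R => RtoC t)); [apply cder_lin |].
          intros E; apply (f_equal Im) in E; simpl in E; lra.
        - intros t _; apply ctsC_mul; [apply ctsC_mul; [| apply Cm] | apply ctsC_const].
          apply ctsC_sub; [apply Pol_ctsC; auto using ctsC_RtoC | apply ctsC_const]. }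
      rewrite (arc_PI r), (arc_0 r) in HX.
      assert (H1 : isCI (fun t => (Ci * (u (arc r t) * k t) - Ci * (u (0, c) * k t)
          - (p (arc r t) - p (0, c)) * / (arc r t - (0, c)) * (Ci * arc r t))%C) 0 PI
        (Ci * I - Ci * (u (0, c) * A) - (P (RtoC (- r)) - P (RtoC r)))%C).
      { apply isCI_sub; [| exact HX]; apply isCI_sub; apply isCI_scal; [exact HI | apply isCI_scal, HA]. }
      assert (H2 : isCI (fun t : R => (u (0, c) * m t
          + (p (RtoC t) - p (0, c)) * / (RtoC t - (0, c)) * 1)%C) (- r) r
        (u (0, c) * B + (P (RtoC r) - P (RtoC (- r))))%C).
      { apply isCI_add; [apply isCI_scal, HB | exact HY]. }
      assert (Dc : upper_disc r (0, c)) by (split; simpl; lra).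
      assert (Xc := Hp _ Dc).
      assert (B1 := isCI_bound _ 0 PI _ (2 * eps * (r * / (r - c))) ltac:(lra) H1).
      assert (B2 := isCI_bound _ (- r) r _ (2 * eps * / c) ltac:(lra) H2).
      match type of B1 with _ -> Cmod ?X <= _ => set (x1 := X) in * end.
      match type of B2 with _ -> Cmod ?X <= _ => set (x2 := X) in * end.
      replace (Ci * I - u (0, c) * (Ci * A + B))%C with (x1 + - x2)%C by (unfold x1, x2; ring).
      le_trans Cmod_triangle; rewrite Cmod_opp.
      replace ((4 * PI * (r * / (r - c)) + 8 * r * / c) * eps) with
        (2 * ((PI - 0) * (2 * eps * (r * / (r - c)))) + 2 * ((r - - r) * (2 * eps * / c))) by ring.
      apply Rplus_le_compat; [apply B1 | apply B2]; clear B1 B2.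
      - intros t Ht; assert (N := arc_sub_neq0 r Hr t _ Hc').
        unfold k.
        match goal with |- Cmod ?X <= _ => replace X with
          (((u (arc r t) - p (arc r t)) + - (u (0, c) - p (0, c))) * (Ci * (arc r t * / (arc r t - (0, c)))))%C
          by ring end.
        assert (X1 := Hp _ (arc_in_upper r Hr t Ht)).
        rewrite Cmod_mult; apply Rmult_le_compat; auto using Cmod_ge_0.
        + le_trans Cmod_triangle; rewrite Cmod_opp; lra.
        + rewrite !Cmod_mult, (Cmod_arc r Hr).
          rewrite Cmod_Ci, Rmult_1_l; apply Rmult_le_compat_l; [lra |].
          apply Cmod_inv_le; [lra |]; rewrite <- HCc at 1; apply arc_sub_ge, Hr.
      - intros t Ht.
        assert (Ht' : Rabs t <= r) by (apply Rabs_le_between; lra).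
        assert (X1 := Hp _ (real_in_upper r t Ht')); rewrite (Hz t Ht') in X1.
        unfold m.
        match goal with |- Cmod ?X <= _ => replace X with
          (((u (0, c) - p (0, c)) + - (0 - p (RtoC t))) * (/ (RtoC t - (0, c))))%C
          by ring end.
        rewrite Cmod_mult; apply Rmult_le_compat; auto using Cmod_ge_0.
        + le_trans Cmod_triangle; rewrite Cmod_opp; lra.
        + apply Cmod_inv_le; [lra |].
          eapply Rle_trans; [| apply im_le_Cmod]; simpl.
          rewrite <- Rabs_Ropp, Rabs_pos_eq; lra. }
    replace (Ci * I)%C with ((Ci * I - u (0, c) * (Ci * A + B)) + u (0, c) * (Ci * A + B))%C by ring.
    rewrite Z; ring.
Qed.

(** A function vanishing on the diameter is glued to zero below it. All real points near 0 are then
    nodes, so the arc integral is smaller than every multiple of q^n and vanishes;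
    [half_disc_cauchy] turns this into the vanishing of u(i c). *)
Lemma half_disc_zero r u c : 0 < c < r -> approx (upper_disc r) u ->
  (forall x : R, Rabs x <= r -> u (RtoC x) = 0%C) -> u (0, c) = 0%C.
Proof.
  intros Hc Hu Hz.
  assert (Pi := PI_RGT_0).
  assert (HCc := pure_im_Cmod c ltac:(lra)).
  assert (Hc' : Cmod (0, c) < r) by lra.
  assert (Hr : 0 < r) by lra.
  destruct (approx_bounded (upper_disc r) r u ltac:(lra) (fun z Hz => proj1 Hz) Hu) as [K HK].
  assert (Hl := approx_zero (lower_disc r)).
  assert (Ck : forall t, ctsC (fun t => (arc r t * / (arc r t - (0, c)))%C) t)
    by (intros t; apply ctsC_mul; [apply ctsC_arc | apply ctsC_ker; auto]).
  destruct (isCI_ex_approx r (upper_disc r) u _ 0 PI ltac:(lra) Hu (arc_in_upper r Hr) Ck) as [I HI].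
  assert (HJ : isCI (fun t => (0 * (arc r t * / (arc r t - (0, c))))%C) PI (2 * PI) 0%C).
  { eapply isCI_ext with (f := fun _ => RtoC 0); [lra | intros; ring |].
    eapply isCI_eq; [apply isCI_cder with (f := fun _ => RtoC 0) |].
    - lra.
    - intros; apply cder_const.
    - intros; apply ctsC_const.
    - cbv beta; ring. }
  assert (HG := glued_split r u (fun _ => 0%C) _ _ _ HI HJ); rewrite Cplus_0_r in HG.
  assert (PK : 0 <= K).
  { eapply Rle_trans; [apply Cmod_ge_0 | apply (HK (RtoC 0))].
    apply real_in_upper; rewrite Rabs_R0; lra. }
  assert (I0 : I = 0%C).
  (* Any rho with c + 2 rho < r gives a ratio below 1. *)
  { set (rho := (r - c) / 4).
    assert (Prho : 0 < rho) by (unfold rho; lra).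
    apply Cmod_eq_0, geometric_zero with (4 * PI * K * (r * / (r - Cmod (0, c)))) ((Cmod (0, c) + rho) / (r - rho));
      [apply Cmod_ge_0 | |].
    - rewrite HCc; split; [apply Rdiv_le_0_compat; unfold rho; lra |].
      apply Rmult_lt_reg_r with (r - rho); [unfold rho; lra |].
      unfold Rdiv; rewrite Rmult_assoc, Rinv_l by (unfold rho; lra); unfold rho; lra.
    - intros n; destruct (distinct_points 0 rho n Prho) as [l0 [ND [Ln Hl0]]]; rewrite <- Ln.
      apply (newton_integral_bound r u (fun _ => 0%C) Hr Hu Hl); auto.
      + unfold rho; lra.
      + intros x Hx; specialize (Hl0 x Hx); rewrite Rabs_pos_eq by lra; split; [lra |].
        apply Hz; rewrite Rabs_pos_eq; unfold rho in Hl0; lra.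
      + intros z _; rewrite Cmod_0; auto. }
  destruct (half_disc_cauchy r u c I Hc Hu Hz HI) as [W [NW E]].
  rewrite I0, Cmult_0_r in E.
  destruct (Ceq_dec (u (0, c)) 0%C) as [| N]; auto; exfalso.
  symmetry in E; revert E; apply Cmult_neq_0; auto.
Qed.

                                                  

(** * The Hilbert space as a complete normed module over the reals, to integrate vector-valued
    functions *)

Section Instances.
Variable H : HilbertSpace.

Definition hball (x : H) (e : R) (y : H) : Prop := hnorm (hsub y x) < e.

Lemma hball_refl (x : H) (e : posreal) : hball x e x.
Proof.
  unfold hball; replace (hsub x x) with (@hzero H) by vec.
  rewrite hnorm_0; apply cond_pos.
Qed.

Lemma hball_sym (x y : H) (e : R) : hball x e y -> hball y e x.
Proof. unfold hball; rewrite hnorm_sub_comm; auto. Qed.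

Lemma hball_tri (x y z : H) (e1 e2 : R) : hball x e1 y -> hball y e2 z -> hball x (e1 + e2) z.
Proof. unfold hball; intros A B; assert (T := hnorm_sub_tri y z x); lra. Qed.

Definition H_AbelianMonoid_mixin := AbelianMonoid.Mixin H hadd hzero (hadd_comm H)
  (fun x y z => hadd_assoc H x y z) (fun x => hadd_0r x).
Definition H_AbelianMonoid := AbelianMonoid.Pack H H_AbelianMonoid_mixin H.
Definition H_AbelianGroup_mixin := AbelianGroup.Mixin H_AbelianMonoid hopp (hadd_opp H).
Definition H_AbelianGroup := AbelianGroup.Pack H (AbelianGroup.Class _ _ H_AbelianGroup_mixin) H.

Definition H_ModuleSpace_mixin : ModuleSpace.mixin_of R_Ring H_AbelianGroup.
Proof.
  refine (ModuleSpace.Mixin R_Ring H_AbelianGroup (fun a (x : H) => sc (RtoC a) x) _ _ _ _).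
  - intros a b x; change (sc (RtoC a) (sc (RtoC b) x) = sc (RtoC (a * b)) x).
    rewrite RtoC_mult; vec.
  - intros x; apply sc_1.
  - intros a x y; change (sc (RtoC a) (hadd x y) = hadd (sc (RtoC a) x) (sc (RtoC a) y)); vec.
  - intros a b x; change (sc (RtoC (a + b)) x = hadd (sc (RtoC a) x) (sc (RtoC b) x)).
    rewrite RtoC_plus; vec.
Defined.

Definition H_UniformSpace_mixin := UniformSpace.Mixin H hzero hball hball_refl hball_sym hball_tri.
Definition H_NormedModuleAux_class := NormedModuleAux.Class R_AbsRing H
  (ModuleSpace.Class R_Ring H (AbelianGroup.Class _ _ H_AbelianGroup_mixin) H_ModuleSpace_mixin) H_UniformSpace_mixin.
Definition H_NormedModuleAux := NormedModuleAux.Pack R_AbsRing H H_NormedModuleAux_class H.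

Definition H_NormedModule_mixin : NormedModule.mixin_of R_AbsRing H_NormedModuleAux.
Proof.
  refine (NormedModule.Mixin R_AbsRing H_NormedModuleAux (fun x : H => hnorm x) 1 _ _ _ _ _).
  - intros x y; apply hnorm_add.
  - intros a x; change (hnorm (sc (RtoC a) x) <= Rabs a * hnorm x).
    rewrite hnorm_sc, Cmod_R; lra.
  - intros x y eps E; exact E.
  - intros x y eps E; rewrite Rmult_1_l; exact E.
  - intros x E; apply hnorm_eq0, E.
Defined.
Definition H_NormedModule_class := NormedModule.Class R_AbsRing H H_NormedModuleAux_class H_NormedModule_mixin.

Definition H_UniformSpace := UniformSpace.Pack H H_UniformSpace_mixin H.

(** Completeness in Coquelicot asks for a limit as a function of the filter, hence the choice
    operator; on filters that do not converge the value is arbitrary. *)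
Definition H_lim (F : (H -> Prop) -> Prop) : H :=
  epsilon (inhabits hzero) (fun l => forall eps : posreal, F (hball l eps)).

Lemma H_lim_spec (F : (H_UniformSpace -> Prop) -> Prop) : ProperFilter F -> cauchy F ->
  forall eps : posreal, F (ball (H_lim F : H_UniformSpace) eps).
Proof.
  intros PF CF.
  cut (exists l : H, forall eps : posreal, F (hball l eps)).
  { intros E; exact (epsilon_spec (inhabits hzero) (fun l : H => forall eps : posreal, F (hball l eps)) E). }
  assert (Pn : forall n : nat, 0 < / (INR n + 1)) by (intros n; apply Rinv_0_lt_compat; generalize (pos_INR n); lra).
  (* Sequential completeness suffices: choose centres of balls of radius 1/(n+1) in the filter. Any
     two of these balls meet, so the centres form a Cauchy sequence. *)
  assert (Hx : forall n : nat, {x : H | F (hball x (/ (INR n + 1)))}).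
  { intros n; apply constructive_indefinite_description; apply (CF (mkposreal _ (Pn n))). }
  set (x := fun n => proj1_sig (Hx n)).
  assert (HF : forall n, F (hball (x n) (/ (INR n + 1)))) by (intros n; apply (proj2_sig (Hx n))).
  assert (Hd : forall m n, hnorm (hsub (x m) (x n)) < / (INR m + 1) + / (INR n + 1)).
  { intros m n.
    destruct (filter_ex _ (filter_and _ _ (HF m) (HF n))) as [y [A B]].
    assert (T := hnorm_sub_tri y (x m) (x n)); unfold hball in *.
    rewrite (hnorm_sub_comm (x m) y) in T; lra. }
  assert (Harch : forall e, 0 < e -> exists N : nat, forall n, (N <= n)%nat -> / (INR n + 1) < e).
  { intros e He; destruct (archimed_cor1 e He) as [N [HN PN]]; exists N; intros n Hn.
    apply Rle_lt_trans with (2 := HN); apply Rinv_le_contravar; [apply lt_0_INR, PN |].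
    apply le_INR in Hn; lra. }
  destruct (hlim_complete x) as [l Hl].
  { intros e He; destruct (Harch (e / 2) ltac:(lra)) as [N HN]; exists N; intros m n Hm Hn.
    specialize (Hd m n); assert (A := HN m Hm); assert (B := HN n Hn); lra. }
  exists l; intros eps; assert (Pe := cond_pos eps).
  destruct (Harch (eps / 2) ltac:(lra)) as [N1 H1].
  destruct (Hl (eps / 2) ltac:(lra)) as [N2 H2].
  set (n := (N1 + N2)%nat).
  apply filter_imp with (2 := HF n); intros y Hy; unfold hball in *.
  assert (A := H1 n ltac:(lia)); assert (B := H2 n ltac:(lia)).
  assert (T := hnorm_sub_tri (x n) y l); lra.
Qed.

Lemma H_lim_close (F1 F2 : (H_UniformSpace -> Prop) -> Prop) : filter_le F1 F2 -> filter_le F2 F1 ->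
  close (H_lim F1 : H_UniformSpace) (H_lim F2).
Proof.
  intros L1 L2; replace F2 with F1; [apply close_refl |].
  apply functional_extensionality; intros P; apply propositional_extensionality; split; auto.
Qed.

Definition H_CompleteSpace_mixin := CompleteSpace.Mixin H_UniformSpace H_lim H_lim_spec H_lim_close.

Definition H_CompleteNormedModule : CompleteNormedModule R_AbsRing :=
  CompleteNormedModule.Pack R_AbsRing H
    (CompleteNormedModule.Class R_AbsRing H H_NormedModule_class H_CompleteSpace_mixin) H.
End Instances.

(** * One-parameter unitary groups, their averages and generators *)

Record unitary_group {H : HilbertSpace} (V : R -> H -> H) : Prop := {
  ug_lin : forall t, lin (V t);
  ug_ip : forall t x y, ip (V t x) (V t y) = ip x y;
  ug_0 : forall x, V 0 x = x;
  ug_add : forall s t x, V (s + t) x = V s (V t x);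
  ug_cts : forall x eps, 0 < eps -> exists d, 0 < d /\
    forall t, Rabs t < d -> hnorm (hsub (V t x) x) < eps }.

Section Average.
Context {H : HilbertSpace}.
Variable V : R -> H -> H.
Hypothesis UV : unitary_group V.

Lemma ug_norm t x : hnorm (V t x) = hnorm x.
Proof.
  change (sqrt (Re (ip (V t x) (V t x))) = sqrt (Re (ip x x))).
  rewrite (ug_ip V UV); reflexivity.
Qed.

Lemma ug_norm_sub t x y : hnorm (hsub (V t x) (V t y)) = hnorm (hsub x y).
Proof. rewrite <- lin_sub by apply (ug_lin V UV); apply ug_norm. Qed.

Lemma ug_inv t x : V (- t) (V t x) = x.
Proof. rewrite <- (ug_add V UV), Rplus_opp_l; apply (ug_0 V UV). Qed.

Lemma ug_inv' t x : V t (V (- t) x) = x.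
Proof. rewrite <- (ug_add V UV), Rplus_opp_r; apply (ug_0 V UV). Qed.

Lemma ug_comm s t x : V s (V t x) = V t (V s x).
Proof. rewrite <- !(ug_add V UV), Rplus_comm; reflexivity. Qed.

Lemma ug_adj t x y : ip (V t x) y = ip x (V (- t) y).
Proof. rewrite <- (ug_inv' t y) at 1; apply (ug_ip V UV). Qed.

Lemma ug_cts_at x b eps : 0 < eps -> exists d, 0 < d /\
  forall t, Rabs (t - b) < d -> hnorm (hsub (V t x) (V b x)) < eps.
Proof.
  intros He; destruct (ug_cts V UV x eps He) as [d [Hd D]]; exists d; split; auto.
  intros t Ht; replace t with (b + (t - b)) at 1 by ring.
  rewrite (ug_add V UV), ug_norm_sub; auto.
Qed.

Definition integral (b : R) (x : H) : H :=
  RInt (V := H_CompleteNormedModule H) (fun t => V t x) 0 b.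

Lemma ug_continuous x b :
  @continuous R_UniformSpace (H_CompleteNormedModule H) (fun t => V t x) b.
Proof.
  apply filterlim_locally; intros eps.
  destruct (ug_cts_at x b eps (cond_pos eps)) as [d [Hd D]].
  exists (mkposreal d Hd); intros t Ht; apply D; exact Ht.
Qed.

Lemma integral_is_RInt x b :
  is_RInt (V := H_CompleteNormedModule H) (fun t => V t x) 0 b (integral b x).
Proof.
  apply (@RInt_correct (H_CompleteNormedModule H)), ex_RInt_continuous.
  intros; apply ug_continuous.
Qed.

Lemma integral_norm b x : 0 <= b -> hnorm (integral b x) <= b * hnorm x.
Proof.
  intros Hb.
  assert (E := norm_RInt_le_const (V := H_CompleteNormedModule H) (fun t => V t x) 0 b
    (integral b x) (hnorm x) Hb).
  rewrite Rminus_0_r in E; apply E; [| apply integral_is_RInt].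
  intros t _; apply Req_le, ug_norm.
Qed.

Lemma integral_0 x : integral 0 x = hzero.
Proof. apply (RInt_point (V := H_CompleteNormedModule H)). Qed.

Lemma integral_derive x b eps : 0 < eps -> exists d, 0 < d /\ forall t, Rabs (t - b) < d ->
  hnorm (hsub (hsub (integral t x) (integral b x)) (sc (RtoC (t - b)) (V b x))) <= eps * Rabs (t - b).
Proof.
  intros He.
  assert (D : is_derive (K := R_AbsRing) (V := H_CompleteNormedModule H) (fun t => integral t x) b (V b x)).
  { apply (is_derive_RInt (V := H_CompleteNormedModule H) (fun t => V t x) (fun t => integral t x) 0 b).
    - apply filter_forall; intros t; apply integral_is_RInt.
    - apply ug_continuous. }
  destruct D as [_ D].
  destruct (D b (fun P HP => HP) (mkposreal eps He)) as [d Hd].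
  exists d; split; [apply cond_pos |]; intros t Ht; apply (Hd t Ht).
Qed.

Lemma cder_integral v x b : cder (fun t => ip v (integral t x)) b (ip v (V b x)).
Proof.
  assert (E : forall eps, 0 < eps -> exists d, 0 < d /\ forall t, Rabs (t - b) < d ->
    Cmod (ip v (integral t x) - ip v (integral b x) - RtoC (t - b) * ip v (V b x)) <= eps * Rabs (t - b)).
  { intros eps He; assert (Pv := hnorm_pos v).
    destruct (integral_derive x b (eps / (hnorm v + 1))) as [d [Hd D]]; [apply Rdiv_lt_0_compat; lra |].
    exists d; split; auto; intros t Ht.
    rewrite <- ip_scr, <- !ip_subr.
    le_trans cauchy_schwarz.
    eapply Rle_trans; [apply Rmult_le_compat_l; [exact Pv | apply (D t Ht)] |].
    assert (Q : hnorm v * (eps / (hnorm v + 1)) <= eps).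
    { apply Rmult_le_reg_r with (hnorm v + 1); [lra |].
      replace (hnorm v * (eps / (hnorm v + 1)) * (hnorm v + 1)) with (hnorm v * eps) by (field; lra).
      nra. }
    assert (A := Rabs_pos (t - b)); nra. }
  split; apply is_derive_Reals; intros eps He; destruct (E (eps / 2) ltac:(lra)) as [d [Hd D]];
    exists (mkposreal d Hd); intros h Nh Hh; specialize (D (b + h));
    replace (b + h - b) with h in D by ring; specialize (D Hh);
    assert (Ph := Rabs_pos_lt h Nh).
  - match goal with |- Rabs ?X < _ => replace X with
      (Re (ip v (integral (b + h) x) - ip v (integral b x) - RtoC h * ip v (V b x)) / h)
      by (simpl; unfold Re; field; auto) end.
    unfold Rdiv; rewrite Rabs_mult, Rabs_inv.
    apply Rmult_lt_reg_r with (Rabs h); [auto |]; rewrite Rmult_assoc, Rinv_l, Rmult_1_r by lra.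
    eapply Rle_lt_trans; [apply re_le_Cmod |]; nra.
  - match goal with |- Rabs ?X < _ => replace X with
      (Im (ip v (integral (b + h) x) - ip v (integral b x) - RtoC h * ip v (V b x)) / h)
      by (simpl; unfold Im; field; auto) end.
    unfold Rdiv; rewrite Rabs_mult, Rabs_inv.
    apply Rmult_lt_reg_r with (Rabs h); [auto |]; rewrite Rmult_assoc, Rinv_l, Rmult_1_r by lra.
    eapply Rle_lt_trans; [apply im_le_Cmod |]; nra.
Qed.

Lemma cder_affine f d (m c t : R) : cder f (m * t + c) d -> cder (fun s => f (m * s + c)) t (RtoC m * d)%C.
Proof.
  intros [A B].
  assert (L : is_derive (fun s => m * s + c) t m).
  { evar_last; [apply @is_derive_plus; [apply is_derive_mult_R; [apply @is_derive_const | apply @is_derive_id] | apply @is_derive_const] |].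
    unfold plus, zero, one; simpl; ring. }
  split.
  - evar_last; [apply (is_derive_comp (fun s => Re (f s))); [exact A | exact L] |].
    unfold scal; simpl; unfold mult, Re; simpl; ring.
  - evar_last; [apply (is_derive_comp (fun s => Im (f s))); [exact B | exact L] |].
    unfold scal; simpl; unfold mult, Im; simpl; ring.
Qed.

Lemma ctsC_ug v x t : ctsC (fun t => ip v (V t x)) t.
Proof.
  apply ctsC_eps; intros eps He; assert (Pv := hnorm_pos v).
  destruct (ug_cts_at x t (eps / (hnorm v + 1))) as [d [Hd D]]; [apply Rdiv_lt_0_compat; lra |].
  exists d; split; auto; intros s Hs; rewrite <- ip_subr.
  eapply Rle_lt_trans; [apply cauchy_schwarz |].
  specialize (D s Hs); apply (Rmult_lt_compat_r (hnorm v + 1)) in D; [| lra].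
  replace (eps / (hnorm v + 1) * (hnorm v + 1)) with eps in D by (field; lra).
  assert (Q := hnorm_pos (hsub (V s x) (V t x))); nra.
Qed.

Lemma isCI_integral v x b : 0 <= b -> isCI (fun t => ip v (V t x)) 0 b (ip v (integral b x)).
Proof.
  intros Hb; eapply isCI_eq; [apply (isCI_cder (fun t => ip v (integral t x))) |].
  - exact Hb.
  - intros; apply cder_integral.
  - intros; apply ctsC_ug.
  - rewrite integral_0, ip_0r; ring.
Qed.

(** Vector integrals are identified weakly, so their algebra reduces to uniqueness of scalar
    integrals. *)
Lemma integral_ext b x y : 0 <= b ->
  (forall v I, isCI (fun t => ip v (V t x)) 0 b I -> I = ip v y) -> integral b x = y.
Proof. intros Hb E; apply ip_ext; intros v; apply E, isCI_integral, Hb. Qed.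

Lemma integral_lin b : 0 <= b -> lin (integral b).
Proof.
  intros Hb; split.
  - intros x y; apply integral_ext; [exact Hb |]; intros v I HI.
    apply (isCI_unique _ _ _ _ _ HI); rewrite ip_addr.
    eapply isCI_ext; [exact Hb | | apply isCI_add; apply isCI_integral; exact Hb].
    intros s _; rewrite (proj1 (ug_lin V UV s)), ip_addr; reflexivity.
  - intros a x; apply integral_ext; [exact Hb |]; intros v I HI.
    apply (isCI_unique _ _ _ _ _ HI); rewrite ip_scr.
    eapply isCI_ext; [exact Hb | | apply isCI_scal, isCI_integral; exact Hb].
    intros s _; rewrite (proj2 (ug_lin V UV s)), ip_scr; reflexivity.
Qed.

Lemma ug_integral s b x : 0 <= b -> V s (integral b x) = hsub (integral (b + s) x) (integral s x).
Proof.
  intros Hb; apply ip_ext; intros v.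
  replace (ip v (V s (integral b x))) with (ip (V (- s) v) (integral b x))
    by (rewrite ug_adj, Ropp_involutive; reflexivity).
  assert (A := isCI_integral (V (- s) v) x b Hb).
  apply (isCI_unique _ _ _ _ _ A).
  eapply isCI_eq; [apply (isCI_cder (fun t => ip v (integral (1 * t + s) x))) |].
  - exact Hb.
  - intros t _; eapply cder_eq; [apply (cder_affine (fun t => ip v (integral t x))), cder_integral |].
    rewrite ug_adj, Ropp_involutive, <- (ug_add V UV), Rmult_1_l, (Rplus_comm s t); ring.
  - intros t _; apply ctsC_ug.
  - rewrite ip_subr, Rmult_1_l, Rmult_0_r, Rplus_0_l; reflexivity.
Qed.

Lemma integral_ug s b x : 0 <= b -> integral b (V s x) = V s (integral b x).
Proof.
  intros Hb; apply integral_ext; [exact Hb |]; intros v I HI.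
  apply (isCI_unique _ _ _ _ _ HI).
  rewrite <- (Ropp_involutive s), <- ug_adj.
  eapply isCI_ext; [exact Hb | | apply isCI_integral, Hb].
  intros t _; simpl; rewrite Ropp_involutive, ug_adj, Ropp_involutive, ug_comm; reflexivity.
Qed.

(** The adjoint is the integral of V(-t) over [0, b]; the substitution t -> b - t writes it as V(-b)
    times the original integral. *)
Lemma integral_adj b x y : 0 <= b -> ip (integral b x) y = ip x (V (- b) (integral b y)).
Proof.
  intros Hb.
  replace (ip x (V (- b) (integral b y))) with (ip (V b x) (integral b y)) by apply ug_adj.
  assert (A := isCI_integral (V b x) y b Hb).
  symmetry; apply (isCI_unique _ _ _ _ _ A).
  assert (Hd : forall t, cder (fun t => Cconj (ip y (integral (-1 * t + b) x))) t (- Cconj (ip y (V (-1 * t + b) x)))%C).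
  { intros t; assert (D := cder_affine (fun t => ip y (integral t x)) _ (-1) b t (cder_integral y x _)).
    destruct D as [D1 D2]; split; simpl.
    - evar_last; [exact D1 | simpl; ring].
    - evar_last; [apply @is_derive_opp; exact D2 |].
      unfold opp; simpl; ring. }
  eapply isCI_eq; [apply (isCI_cder (fun t => - 1 * Cconj (ip y (integral (-1 * t + b) x)))%C) |].
  - exact Hb.
  - intros t _; eapply cder_eq; [apply cder_mul; [apply cder_const | apply Hd] |].
    cbv beta; rewrite <- !ip_conj.
    replace (-1 * t + b) with (- t + b) by ring.
    rewrite (ug_add V UV), (ug_adj (- t)), Ropp_involutive; ring.
  - intros t _; apply ctsC_ug.
  - replace (-1 * b + b) with 0 by ring; replace (-1 * 0 + b) with b by ring.
    rewrite integral_0, ip_0r, <- !ip_conj; cring.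
Qed.

(** Both sides are the integral up to g + h minus those up to g and up to h. *)
Lemma integral_swap g h x : 0 <= g -> 0 <= h ->
  hsub (V h (integral g x)) (integral g x) = hsub (V g (integral h x)) (integral h x).
Proof.
  intros Hg Hh; rewrite !ug_integral by auto; rewrite (Rplus_comm g h).
  vec.
Qed.

Definition avg (h : R) (x : H) : H := sc (RtoC (/ h)) (integral h x).

Lemma avg_lin h : 0 < h -> lin (avg h).
Proof.
  intros Hh; destruct (integral_lin h ltac:(lra)) as [L1 L2]; unfold avg; split; intros.
  - rewrite L1; vec.
  - rewrite L2; vec.
Qed.

Lemma avg_norm h x : 0 < h -> hnorm (avg h x) <= hnorm x.
Proof.
  intros Hh; unfold avg; rewrite hnorm_sc, Cmod_R, Rabs_pos_eq by (left; apply Rinv_0_lt_compat; auto).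
  assert (B := integral_norm h x ltac:(lra)).
  apply Rmult_le_reg_l with h; auto; rewrite <- Rmult_assoc, Rinv_r, Rmult_1_l by lra; auto.
Qed.

Lemma avg_ug h s x : 0 < h -> avg h (V s x) = V s (avg h x).
Proof.
  intros Hh; unfold avg; rewrite integral_ug, (proj2 (ug_lin V UV s)) by lra; reflexivity.
Qed.

Lemma avg_adj h x y : 0 < h -> ip (avg h x) y = ip x (V (- h) (avg h y)).
Proof.
  intros Hh; unfold avg; rewrite (proj2 (ug_lin V UV _)), ip_scl, ip_scr, integral_adj by lra.
  f_equal; cring.
Qed.

Lemma avg_limit x eps : 0 < eps -> exists d, 0 < d /\ forall h, 0 < h < d -> hnorm (hsub (avg h x) x) <= eps.
Proof.
  intros He; destruct (integral_derive x 0 eps He) as [d [Hd D]]; exists d; split; auto.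
  intros h Hh; specialize (D h); rewrite Rminus_0_r, integral_0, (ug_0 V UV), Rabs_pos_eq in D by lra.
  specialize (D ltac:(lra)).
  assert (N : RtoC h <> 0%C) by rneq.
  replace (hsub (avg h x) x) with (sc (RtoC (/ h)) (hsub (hsub (integral h x) hzero) (sc (RtoC h) x))).
  - rewrite hnorm_sc, Cmod_R, Rabs_pos_eq by (left; apply Rinv_0_lt_compat; lra).
    apply Rmult_le_reg_l with h; [lra |]; rewrite <- Rmult_assoc, Rinv_r, Rmult_1_l by lra; lra.
  - unfold avg; apply ip_ext; intros v; ipall.
    rewrite RtoC_inv by lra; field; auto.
Qed.

                                                        
(** By [avg_gen] this is G A_h x: the generator after averaging, hence a bounded operator. *)
Definition dquot (h : R) (x : H) : H := sc (/ (Ci * RtoC h))%C (hsub (V h x) x).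

Definition is_gen (phi psi : H) : Prop := forall eps, eps > 0 -> exists delta, delta > 0 /\
  forall t, t <> 0 -> Rabs t < delta ->
    hnorm (hsub (sc (RtoC (/ t)) (hsub (V t phi) phi)) (sc Ci psi)) < eps.

Lemma Ci_neq0 : Ci <> 0%C.
Proof. intros E; apply (f_equal Im) in E; simpl in E; lra. Qed.

(** Averaging smooths: V(t) moves the integral over [0, h] by the integral over [h, h + t] minus
    that over [0, t], and both are differentiable at t = 0. *)
Lemma avg_gen h x : 0 < h -> is_gen (avg h x) (dquot h x).
Proof.
  intros Hh eps He.
  assert (Nh : RtoC h <> 0%C) by rneq.
  assert (Ph : 0 < / h) by (apply Rinv_0_lt_compat; lra).
  destruct (integral_derive x h (eps * h / 4)) as [d1 [P1 D1]]; [nra |].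
  destruct (integral_derive x 0 (eps * h / 4)) as [d2 [P2 D2]]; [nra |].
  exists (Rmin d1 d2); split; [apply Rmin_glb_lt; auto |]; intros t Nt Ht.
  assert (M1 := Rmin_l d1 d2); assert (M2 := Rmin_r d1 d2).
  specialize (D1 (h + t)); replace (h + t - h) with t in D1 by ring; specialize (D1 ltac:(lra)).
  specialize (D2 t); rewrite Rminus_0_r, integral_0, (ug_0 V UV) in D2; specialize (D2 ltac:(lra)).
  assert (NtC : RtoC t <> 0%C) by rneq.
  match type of D1 with hnorm ?X <= _ => set (y1 := X) in * end.
  match type of D2 with hnorm ?X <= _ => set (y2 := X) in * end.
  match goal with |- hnorm ?X < _ => replace X with (sc (RtoC (/ t * / h)) (hsub y1 y2)) end.
  - rewrite hnorm_sc, Cmod_R, Rabs_mult, (Rabs_pos_eq (/ h)), Rabs_inv by lra.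
    assert (Pt := Rabs_pos_lt t Nt).
    apply Rmult_lt_reg_l with (Rabs t * h); [nra |].
    replace (Rabs t * h * (/ Rabs t * / h * hnorm (hsub y1 y2))) with (hnorm (hsub y1 y2)) by (field; lra).
    assert (Pp : 0 < eps * h * Rabs t) by (apply Rmult_lt_0_compat; nra).
    eapply Rle_lt_trans; [apply hnorm_sub |]; lra.
  - unfold avg at 1; rewrite (proj2 (ug_lin V UV t)), ug_integral by lra.
    unfold y1, y2, avg, dquot; apply ip_ext; intros v; ipall.
    rewrite RtoC_mult, (RtoC_inv t Nt), (RtoC_inv h) by lra; field; repeat split; auto using Ci_neq0.
Qed.
End Average.

                                                                       

(** * Comparison of powers of commuting operators *)

Section Iterates.
Context {H : HilbertSpace}.
Implicit Types X Y : H -> H.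

Lemma iter_lin n X : lin X -> lin (Nat.iter n X).
Proof.
  intros L; induction n as [| n IH]; simpl; [split; auto |].
  apply (lin_comp X (Nat.iter n X)); auto.
Qed.

Lemma iter_comm n X Y x : (forall x, X (Y x) = Y (X x)) -> Nat.iter n X (Y x) = Y (Nat.iter n X x).
Proof. intros E; induction n as [| n IH]; simpl; [auto | rewrite IH; auto]. Qed.

Lemma iter_S_r n X x : Nat.iter (S n) X x = Nat.iter n X (X x).
Proof. simpl; symmetry; apply iter_comm; auto. Qed.

Lemma iter_mul m n X x : Nat.iter m (Nat.iter n X) x = Nat.iter (m * n) X x.
Proof.
  induction m as [| m IH]; simpl; [auto |].
  rewrite Nat.iter_add, IH; auto.
Qed.

(** The telescoping sum for X^n - Y^n. Only the powers are assumed bounded, uniformly by M, since a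
    bound on a single step would be raised to the power n. The prefix of m further factors Y is what
    the induction on n needs. *)
Lemma telescope N M X Y w : lin X -> lin Y -> (forall x, X (Y x) = Y (X x)) ->
  (forall j x, (j <= N)%nat -> hnorm (Nat.iter j X x) <= M * hnorm x) ->
  (forall j x, (j <= N)%nat -> hnorm (Nat.iter j Y x) <= M * hnorm x) -> 0 <= M ->
  forall n m, (m + n <= N)%nat ->
  hnorm (Nat.iter m Y (hsub (Nat.iter n X w) (Nat.iter n Y w))) <= INR n * (M * M * hnorm (hsub (X w) (Y w))).
Proof.
  intros LX LY E BX BY HM; induction n as [| n IH]; intros m Hmn.
  - simpl; replace (hsub w w) with (@hzero H) by vec.
    rewrite lin_0 by (apply iter_lin; auto); rewrite hnorm_0; lra.
  - rewrite !iter_S_r.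
    replace (Nat.iter m Y (hsub (Nat.iter n X (X w)) (Nat.iter n Y (Y w)))) with
      (hadd (Nat.iter m Y (Nat.iter n X (hsub (X w) (Y w))))
            (Nat.iter (S m) Y (hsub (Nat.iter n X w) (Nat.iter n Y w)))).
    + le_trans hnorm_add; rewrite S_INR.
      specialize (IH (S m) ltac:(lia)).
      assert (A := BY m (Nat.iter n X (hsub (X w) (Y w))) ltac:(lia)).
      assert (B := BX n (hsub (X w) (Y w)) ltac:(lia)).
      assert (C := Rmult_le_compat_l M _ _ HM B); lra.
    + rewrite iter_S_r, (lin_sub Y), <- (iter_comm n X Y), <- (iter_comm n Y Y) by auto.
      rewrite <- (proj1 (iter_lin m Y LY)); f_equal.
      rewrite (lin_sub (Nat.iter n X)) by (apply iter_lin; auto); vec.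
Qed.

Lemma iter_difference N M X Y w : lin X -> lin Y -> (forall x, X (Y x) = Y (X x)) ->
  (forall j x, (j <= N)%nat -> hnorm (Nat.iter j X x) <= M * hnorm x) ->
  (forall j x, (j <= N)%nat -> hnorm (Nat.iter j Y x) <= M * hnorm x) -> 0 <= M ->
  hnorm (hsub (Nat.iter N X w) (Nat.iter N Y w)) <= INR N * (M * M * hnorm (hsub (X w) (Y w))).
Proof. intros; apply (telescope N M X Y w) with (n := N) (m := 0%nat); auto. Qed.
End Iterates.

(** * Construction of exp(i z G) on the closed upper half plane *)

Section Semigroup.
Context {H : HilbertSpace}.
Variables (V : R -> H -> H) (k : R).
Hypothesis UV : unitary_group V.
Hypothesis Hk : 0 <= k.
Hypothesis Hgen : forall phi psi, is_gen V phi psi -> - k * (hnorm phi * hnorm phi) <= Re (ip phi psi).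

(* [A^* G A] with [A = avg V h] and [G] the generator of [V], since [A^* = V (- h) A]. *)
Definition regen (h : R) (x : H) : H := V (- h) (avg V h (dquot V h x)).

Lemma dquot_lin h : lin (dquot V h).
Proof.
  destruct (ug_lin V UV h) as [L1 L2]; unfold dquot; split; intros.
  - rewrite L1; vec.
  - rewrite L2; vec.
Qed.

Lemma regen_lin h : 0 < h -> lin (regen h).
Proof.
  intros Hh; apply (lin_comp (V (- h)) (fun x => avg V h (dquot V h x))); [apply (ug_lin V UV) |].
  apply (lin_comp (avg V h) (dquot V h)); [apply avg_lin; auto | apply dquot_lin].
Qed.

Lemma dquot_comm h (A : H -> H) x : lin A -> (forall t x, A (V t x) = V t (A x)) ->
  A (dquot V h x) = dquot V h (A x).
Proof. intros L E; unfold dquot; rewrite (proj2 L), lin_sub, E by auto; reflexivity. Qed.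

Lemma avg_adj' g v x : 0 < g -> ip v (avg V g x) = ip (V (- g) (avg V g v)) x.
Proof.
  intros Hg; rewrite (ug_adj V UV), Ropp_involutive, (avg_adj V UV), (avg_ug V UV), (ug_inv V UV) by auto.
  reflexivity.
Qed.

Lemma avg_comm g h x : 0 < g -> 0 < h -> avg V h (avg V g x) = avg V g (avg V h x).
Proof.
  intros Hg Hh; unfold avg at 1 4; rewrite (proj2 (avg_lin V UV g Hg)); f_equal.
  apply (integral_ext V UV); [lra |]; intros v I HI.
  apply (isCI_unique _ _ _ _ _ HI); rewrite avg_adj' by auto.
  eapply isCI_ext; [| | apply (isCI_integral V UV)]; [lra | | lra].
  intros t _; simpl; rewrite <- avg_adj', (avg_ug V UV) by auto; reflexivity.
Qed.

Lemma regen_ug h t x : 0 < h -> regen h (V t x) = V t (regen h x).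
Proof.
  intros Hh; unfold regen.
  rewrite <- (dquot_comm h (V t)), (avg_ug V UV), (ug_comm V UV) by (auto using ug_lin, ug_comm).
  reflexivity.
Qed.

Lemma regen_avg h g x : 0 < h -> 0 < g -> regen h (avg V g x) = avg V g (regen h x).
Proof.
  intros Hh Hg; unfold regen.
  rewrite <- (dquot_comm h (avg V g)), avg_comm, (avg_ug V UV) by (auto using avg_lin, avg_ug).
  reflexivity.
Qed.

Lemma regen_comm g h x : 0 < g -> 0 < h -> regen h (regen g x) = regen g (regen h x).
Proof.
  intros Hg Hh; unfold regen at 2 3.
  rewrite regen_ug, regen_avg by auto.
  rewrite (dquot_comm g (regen h)) by (auto using regen_lin, regen_ug); reflexivity.
Qed.

Lemma regen_norm h x : 0 < h -> hnorm (regen h x) <= 2 / h * hnorm x.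
Proof.
  intros Hh; unfold regen; rewrite (ug_norm V UV).
  eapply Rle_trans; [apply (avg_norm V UV), Hh |].
  assert (N : RtoC h <> 0%C) by rneq.
  unfold dquot; rewrite hnorm_sc, Cmod_inv, Cmod_mult, Cmod_R, (Rabs_pos_eq h)
    by (try lra; apply Cmult_neq_0; auto using Ci_neq0).
  rewrite Cmod_Ci, Rmult_1_l.
  assert (B := hnorm_sub (V h x) x); rewrite (ug_norm V UV) in B.
  unfold Rdiv; rewrite (Rmult_comm 2), Rmult_assoc.
  apply Rmult_le_compat_l; [left; apply Rinv_0_lt_compat; auto | lra].
Qed.

Lemma regen_form h x y : 0 < h -> ip x (regen h y) = ip (avg V h x) (dquot V h y).
Proof.
  intros Hh; unfold regen; rewrite (avg_adj V UV) by auto; reflexivity.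
Qed.

Lemma regen_sym h x y : 0 < h -> ip (regen h x) y = ip x (regen h y).
Proof.
  intros Hh.
  assert (N : RtoC h <> 0%C) by rneq.
  rewrite regen_form, ip_conj, regen_form, <- ip_conj by auto.
  unfold dquot; rewrite ip_scl, ip_scr, ip_subl, ip_subr.
  rewrite (ug_adj V UV h x), (avg_adj V UV h x (V h y)), (avg_ug V UV), (ug_inv V UV) by auto.
  replace (ip x (V (- h) (avg V h y))) with (ip (avg V h x) y) by (rewrite (avg_adj V UV) by auto; auto).
  replace (Cconj (/ (Ci * h))) with (- / (Ci * h))%C; [ring |].
  rewrite Cinv_conj by (apply Cmult_neq_0; auto using Ci_neq0).
  replace (Cconj (Ci * h)) with (- (Ci * h))%C by (cring).
  field; split; auto using Ci_neq0.
Qed.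

(** The average of x is in the domain of the generator with image [dquot V h x], and it is no longer
    than x; as k >= 0, the lower bound survives the shortening. *)
Lemma regen_lower h x : 0 < h -> - k * (hnorm x * hnorm x) <= Re (ip x (regen h x)).
Proof.
  intros Hh; rewrite regen_form by auto.
  eapply Rle_trans; [| apply (Hgen _ _ (avg_gen V UV h x Hh))].
  assert (B := avg_norm V UV h x Hh); assert (P := hnorm_pos (avg V h x)).
  assert (Q : hnorm (avg V h x) * hnorm (avg V h x) <= hnorm x * hnorm x) by nra.
  nra.
Qed.

(** On averaged vectors [regen h] tends to G: by [integral_swap] the quotient of step h applied to
    the g-average is the h-average of a fixed vector, and averages tend to the identity. *)
Lemma regen_avg_limit g w eps : 0 < g -> 0 < eps -> exists d, 0 < d /\ forall h, 0 < h < d ->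
  hnorm (hsub (regen h (avg V g w)) (dquot V g w)) <= eps.
Proof.
  intros Hg He; set (v := dquot V g w).
  destruct (avg_limit V UV v (eps / 4) ltac:(lra)) as [d1 [P1 D1]].
  destruct (ug_cts V UV v (eps / 4) ltac:(lra)) as [d2 [P2 D2]].
  exists (Rmin d1 d2); split; [apply Rmin_glb_lt; auto |]; intros h Hh.
  assert (M1 := Rmin_l d1 d2); assert (M2 := Rmin_r d1 d2).
  assert (Nh : RtoC h <> 0%C) by rneq.
  assert (Ng : RtoC g <> 0%C) by rneq.
  assert (E : dquot V h (avg V g w) = avg V h v).
  { unfold v; rewrite (dquot_comm g (avg V h)) by (try (apply avg_lin; auto; lra); intros; apply avg_ug; auto; lra).
    unfold dquot, avg; rewrite !(proj2 (ug_lin V UV _)).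
    replace (hsub (sc (/ g)%R (V h (integral V g w))) (sc (/ g)%R (integral V g w)))
      with (sc (RtoC (/ g)) (hsub (V h (integral V g w)) (integral V g w))) by vec.
    rewrite (integral_swap V UV) by lra.
    apply ip_ext; intros u; ipall; rewrite !RtoC_inv by lra; field; auto using Ci_neq0. }
  unfold regen; rewrite E.
  assert (A1 := D1 h ltac:(lra)).
  assert (A2 := D2 (- h) ltac:(rewrite Rabs_Ropp, Rabs_pos_eq; lra)).
  le_trans (hnorm_sub_tri (V (- h) (avg V h v))).
  eapply Rle_trans; [apply Rplus_le_compat_l, (hnorm_sub_tri (V (- h) v)) |].
  rewrite !(ug_norm_sub V UV).
  assert (A3 := avg_norm V UV h (hsub (avg V h v) v) ltac:(lra)).
  rewrite (lin_sub (avg V h)) in A3 by (apply avg_lin; auto; lra).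
  lra.
Qed.

Definition step (c : C) (h : R) (x : H) : H := hadd x (sc c (regen h x)).

Lemma step_lin c h : 0 < h -> lin (step c h).
Proof.
  intros Hh; destruct (regen_lin h Hh) as [L1 L2]; unfold step; split; intros.
  - rewrite L1; vec.
  - rewrite L2; vec.
Qed.

(** The bound exp(k |z|) expected of exp(i z G), with one unit in the exponent reserved for
    second-order errors of the Euler scheme. *)
Definition growth (R0 : R) : R := exp (k * R0 + 1).

Lemma growth_ge1 R0 : 0 <= R0 -> 1 <= growth R0.
Proof.
  intros HR; unfold growth; apply Rle_trans with (exp 0); [rewrite exp_0; lra |]; left; apply exp_increasing.
  assert (P := Rmult_le_pos _ _ Hk HR); lra.
Qed.

(** In |x + c T x|^2 the cross term is 2 Re c <x, T x>, because T is symmetric. With Re c <= 0 it is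
    controlled by the lower bound of T alone; the norm 2/h of T, which blows up, enters only
    quadratically in c. *)
Lemma step_norm c h x : 0 < h -> Re c <= 0 ->
  hnorm (step c h x) <= exp (k * Cmod c + Cmod c * Cmod c * (2 / (h * h))) * hnorm x.
Proof.
  intros Hh Hc.
  assert (Px := hnorm_pos x); assert (Pc := Cmod_ge_0 c).
  assert (Ph : 0 < 2 / (h * h)) by (apply Rdiv_lt_0_compat; nra).
  set (a := k * Cmod c + Cmod c * Cmod c * (2 / (h * h))).
  assert (Pa : 0 <= a) by (unfold a; assert (0 <= Cmod c * Cmod c) by nra; nra).
  apply Rle_trans with ((1 + a) * hnorm x).
  2: { apply Rmult_le_compat_r; [auto |]. apply exp_ineq1_le. }
  apply hnorm_le; [nra |].
  assert (E : Re (ip (step c h x) (step c h x)) =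
    hnorm x * hnorm x + 2 * (Re c * Re (ip x (regen h x))) + (Cmod c * hnorm (regen h x)) * (Cmod c * hnorm (regen h x))).
  { assert (Sy := regen_sym h x x Hh); rewrite ip_conj in Sy.
    rewrite <- hnorm_sc, !hnorm_sqr; unfold step.
    rewrite ip_addl, !ip_addr, (ip_scl c (regen h x) x), (ip_scr c x (regen h x)), (ip_conj x (regen h x)).
    assert (Im0 : Im (ip x (regen h x)) = 0) by (apply (f_equal Im) in Sy; rewrite im_conj in Sy; lra).
    destruct (ip x (regen h x)) as [t1 t2]; simpl in *; subst; unfold Re; simpl; ring. }
  rewrite E.
  assert (TL := regen_lower h x Hh); assert (TN := regen_norm h x Hh).
  assert (RC : - Cmod c <= Re c) by (generalize (re_le_Cmod c); intros Q; apply Rabs_le_between in Q; lra).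
  set (q := hnorm x * hnorm x) in *.
  assert (Pq : 0 <= q) by (unfold q; nra).
  assert (B1 : Re c * Re (ip x (regen h x)) <= Cmod c * k * q).
  { assert (X1 : 0 <= - Re c * (Re (ip x (regen h x)) + k * q)) by (apply Rmult_le_pos; lra).
    assert (X2 : 0 <= (Cmod c + Re c) * (k * q)) by (apply Rmult_le_pos; nra).
    lra. }
  assert (B2 : (Cmod c * hnorm (regen h x)) * (Cmod c * hnorm (regen h x)) <= Cmod c * Cmod c * (4 / (h * h)) * q).
  { assert (X : Cmod c * hnorm (regen h x) <= Cmod c * (2 / h * hnorm x)) by (apply Rmult_le_compat_l; auto).
    assert (Y : 0 <= Cmod c * hnorm (regen h x)) by (apply Rmult_le_pos; auto using hnorm_pos).
    eapply Rle_trans; [apply Rmult_le_compat; [exact Y | exact Y | exact X | exact X] |].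
    right; unfold q; field; lra. }
  replace ((1 + a) * hnorm x * ((1 + a) * hnorm x)) with ((1 + 2 * a + a * a) * q) by (unfold q; ring).
  replace (4 / (h * h)) with (2 * (2 / (h * h))) in B2 by (field; lra).
  assert (X3 : 0 <= a * a * q) by (apply Rmult_le_pos; [nra | auto]).
  unfold a at 1; lra.
Qed.

                                                               
(** The quadratic terms of j steps add up to at most 2 R0 |c| / h^2 <= 1, which is the unit reserved
    in [growth]. *)
Lemma step_iter_norm c h R0 j x : 0 < h -> Re c <= 0 -> INR j * Cmod c <= R0 ->
  2 * R0 * Cmod c <= h * h -> hnorm (Nat.iter j (step c h) x) <= growth R0 * hnorm x.
Proof.
  intros Hh Hc Hj Hs.
  assert (Px := hnorm_pos x); assert (Pc := Cmod_ge_0 c).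
  set (b := k * Cmod c + Cmod c * Cmod c * (2 / (h * h))).
  apply Rle_trans with (exp (INR j * b) * hnorm x).
  - clear Hj; induction j as [| j IH].
    + simpl; rewrite Rmult_0_l, exp_0; lra.
    + rewrite S_INR, Rmult_plus_distr_r, exp_plus, Rmult_1_l, Nat.iter_succ.
      eapply Rle_trans; [apply step_norm; auto |]; fold b.
      rewrite (Rmult_comm (exp (INR j * b))), Rmult_assoc.
      apply Rmult_le_compat_l; [left; apply exp_pos | exact IH].
  - apply Rmult_le_compat_r; [auto |]; unfold growth.
    cut (INR j * b <= k * R0 + 1).
    { intros [Q | ->]; [left; apply exp_increasing, Q | right; reflexivity]. }
    unfold b.
    assert (Pj := pos_INR j).
    assert (PR : 0 <= R0) by nra.
    assert (E : Cmod c * R0 * (2 / (h * h)) <= 1).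
    { apply Rmult_le_reg_r with (h * h); [nra |].
      replace (Cmod c * R0 * (2 / (h * h)) * (h * h)) with (2 * R0 * Cmod c) by (field; lra); lra. }
    assert (Ph : 0 < 2 / (h * h)) by (apply Rdiv_lt_0_compat; nra).
    assert (X1 : k * (INR j * Cmod c) <= k * R0) by (apply Rmult_le_compat_l; auto).
    assert (X2 : (INR j * Cmod c) * (Cmod c * (2 / (h * h))) <= R0 * (Cmod c * (2 / (h * h)))).
    { apply Rmult_le_compat_r; [apply Rmult_le_pos; lra | auto]. }
    lra.
Qed.

(** The difference between n small steps and one step of length n c begins at second order in c;
    this gives the consistency error of the scheme. *)
Lemma step_iter_plus c h x n M : 0 < h -> 0 <= M ->
  (forall j y, (j <= n)%nat -> hnorm (Nat.iter j (step c h) y) <= M * hnorm y) -> 1 <= M ->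
  hnorm (hsub (Nat.iter n (step c h) x) (step (INR n * c) h x)) <=
    INR n * INR n * (M * M * (Cmod c * Cmod c * hnorm (regen h (regen h x)))).
Proof.
  intros Hh PM B HM; revert B.
  assert (L := step_lin c h Hh).
  assert (Pt := hnorm_pos (regen h (regen h x))); assert (Pc := Cmod_ge_0 c).
  induction n as [| n IH]; intros B.
  - simpl; replace (hsub x (step (0 * c) h x)) with (@hzero H); [rewrite hnorm_0; lra |].
    unfold step; vec.
  - assert (IH' := IH (fun j y Hj => B j y ltac:(lia))).
    assert (D : hnorm (hsub (Nat.iter n (step c h) (regen h x)) (Nat.iter n (fun y => y) (regen h x)))
        <= INR n * (M * M * hnorm (hsub (step c h (regen h x)) (regen h x)))).
    { apply (iter_difference n M (step c h) (fun y => y)); auto.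
      - split; auto.
      - intros j y Hj; assert (E : Nat.iter j (fun y : H => y) y = y) by (clear; induction j; auto).
        rewrite E; assert (P := hnorm_pos y); nra. }
    assert (E : Nat.iter n (fun y : H => y) (regen h x) = regen h x) by (clear; induction n; auto).
    rewrite E in D.
    replace (hsub (step c h (regen h x)) (regen h x)) with (sc c (regen h (regen h x))) in D by (unfold step; vec).
    rewrite hnorm_sc in D.
    replace (hsub (Nat.iter (S n) (step c h) x) (step (INR (S n) * c) h x)) with
      (hadd (hsub (Nat.iter n (step c h) x) (step (INR n * c) h x))
            (sc c (hsub (Nat.iter n (step c h) (regen h x)) (regen h x)))).
    + le_trans hnorm_add; rewrite hnorm_sc, S_INR.
      set (q := Cmod c * Cmod c * hnorm (regen h (regen h x))) in *.
      assert (Pq : 0 <= q) by (unfold q; repeat apply Rmult_le_pos; auto).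
      assert (D' := Rmult_le_compat_l _ _ _ Pc D).
      replace (Cmod c * (INR n * (M * M * (Cmod c * hnorm (regen h (regen h x))))))
        with (INR n * (M * M * q)) in D' by (unfold q; ring).
      assert (Pn := pos_INR n).
      assert (P1 : 0 <= M * M * q) by (repeat apply Rmult_le_pos; auto).
      assert (P2 : 0 <= INR n * (M * M * q)) by (apply Rmult_le_pos; auto).
      lra.
    + rewrite iter_S_r; change (step c h x) with (hadd x (sc c (regen h x))).
      rewrite (proj1 (iter_lin n _ L)), (proj2 (iter_lin n _ L)), S_INR, RtoC_plus.
      unfold step; vec.
Qed.

Lemma iter_refine c h x N n M : 0 < h -> 1 <= M ->
  (forall j y, (j <= N)%nat -> hnorm (Nat.iter j (step c h) y) <= M * hnorm y) ->
  (forall j y, (j <= N * S n)%nat -> hnorm (Nat.iter j (step (/ INR (S n) * c) h) y) <= M * hnorm y) ->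
  hnorm (hsub (Nat.iter N (step c h) x) (Nat.iter (N * S n) (step (/ INR (S n) * c) h) x)) <=
    INR N * (M * M * (M * M * (Cmod c * Cmod c * hnorm (regen h (regen h x))))).
Proof.
  intros Hh HM B1 B2; set (c' := (/ INR (S n) * c)%C) in *.
  assert (NS : RtoC (INR (S n)) <> 0%C).
  { intros E; apply RtoC_inj in E; rewrite S_INR in E; generalize (pos_INR n); lra. }
  destruct N as [| N].
  { simpl; replace (hsub x x) with (@hzero H) by vec; rewrite hnorm_0; lra. }
  assert (Cc : forall a b y, step a h (step b h y) = step b h (step a h y)).
  { intros a b y; destruct (regen_lin h Hh) as [L1 L2]; unfold step; rewrite !L1, !L2; vec. }
  rewrite <- iter_mul.
  le_trans (iter_difference (S N) M).
  - apply step_lin, Hh.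
  - apply iter_lin, step_lin, Hh.
  - intros y; symmetry; apply iter_comm; intros; apply Cc.
  - exact B1.
  - intros j y Hj; rewrite iter_mul; apply B2; nia.
  - lra.
  - apply Rmult_le_compat_l; [apply pos_INR |]; apply Rmult_le_compat_l; [nra |].
    rewrite hnorm_sub_comm.
    assert (E := step_iter_plus c' h x (S n) M Hh ltac:(lra) (fun j y Hj => B2 j y ltac:(nia)) HM).
    replace (INR (S n) * c')%C with c in E by (unfold c'; field; auto).
    eapply Rle_trans; [exact E |].
    assert (Ec : Cmod c = INR (S n) * Cmod c').
    { replace c with (INR (S n) * c')%C at 1 by (unfold c'; field; auto).
      rewrite Cmod_mult, Cmod_R, Rabs_pos_eq; auto using pos_INR. }
    rewrite Ec; right; ring.
Qed.

(* [euler m z] is the Euler approximation [(1 + i z regen / N)^N] of [exp (i z G)]; the number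
   of steps [N = 4 (m + 1)^3] dominates [|z|^2 ||regen||^2 = O(m^2)]. *)
Definition mesh (m : nat) : R := / INR (S m).
Definition steps (m : nat) : nat := (4 * (S m) ^ 3)%nat.
Definition incr (m : nat) (z : C) : C := (/ INR (steps m) * (Ci * z))%C.
Definition euler (m : nat) (z : C) (w : H) : H := Nat.iter (steps m) (step (incr m z) (mesh m)) w.

Lemma mesh_pos m : 0 < mesh m.
Proof. apply Rinv_0_lt_compat, lt_0_INR; lia. Qed.

Lemma steps_pos m : 0 < INR (steps m).
Proof. apply lt_0_INR; unfold steps; generalize (Nat.pow_nonzero (S m) 3); lia. Qed.

Lemma steps_INR m : INR (steps m) = 4 * INR (S m) ^ 3.
Proof. unfold steps; rewrite mult_INR, pow_INR; simpl (INR 4); ring. Qed.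

Lemma Cmod_incr m z : Cmod (incr m z) = Cmod z / INR (steps m).
Proof.
  assert (Pn := steps_pos m); unfold incr.
  rewrite !Cmod_mult, Cmod_Ci, <- RtoC_inv, Cmod_R, Rabs_pos_eq by (try lra; left; apply Rinv_0_lt_compat; auto).
  field; lra.
Qed.

Lemma Re_scal_Ci (a : R) z : 0 <= a -> 0 <= Im z -> Re (RtoC a * (Ci * z))%C <= 0.
Proof. intros Ha Hz; destruct z; simpl in *; nra. Qed.

Lemma Re_incr m z : 0 <= Im z -> Re (incr m z) <= 0.
Proof.
  intros Hz; assert (Pn := steps_pos m); unfold incr; rewrite <- RtoC_inv by lra.
  apply Re_scal_Ci; auto; left; apply Rinv_0_lt_compat, Pn.
Qed.

Lemma small_steps R0 m : R0 * R0 <= INR (S m) -> 2 * R0 * (R0 / INR (steps m)) <= mesh m * mesh m.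
Proof.
  intros Hm; assert (Pm : 0 < INR (S m)) by (apply lt_0_INR; lia).
  rewrite steps_INR; unfold mesh.
  apply Rmult_le_reg_r with (2 * INR (S m) ^ 3); [apply Rmult_lt_0_compat; [lra | apply pow_lt, Pm] |].
  replace (2 * R0 * (R0 / (4 * INR (S m) ^ 3)) * (2 * INR (S m) ^ 3)) with (R0 * R0) by (field; lra).
  replace (/ INR (S m) * / INR (S m) * (2 * INR (S m) ^ 3)) with (2 * INR (S m)) by (field; lra).
  lra.
Qed.

Lemma incr_iter_norm R0 m z j y : 0 < R0 -> R0 * R0 <= INR (S m) -> upper_disc R0 z -> (j <= steps m)%nat ->
  hnorm (Nat.iter j (step (incr m z) (mesh m)) y) <= growth R0 * hnorm y.
Proof.
  intros HR Hm [Hz1 Hz2] Hj; assert (Pn := steps_pos m).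
  apply step_iter_norm; [apply mesh_pos | apply Re_incr, Hz2 | |]; rewrite Cmod_incr.
  - apply le_INR in Hj.
    apply Rmult_le_reg_r with (INR (steps m)); [auto |].
    replace (INR j * (Cmod z / INR (steps m)) * INR (steps m)) with (INR j * Cmod z) by (field; lra).
    rewrite (Rmult_comm R0); apply Rmult_le_compat; auto using pos_INR, Cmod_ge_0.
  - eapply Rle_trans; [| apply small_steps, Hm].
    apply Rmult_le_compat_l; [lra |]; unfold Rdiv; apply Rmult_le_compat_r; [left; apply Rinv_0_lt_compat, Pn | auto].
Qed.

Lemma incr_refine_norm R0 m n z j y : 0 < R0 -> R0 * R0 <= INR (S m) -> upper_disc R0 z -> (j <= steps m * S n)%nat ->
  hnorm (Nat.iter j (step (/ INR (S n) * incr m z) (mesh m)) y) <= growth R0 * hnorm y.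
Proof.
  intros HR Hm [Hz1 Hz2] Hj; assert (Pn := steps_pos m).
  assert (Ps : 0 < INR (S n)) by (apply lt_0_INR; lia).
  assert (Ps1 : 1 <= INR (S n)) by (rewrite S_INR; generalize (pos_INR n); lra).
  assert (Pz := Cmod_ge_0 z).
  assert (Pi : 0 < / INR (steps m)) by (apply Rinv_0_lt_compat, Pn).
  assert (Ec : Cmod (/ INR (S n) * incr m z) = / INR (S n) * (Cmod z / INR (steps m))).
  { rewrite Cmod_mult, Cmod_incr, <- RtoC_inv, Cmod_R, Rabs_pos_eq by (try lra; left; apply Rinv_0_lt_compat; auto); auto. }
  apply step_iter_norm; [apply mesh_pos | | |]; rewrite ?Ec.
  - rewrite <- RtoC_inv by lra; unfold incr; rewrite <- RtoC_inv by lra.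
    replace (RtoC (/ INR (S n)) * (RtoC (/ INR (steps m)) * (Ci * z)))%C
      with (RtoC (/ INR (S n) * / INR (steps m)) * (Ci * z))%C by (rewrite RtoC_mult; ring).
    apply Re_scal_Ci; auto; apply Rmult_le_pos; left; auto using Rinv_0_lt_compat.
  - apply le_INR in Hj; rewrite mult_INR in Hj.
    apply Rmult_le_reg_r with (INR (steps m) * INR (S n)); [nra |].
    replace (INR j * (/ INR (S n) * (Cmod z / INR (steps m))) * (INR (steps m) * INR (S n))) with (INR j * Cmod z) by (field; lra).
    rewrite (Rmult_comm R0); apply Rmult_le_compat; auto using pos_INR.
  - eapply Rle_trans; [| apply small_steps, Hm].
    apply Rmult_le_compat_l; [lra |].
    apply Rle_trans with (1 * (Cmod z / INR (steps m))).
    + apply Rmult_le_compat_r; [unfold Rdiv; apply Rmult_le_pos; lra |].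
      rewrite <- Rinv_1; apply Rinv_le_contravar; lra.
    + rewrite Rmult_1_l; unfold Rdiv; apply Rmult_le_compat_r; lra.
Qed.

Lemma euler_lin m z : lin (euler m z).
Proof. apply iter_lin, step_lin, mesh_pos. Qed.

Lemma euler_norm R0 m z w : 0 < R0 -> R0 * R0 <= INR (S m) -> upper_disc R0 z -> hnorm (euler m z w) <= growth R0 * hnorm w.
Proof. intros; apply incr_iter_norm; auto. Qed.

(** The cubic number of steps pays here: the local error is (|z|/N)^2 times the bound 4 (m + 1)^2
    for the squared norm of [regen], and N such errors leave the rate 1/(m + 1), uniformly in the
    refinement n. *)
Lemma euler_refine R0 m n z x : 0 < R0 -> R0 * R0 <= INR (S m) -> upper_disc R0 z ->
  hnorm (hsub (euler m z x) (Nat.iter (steps m * S n) (step (/ INR (S n) * incr m z) (mesh m)) x)) <=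
    growth R0 ^ 4 * (R0 * R0) * hnorm x / INR (S m).
Proof.
  intros HR Hm Hz; assert (Pn := steps_pos m); assert (HM := growth_ge1 R0 ltac:(lra)).
  assert (Pm : 0 < INR (S m)) by (apply lt_0_INR; lia).
  le_trans (iter_refine (incr m z) (mesh m) x (steps m) n (growth R0) (mesh_pos m) HM).
  - intros; apply incr_iter_norm; auto.
  - intros; apply incr_refine_norm; auto.
  - assert (B : hnorm (regen (mesh m) (regen (mesh m) x)) <= (2 / mesh m) * (2 / mesh m) * hnorm x).
    { assert (B1 := regen_norm (mesh m) (regen (mesh m) x) (mesh_pos m)); assert (B2 := regen_norm (mesh m) x (mesh_pos m)).
      assert (Ph := mesh_pos m); assert (P2 : 0 < 2 / mesh m) by (apply Rdiv_lt_0_compat; lra).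
      apply (Rmult_le_compat_l (2 / mesh m)) in B2; [| lra]; lra. }
    replace (2 / mesh m) with (2 * INR (S m)) in B by (unfold mesh; field; lra).
    rewrite Cmod_incr; destruct Hz as [Hz1 Hz2]; assert (Pz := Cmod_ge_0 z).
    assert (Pt := hnorm_pos (regen (mesh m) (regen (mesh m) x))).
    assert (Px := hnorm_pos x).
    apply Rle_trans with (INR (steps m) * (growth R0 * growth R0 * (growth R0 * growth R0 *
      (R0 / INR (steps m) * (R0 / INR (steps m)) * (2 * INR (S m) * (2 * INR (S m)) * hnorm x))))).
    + apply Rmult_le_compat_l; [lra |]; apply Rmult_le_compat_l; [nra |]; apply Rmult_le_compat_l; [nra |].
      assert (Q : 0 <= Cmod z / INR (steps m) <= R0 / INR (steps m)).
      { assert (Pi : 0 < / INR (steps m)) by (apply Rinv_0_lt_compat, Pn).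
        split; unfold Rdiv; [apply Rmult_le_pos; lra | apply Rmult_le_compat_r; lra]. }
      apply Rmult_le_compat; auto; [apply Rmult_le_pos; lra |].
      apply Rmult_le_compat; lra.
    + right; rewrite steps_INR; field; lra.
Qed.

                                                                                 
(** Schemes with different m differ in mesh and in step count. Both are refined to
    [steps m * steps n] steps, where they share the increment c and differ only through [regen]. *)
Lemma euler_difference R0 m n z x : 0 < R0 -> R0 * R0 <= INR (S m) -> R0 * R0 <= INR (S n) -> upper_disc R0 z ->
  hnorm (hsub (euler m z x) (euler n z x)) <= growth R0 ^ 4 * (R0 * R0) * hnorm x / INR (S m)
    + growth R0 ^ 4 * (R0 * R0) * hnorm x / INR (S n)
    + growth R0 * growth R0 * R0 * hnorm (hsub (regen (mesh m) x) (regen (mesh n) x)).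
Proof.
  intros HR Hm Hn Hz; assert (HM := growth_ge1 R0 ltac:(lra)).
  assert (Pm := steps_pos m); assert (Pn := steps_pos n).
  (* The refinement factor in [euler_refine] has the form S n, so the positive step counts are
     written as successors. *)
  assert (ENm : steps m = S (Nat.pred (steps m))) by (apply INR_lt in Pm || (assert (0 < steps m)%nat by (apply INR_lt; auto); lia)).
  assert (ENn : steps n = S (Nat.pred (steps n))) by (assert (0 < steps n)%nat by (apply INR_lt; auto); lia).
  assert (A1 := euler_refine R0 m (Nat.pred (steps n)) z x HR Hm Hz).
  assert (A2 := euler_refine R0 n (Nat.pred (steps m)) z x HR Hn Hz).
  assert (B1 := fun j y => incr_refine_norm R0 m (Nat.pred (steps n)) z j y HR Hm Hz).
  assert (B2 := fun j y => incr_refine_norm R0 n (Nat.pred (steps m)) z j y HR Hn Hz).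
  rewrite <- ENn in A1, B1; rewrite <- ENm in A2, B2.
  rewrite (Nat.mul_comm (steps n)) in A2, B2.
  assert (Nm : RtoC (INR (steps m)) <> 0%C) by rneq.
  assert (Nn : RtoC (INR (steps n)) <> 0%C) by rneq.
  assert (Ec : (/ INR (steps m) * incr n z)%C = (/ INR (steps n) * incr m z)%C) by (unfold incr; ring).
  rewrite Ec in A2, B2.
  set (c := (/ INR (steps n) * incr m z)%C) in *.
  assert (Hc : Cmod c = Cmod z / INR (steps m) / INR (steps n)).
  { unfold c; rewrite Cmod_mult, Cmod_incr, <- RtoC_inv, Cmod_R, Rabs_pos_eq by (try lra; left; apply Rinv_0_lt_compat; auto).
    field; lra. }
  assert (D := iter_difference (steps m * steps n) (growth R0) (step c (mesh m)) (step c (mesh n)) x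
    (step_lin c _ (mesh_pos m)) (step_lin c _ (mesh_pos n))).
  assert (Cm : forall y, step c (mesh m) (step c (mesh n) y) = step c (mesh n) (step c (mesh m) y)).
  { intros y; destruct (regen_lin _ (mesh_pos m)) as [L1 L2]; destruct (regen_lin _ (mesh_pos n)) as [L3 L4].
    unfold step; rewrite L1, L3, L2, L4, (regen_comm (mesh n) (mesh m)) by apply mesh_pos; vec. }
  specialize (D Cm B1 B2 ltac:(lra)).
  replace (hsub (step c (mesh m) x) (step c (mesh n) x)) with (sc c (hsub (regen (mesh m) x) (regen (mesh n) x))) in D
    by (unfold step; vec).
  rewrite hnorm_sc, Hc, mult_INR in D.
  destruct Hz as [Hz1 _].
  set (q := hnorm (hsub (regen (mesh m) x) (regen (mesh n) x))) in *.
  assert (Pq : 0 <= q) by apply hnorm_pos.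
  replace (INR (steps m) * INR (steps n) * (growth R0 * growth R0 * (Cmod z / INR (steps m) / INR (steps n) * q)))
    with (growth R0 * growth R0 * Cmod z * q) in D by (field; lra).
  assert (D' : growth R0 * growth R0 * Cmod z * q <= growth R0 * growth R0 * R0 * q).
  { apply Rmult_le_compat_r; auto; apply Rmult_le_compat_l; auto; nra. }
  le_trans (hnorm_sub_tri (Nat.iter (steps m * steps n) (step c (mesh m)) x)).
  eapply Rle_trans; [apply Rplus_le_compat_l, (hnorm_sub_tri (Nat.iter (steps m * steps n) (step c (mesh n)) x)) |].
  rewrite (hnorm_sub_comm _ (euler n z x)); lra.
Qed.

Lemma eventually_large (A : R) : exists N, forall m, (N <= m)%nat -> A <= INR (S m).
Proof.
  destruct (INR_unbounded A) as [N HN]; exists N; intros m Hm.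
  apply Rle_trans with (INR N); [lra | apply le_INR; lia].
Qed.

Lemma eventually_quotient (A eps : R) : 0 < eps -> exists N, forall m, (N <= m)%nat -> A / INR (S m) <= eps.
Proof.
  intros He; destruct (eventually_large (A / eps)) as [N HN]; exists N; intros m Hm.
  specialize (HN m Hm); assert (Pm : 0 < INR (S m)) by (apply lt_0_INR; lia).
  apply Rmult_le_reg_r with (INR (S m)); auto.
  replace (A / INR (S m) * INR (S m)) with A by (field; lra).
  apply (Rmult_le_compat_l eps) in HN; [| lra].
  replace (eps * (A / eps)) with A in HN by (field; lra); lra.
Qed.

Lemma eventually_regen g w eps : 0 < g -> 0 < eps -> exists N, forall m, (N <= m)%nat ->
  hnorm (hsub (regen (mesh m) (avg V g w)) (dquot V g w)) <= eps.
Proof.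
  intros Hg He; destruct (regen_avg_limit g w eps Hg He) as [d [Hd D]].
  destruct (eventually_quotient 1 (d / 2) ltac:(lra)) as [N HN]; exists N; intros m Hm.
  apply D; split; [apply mesh_pos |].
  specialize (HN m Hm); unfold Rdiv in HN at 1; rewrite Rmult_1_l in HN; fold (mesh m) in HN; lra.
Qed.

Lemma avg_dense w eps : 0 < eps -> exists g, 0 < g /\ hnorm (hsub (avg V g w) w) <= eps.
Proof.
  intros He; destruct (avg_limit V UV w eps He) as [d [Hd D]].
  exists (d / 2); split; [lra | apply D; lra].
Qed.

(** On averaged vectors the operators [regen (mesh m)] converge; the uniform norm bound on the
    half-disc extends this to all w by density. *)
Lemma euler_cauchy R0 w eps : 0 < R0 -> 0 < eps -> exists m0, forall m n z, (m0 <= m)%nat -> (m0 <= n)%nat ->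
  upper_disc R0 z -> hnorm (hsub (euler m z w) (euler n z w)) <= eps.
Proof.
  intros HR He; assert (HM := growth_ge1 R0 ltac:(lra)); set (M := growth R0) in *.
  destruct (avg_dense w (eps / (8 * M))) as [g [Hg Dg]]; [apply Rdiv_lt_0_compat; lra |].
  set (w' := avg V g w) in *.
  assert (PB : 0 < M * M * R0) by (repeat apply Rmult_lt_0_compat; lra).
  destruct (eventually_large (R0 * R0)) as [N1 H1].
  destruct (eventually_quotient (M ^ 4 * (R0 * R0) * hnorm w') (eps / 8) ltac:(lra)) as [N2 H2].
  destruct (eventually_regen g w (eps / (8 * (M * M * R0))) Hg) as [N3 H3]; [apply Rdiv_lt_0_compat; lra |].
  exists (N1 + N2 + N3)%nat; intros m n z Hm Hn Hz.
  assert (D := euler_difference R0 m n z w' HR (H1 m ltac:(lia)) (H1 n ltac:(lia)) Hz); fold M in D.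
  assert (Q1 := H2 m ltac:(lia)); assert (Q2 := H2 n ltac:(lia)).
  assert (Q3 := H3 m ltac:(lia)); assert (Q4 := H3 n ltac:(lia)); fold w' in Q3, Q4.
  assert (Tq := hnorm_sub_tri (dquot V g w) (regen (mesh m) w') (regen (mesh n) w')).
  rewrite (hnorm_sub_comm (dquot V g w)) in Tq.
  assert (Q5 : M * M * R0 * hnorm (hsub (regen (mesh m) w') (regen (mesh n) w')) <= eps / 4).
  { apply Rle_trans with (M * M * R0 * (2 * (eps / (8 * (M * M * R0))))).
    - apply Rmult_le_compat_l; lra.
    - right; field; split; lra. }
  assert (Dw : forall m, (N1 <= m)%nat -> hnorm (hsub (euler m z w) (euler m z w')) <= eps / 8).
  { intros i Hi; rewrite <- lin_sub by apply euler_lin.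
    le_trans (euler_norm R0); auto; fold M.
    rewrite hnorm_sub_comm.
    apply Rle_trans with (M * (eps / (8 * M))); [apply Rmult_le_compat_l; lra | right; field; lra]. }
  assert (W1 := Dw m ltac:(lia)); assert (W2 := Dw n ltac:(lia)).
  le_trans (hnorm_sub_tri (euler m z w')).
  eapply Rle_trans; [apply Rplus_le_compat_l, (hnorm_sub_tri (euler n z w')) |].
  rewrite (hnorm_sub_comm _ (euler n z w)); lra.
Qed.

(** The operator exp(i z G) for Im z >= 0, as a strong limit; for other z nothing is claimed. *)
Definition semigroup (z : C) (w : H) : H := epsilon (inhabits hzero) (fun l => hlim (fun m => euler m z w) l).

Lemma upper_disc_ex z : 0 <= Im z -> exists R0, 0 < R0 /\ upper_disc R0 z.
Proof.
  intros Hz; exists (Cmod z + 1); assert (Pz := Cmod_ge_0 z); split; [lra | split; [lra | auto]].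
Qed.

Lemma semigroup_hlim z w : 0 <= Im z -> hlim (fun m => euler m z w) (semigroup z w).
Proof.
  intros Hz; apply (epsilon_spec (inhabits hzero) (fun l => hlim (fun m => euler m z w) l)).
  apply hlim_complete; intros eps He; destruct (upper_disc_ex z Hz) as [R0 [HR Dz]].
  destruct (euler_cauchy R0 w (eps / 2) HR ltac:(lra)) as [m0 H0]; exists m0; intros m n Hm Hn.
  specialize (H0 m n z Hm Hn Dz); lra.
Qed.

Lemma semigroup_unif R0 w eps : 0 < R0 -> 0 < eps -> exists m0, forall m z, (m0 <= m)%nat -> upper_disc R0 z ->
  hnorm (hsub (euler m z w) (semigroup z w)) <= eps.
Proof.
  intros HR He; destruct (euler_cauchy R0 w (eps / 2) HR ltac:(lra)) as [m0 H0]; exists m0; intros m z Hm Dz.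
  destruct (semigroup_hlim z w (proj2 Dz) (eps / 2) ltac:(lra)) as [n0 H1].
  specialize (H0 m (m0 + n0)%nat z Hm ltac:(lia) Dz); specialize (H1 (m0 + n0)%nat ltac:(lia)).
  le_trans (hnorm_sub_tri (euler (m0 + n0) z w)); lra.
Qed.

Lemma semigroup_norm R0 z w : 0 < R0 -> upper_disc R0 z -> hnorm (semigroup z w) <= growth R0 * hnorm w.
Proof.
  intros HR Dz; destruct (eventually_large (R0 * R0)) as [N HN].
  apply Rnot_lt_le; intros Hlt.
  destruct (semigroup_hlim z w (proj2 Dz) (hnorm (semigroup z w) - growth R0 * hnorm w) ltac:(lra)) as [n0 H1].
  specialize (H1 (N + n0)%nat ltac:(lia)).
  assert (B := euler_norm R0 (N + n0) z w HR (HN (N + n0)%nat ltac:(lia)) Dz).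
  assert (Tq := hnorm_le_sub (semigroup z w) (euler (N + n0) z w)); rewrite hnorm_sub_comm in Tq; lra.
Qed.

Lemma euler_ug m z t w : euler m z (V t w) = V t (euler m z w).
Proof.
  unfold euler; apply iter_comm; intros x; unfold step.
  rewrite (regen_ug (mesh m) t x (mesh_pos m)), (proj1 (ug_lin V UV t)), (proj2 (ug_lin V UV t)); reflexivity.
Qed.

Lemma ug_bnd t : bnd 1 (V t).
Proof. intros x; rewrite (ug_norm V UV); lra. Qed.

Lemma semigroup_ug z t w : 0 <= Im z -> semigroup z (V t w) = V t (semigroup z w).
Proof.
  intros Hz; apply (hlim_unique (fun m => euler m z (V t w))); [apply semigroup_hlim, Hz |].
  eapply hlim_ext; [intros m; symmetry; apply euler_ug |].
  apply (hlim_lin (V t) 1); [apply (ug_lin V UV) | apply ug_bnd | apply semigroup_hlim, Hz].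
Qed.

Lemma ug_iter n t x : Nat.iter n (V t) x = V (INR n * t) x.
Proof.
  induction n as [| n IH]; simpl Nat.iter.
  - rewrite Rmult_0_l, (ug_0 V UV); auto.
  - rewrite IH, <- (ug_add V UV), S_INR; f_equal; ring.
Qed.

Lemma iter_compose n X Y x : (forall x : H, X (Y x) = Y (X x)) ->
  Nat.iter n (fun y => X (Y y)) x = Nat.iter n X (Nat.iter n Y x).
Proof.
  intros E; induction n as [| n IH]; simpl; auto.
  rewrite IH, <- (iter_comm n X Y) by auto; reflexivity.
Qed.

(** V(t) is cut into N factors V(s) with s = t/N and distributed over the Euler steps; a step with
    increment c + i s then agrees with V(s) after a step with increment c up to o(1/N). *)
Lemma euler_shift_avg R0 z t g w eps : 0 < R0 -> upper_disc R0 z -> upper_disc R0 (z + RtoC t) -> Rabs t <= R0 ->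
  0 < g -> 0 < eps -> exists m0, forall m, (m0 <= m)%nat ->
  hnorm (hsub (euler m (z + RtoC t) (avg V g w)) (V t (euler m z (avg V g w)))) <= eps.
Proof.
  intros HR Hz Hzt Ht Hg He; assert (HM := growth_ge1 R0 ltac:(lra)); set (M := growth R0) in *.
  set (w' := avg V g w); set (v := dquot V g w).
  assert (PB : 0 < 8 * (M * M * R0)) by (repeat apply Rmult_lt_0_compat; lra).
  set (e := eps / (8 * (M * M * R0))).
  assert (Pe : 0 < e) by (apply Rdiv_lt_0_compat; lra).
  destruct (avg_gen V UV g w Hg e Pe) as [d1 [P1 D1]].
  destruct (ug_cts V UV v e Pe) as [d2 [P2 D2]].
  destruct (eventually_large (R0 * R0)) as [N1 H1].
  destruct (eventually_regen g w e Hg Pe) as [N3 H3].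
  assert (PQ : 0 < Rmin d1 d2 / 2) by (assert (Q := Rmin_glb_lt _ _ _ P1 P2); lra).
  destruct (eventually_quotient R0 (Rmin d1 d2 / 2) PQ) as [N2 H2].
  exists (N1 + N2 + N3)%nat; intros m Hm.
  specialize (H1 m ltac:(lia)); specialize (H2 m ltac:(lia)); specialize (H3 m ltac:(lia)).
  fold w' v in H3.
  assert (Pn := steps_pos m); assert (Ps : 0 < INR (S m)) by (apply lt_0_INR; lia).
  assert (Ln : INR (S m) <= INR (steps m)).
  { apply le_INR; unfold steps; simpl; nia. }
  set (s := t / INR (steps m)).
  assert (Hs : Rabs s < Rmin d1 d2).
  { unfold s, Rdiv; rewrite Rabs_mult, (Rabs_pos_eq (/ _)) by (left; apply Rinv_0_lt_compat, Pn).
    apply Rle_lt_trans with (R0 / INR (S m)); [| lra].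
    apply Rmult_le_compat; [apply Rabs_pos | left; apply Rinv_0_lt_compat, Pn | auto | apply Rinv_le_contravar; auto]. }
  assert (Hs1 := Rlt_le_trans _ _ _ Hs (Rmin_l _ _)); assert (Hs2 := Rlt_le_trans _ _ _ Hs (Rmin_r _ _)).
  set (c := incr m z).
  assert (Cv : forall c y, V s (step c (mesh m) y) = step c (mesh m) (V s y)).
  { intros c' y; unfold step; rewrite (proj1 (ug_lin V UV s)), (proj2 (ug_lin V UV s)), regen_ug by apply mesh_pos; auto. }
  assert (EV : V t (euler m z w') = Nat.iter (steps m) (fun y => V s (step c (mesh m) y)) w').
  { rewrite iter_compose, ug_iter by apply Cv.
    f_equal; unfold s; field; lra. }
  rewrite EV; unfold euler.
  assert (EC : forall y, step (incr m (z + t)) (mesh m) (V s (step c (mesh m) y)) = V s (step c (mesh m) (step (incr m (z + t)) (mesh m) y))).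
  { intros y; rewrite <- Cv; f_equal.
    destruct (regen_lin _ (mesh_pos m)) as [L1 L2]; unfold step; rewrite !L1, !L2; vec. }
  le_trans (iter_difference (steps m) M).
  - apply step_lin, mesh_pos.
  - apply (lin_comp (V s) (step c (mesh m))); [apply (ug_lin V UV) | apply step_lin, mesh_pos].
  - exact EC.
  - intros; apply incr_iter_norm; auto.
  - intros j y Hj; rewrite iter_compose, ug_iter, (ug_norm V UV) by apply Cv.
    apply incr_iter_norm; auto.
  - lra.
  - assert (NmC : RtoC (INR (steps m)) <> 0%C) by rneq.
    (* The three sources of error: differentiating the group at w', replacing G by [regen], and the
       failure of V(s) to fix [regen (mesh m) w']. *)
    assert (ED : hsub (step (incr m (z + t)) (mesh m) w') (V s (step c (mesh m) w')) =
      hadd (hadd (hopp (hsub (hsub (V s w') w') (sc (Ci * RtoC s) v)))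
        (sc (Ci * RtoC s) (hsub (regen (mesh m) w') v)))
        (sc c (hadd (hsub (regen (mesh m) w') v) (hsub (hsub v (V s v)) (V s (hsub (regen (mesh m) w') v)))))).
    { unfold step; rewrite (proj1 (ug_lin V UV s)), (proj2 (ug_lin V UV s)), (lin_sub (V s)) by apply (ug_lin V UV).
      apply ip_ext; intros u; ipall.
      replace (incr m (z + t)) with (c + Ci * RtoC s)%C.
      - ring.
      - unfold c, incr, s, Rdiv; rewrite RtoC_mult, RtoC_inv by lra; field; auto. }
    cbv beta; fold w'; rewrite ED.
    assert (X1 : hnorm (hsub (hsub (V s w') w') (sc (Ci * RtoC s) v)) <= Rabs s * e).
    { destruct (Req_dec s 0) as [Z | NZ].
      - rewrite Z, (ug_0 V UV), Rabs_R0, Rmult_0_l.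
        replace (hsub (hsub w' w') (sc (Ci * RtoC 0) v)) with (@hzero H) by vec.
        rewrite hnorm_0; lra.
      - assert (D := D1 s NZ Hs1); fold w' v in D.
        assert (NsC : RtoC s <> 0%C) by rneq.
        replace (hsub (hsub (V s w') w') (sc (Ci * RtoC s) v)) with
          (sc (RtoC s) (hsub (sc (/ s)%R (hsub (V s w') w')) (sc Ci v))).
        + rewrite hnorm_sc, Cmod_R; apply Rmult_le_compat_l; [apply Rabs_pos | lra].
        + apply ip_ext; intros u; ipall; rewrite RtoC_inv by auto; field; auto. }
    assert (X2 : hnorm (sc (Ci * RtoC s) (hsub (regen (mesh m) w') v)) <= Rabs s * e).
    { rewrite hnorm_sc, Cmod_mult, Cmod_Ci, Rmult_1_l, Cmod_R; apply Rmult_le_compat_l; [apply Rabs_pos | auto]. }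
    assert (X3 : hnorm (hadd (hsub (regen (mesh m) w') v) (hsub (hsub v (V s v)) (V s (hsub (regen (mesh m) w') v)))) <= 3 * e).
    { le_trans hnorm_add.
      eapply Rle_trans; [apply Rplus_le_compat_l, hnorm_sub |].
      rewrite (ug_norm V UV), (hnorm_sub_comm v); specialize (D2 s Hs2); lra. }
    assert (Hsn : Rabs s * INR (steps m) = Rabs t).
    { unfold s, Rdiv; rewrite Rabs_mult, (Rabs_pos_eq (/ _)) by (left; apply Rinv_0_lt_compat, Pn); field; lra. }
    assert (Hcn : Cmod c * INR (steps m) = Cmod z) by (unfold c; rewrite Cmod_incr; field; lra).
    match goal with |- INR (steps m) * (M * M * hnorm ?X) <= _ => set (Y := X) end.
    assert (X4 : hnorm Y <= 2 * (Rabs s * e) + Cmod c * (3 * e)).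
    { unfold Y; le_trans hnorm_add.
      eapply Rle_trans; [apply Rplus_le_compat_r, hnorm_add |].
      rewrite hnorm_opp, (hnorm_sc c).
      assert (X5 := Rmult_le_compat_l _ _ _ (Cmod_ge_0 c) X3); lra. }
    apply Rle_trans with (INR (steps m) * (M * M * (2 * (Rabs s * e) + Cmod c * (3 * e)))).
    { apply Rmult_le_compat_l; [lra |]; apply Rmult_le_compat_l; [nra | auto]. }
    replace (INR (steps m) * (M * M * (2 * (Rabs s * e) + Cmod c * (3 * e)))) with
      (M * M * e * (2 * (Rabs s * INR (steps m)) + 3 * (Cmod c * INR (steps m)))) by ring.
    rewrite Hsn, Hcn.
    apply Rle_trans with (M * M * e * (5 * R0)).
    { apply Rmult_le_compat_l; [apply Rmult_le_pos; [apply Rmult_le_pos |]; lra | destruct Hz; lra]. }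
    replace (M * M * e * (5 * R0)) with (eps * (5 / 8)) by (unfold e; field; split; lra).
    lra.
Qed.

Lemma semigroup_shift z t w : 0 <= Im z -> semigroup (z + RtoC t) w = V t (semigroup z w).
Proof.
  intros Hz; set (R0 := Cmod z + Rabs t + 1).
  assert (Pz := Cmod_ge_0 z); assert (Pt := Rabs_pos t).
  assert (HR : 0 < R0) by (unfold R0; lra).
  assert (D1 : upper_disc R0 z) by (split; auto; unfold R0; lra).
  assert (D2 : upper_disc R0 (z + RtoC t)).
  { split; [le_trans Cmod_triangle; rewrite Cmod_R; unfold R0; lra |].
    destruct z; simpl in *; lra. }
  assert (HM := growth_ge1 R0 ltac:(lra)).
  apply hnorm_sub_small; intros eps He.
  destruct (avg_dense w (eps / (8 * growth R0))) as [g [Hg Dg]]; [apply Rdiv_lt_0_compat; lra |].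
  destruct (euler_shift_avg R0 z t g w (eps / 4) HR D1 D2 ltac:(unfold R0; lra) Hg ltac:(lra)) as [m0 H0].
  destruct (eventually_large (R0 * R0)) as [N1 H1].
  destruct (semigroup_unif R0 w (eps / 8) HR ltac:(lra)) as [m1 H2].
  set (m := (m0 + N1 + m1)%nat).
  specialize (H0 m ltac:(lia)); specialize (H1 m ltac:(lia)).
  assert (A1 := H2 m _ ltac:(lia) D1); assert (A2 := H2 m _ ltac:(lia) D2).
  set (w' := avg V g w) in *.
  assert (B : growth R0 * hnorm (hsub w' w) <= eps / 8).
  { apply Rle_trans with (growth R0 * (eps / (8 * growth R0))); [apply Rmult_le_compat_l; lra | right; field; lra]. }
  assert (B1 := euler_norm R0 m z (hsub w' w) HR H1 D1); assert (B2 := euler_norm R0 m _ (hsub w' w) HR H1 D2).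
  rewrite lin_sub in B1, B2 by apply euler_lin.
  le_trans (hnorm_sub_tri (euler m (z + t) w)).
  eapply Rle_trans; [apply Rplus_le_compat_l, (hnorm_sub_tri (euler m (z + t) w')) |].
  eapply Rle_trans; [apply Rplus_le_compat_l, Rplus_le_compat_l, (hnorm_sub_tri (V t (euler m z w'))) |].
  eapply Rle_trans; [apply Rplus_le_compat_l, Rplus_le_compat_l, Rplus_le_compat_l, (hnorm_sub_tri (V t (euler m z w))) |].
  rewrite !(ug_norm_sub V UV), (hnorm_sub_comm (semigroup (z + t) w)), (hnorm_sub_comm (euler m (z + t) w) (euler m (z + t) w')).
  lra.
Qed.

(** The boundary values are the given group: shift from z = 0, where every Euler step is the
    identity. *)
Lemma semigroup_real t w : semigroup (RtoC t) w = V t w.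
Proof.
  replace (RtoC t) with (0 + RtoC t)%C by ring.
  rewrite semigroup_shift by (simpl; lra); f_equal.
  apply (hlim_unique (fun m => euler m 0 w)); [apply semigroup_hlim; simpl; lra |].
  intros eps He; exists 0%nat; intros m _.
  replace (euler m 0 w) with w; [replace (hsub w w) with (@hzero H) by vec; rewrite hnorm_0; lra |].
  unfold euler; generalize (steps m); induction n as [| n IH]; simpl; auto.
  rewrite <- IH; unfold step, incr; vec.
Qed.
End Semigroup.

                        

(** * Vector-valued polynomials and their pairings *)

Section VectorPolynomials.
Context {H : HilbertSpace}.

Inductive VPol : (C -> H) -> Prop :=
| VPol_mono p x : Pol p -> VPol (fun z => sc (p z) x)
| VPol_add f g : VPol f -> VPol g -> VPol (fun z => hadd (f z) (g z)).

Lemma VPol_ext f g : (forall z, f z = g z) -> VPol f -> VPol g.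
Proof. intros E; replace g with f by (apply functional_extensionality, E); auto. Qed.

Lemma VPol_const x : VPol (fun _ => x).
Proof. apply VPol_ext with (2 := VPol_mono _ x (Pol_const 1%C)); intros; apply sc_1. Qed.

Lemma VPol_scale p f : Pol p -> VPol f -> VPol (fun z => sc (p z) (f z)).
Proof.
  intros Pp Hf; induction Hf as [q x Pq | f g _ IHf _ IHg].
  - apply VPol_ext with (2 := VPol_mono _ x (Pol_mul _ _ Pp Pq)); intros; vec.
  - apply VPol_ext with (2 := VPol_add _ _ IHf IHg); intros; vec.
Qed.

Lemma VPol_lin A f : lin A -> VPol f -> VPol (fun z => A (f z)).
Proof.
  intros [L1 L2] Hf; induction Hf as [q x Pq | f g _ IHf _ IHg].
  - apply VPol_ext with (2 := VPol_mono _ (A x) Pq); intros; rewrite L2; auto.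
  - apply VPol_ext with (2 := VPol_add _ _ IHf IHg); intros; rewrite L1; auto.
Qed.

Lemma VPol_comp f q : VPol f -> Pol q -> VPol (fun z => f (q z)).
Proof.
  intros Hf Pq; induction Hf as [p x Pp | f g _ IHf _ IHg].
  - apply (VPol_mono (fun z => p (q z))), Pol_comp; auto.
  - apply (VPol_add _ _ IHf IHg).
Qed.

(** The first slot is antilinear, so f is evaluated at the conjugate of z; the two conjugations
    cancel and leave a polynomial in z. *)
Lemma Pol_pairing f g B : VPol f -> VPol g -> lin B -> Pol (fun z => ip (f (Cconj z)) (B (g z))).
Proof.
  intros Hf Hg LB; induction Hf as [p x Pp | f1 f2 _ IH1 _ IH2].
  - induction Hg as [q y Pq | g1 g2 _ IH1 _ IH2].
    + apply Pol_ext with (2 := Pol_mul _ _ (Pol_conj p Pp) (Pol_mul _ _ Pq (Pol_const (ip x (B y))))).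
      intros z; rewrite (proj2 LB), ip_scl, ip_scr; ring.
    + apply Pol_ext with (2 := Pol_add _ _ IH1 IH2); intros z; rewrite (proj1 LB), ip_addr; auto.
  - apply Pol_ext with (2 := Pol_add _ _ IH1 IH2); intros z; rewrite ip_addl; auto.
Qed.

Definition vapprox (D : C -> Prop) (f : C -> H) : Prop :=
  forall eps, 0 < eps -> exists g, VPol g /\ forall z, D z -> hnorm (hsub (f z) (g z)) <= eps.

Lemma vapprox_const D x : vapprox D (fun _ => x).
Proof.
  intros eps He; exists (fun _ => x); split; [apply VPol_const |]; intros.
  replace (hsub x x) with (@hzero H) by vec; rewrite hnorm_0; lra.
Qed.

Lemma vapprox_comp (D D' : C -> Prop) f q : Pol q -> (forall z, D z -> D' (q z)) ->
  vapprox D' f -> vapprox D (fun z => f (q z)).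
Proof.
  intros Pq HD Hf eps He; destruct (Hf eps He) as [g [Pg Hg]].
  exists (fun z => g (q z)); split; [apply VPol_comp; auto | auto].
Qed.

Lemma approx_pairing (D : C -> Prop) f g B K :
  vapprox (fun z => D (Cconj z)) f -> vapprox D g -> lin B -> bnd 1 B ->
  (forall z, D z -> hnorm (f (Cconj z)) <= K) -> (forall z, D z -> hnorm (g z) <= K) ->
  approx D (fun z => ip (f (Cconj z)) (B (g z))).
Proof.
  intros Hf Hg LB BB Kf Kg eps He.
  assert (PK : 0 < Rabs K + 1) by (generalize (Rabs_pos K); lra).
  (* The cap at 1 bounds the approximant of f by |K| + 1. *)
  set (e := Rmin 1 (eps / (2 * (Rabs K + 1)))).
  assert (Pe : 0 < e) by (apply Rmin_glb_lt; [lra | apply Rdiv_lt_0_compat; lra]).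
  assert (e1 : e <= 1) by apply Rmin_l.
  assert (e2 : 2 * (Rabs K + 1) * e <= eps).
  { apply Rle_trans with (2 * (Rabs K + 1) * (eps / (2 * (Rabs K + 1)))).
    - apply Rmult_le_compat_l; [lra | apply Rmin_r].
    - right; field; lra. }
  destruct (Hf e Pe) as [f' [Pf Ff]]; destruct (Hg e Pe) as [g' [Pg Fg]].
  exists (fun z => ip (f' (Cconj z)) (B (g' z))); split; [apply Pol_pairing; auto |].
  intros z Dz.
  assert (Dz' : D (Cconj (Cconj z))) by (rewrite Cconj_conj; auto).
  assert (X1 := Ff (Cconj z) Dz'); assert (X2 := Fg z Dz).
  assert (X3 := Kf z Dz); assert (X4 := Kg z Dz); assert (LK := Rle_abs K).
  replace (ip (f (Cconj z)) (B (g z)) - ip (f' (Cconj z)) (B (g' z)))%C with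
    (ip (hsub (f (Cconj z)) (f' (Cconj z))) (B (g z)) + ip (f' (Cconj z)) (B (hsub (g z) (g' z))))%C
    by (rewrite lin_sub, ip_subl, ip_subr by auto; ring).
  le_trans Cmod_triangle.
  assert (Y1 := cauchy_schwarz (hsub (f (Cconj z)) (f' (Cconj z))) (B (g z))).
  assert (Y2 := cauchy_schwarz (f' (Cconj z)) (B (hsub (g z) (g' z)))).
  assert (Z1 := BB (g z)); assert (Z2 := BB (hsub (g z) (g' z))).
  assert (W := hnorm_le_sub (f' (Cconj z)) (f (Cconj z))).
  rewrite hnorm_sub_comm in W.
  assert (Q1 : hnorm (hsub (f (Cconj z)) (f' (Cconj z))) * hnorm (B (g z)) <= e * (Rabs K + 1)).
  { apply Rmult_le_compat; auto using hnorm_pos; lra. }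
  assert (Q2 : hnorm (f' (Cconj z)) * hnorm (B (hsub (g z) (g' z))) <= (Rabs K + 1) * e).
  { apply Rmult_le_compat; auto using hnorm_pos; lra. }
  lra.
Qed.
End VectorPolynomials.

(** * Analytic continuation of orbit coefficients *)

Section Uniqueness.
Context {H : HilbertSpace}.
Variables (V : R -> H -> H) (k : R).
Hypothesis UV : unitary_group V.
Hypothesis Hk : 0 <= k.
Hypothesis Hgen : forall phi psi, is_gen V phi psi -> - k * (hnorm phi * hnorm phi) <= Re (ip phi psi).

Notation S := (semigroup V).

Lemma VPol_euler m w : VPol (fun z => euler V m z w).
Proof.
  unfold euler; generalize (steps m) as n; intros n; induction n as [| n IH]; simpl.
  - apply VPol_const.
  - unfold step at 1; apply VPol_add; [exact IH |].
    apply (VPol_scale (incr m) (fun z => regen V (mesh m) (Nat.iter n (step V (incr m z) (mesh m)) w))).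
    + unfold incr; apply (Pol_mul (fun _ => (/ INR (steps m))%C)); [apply Pol_const |].
      apply (Pol_mul (fun _ => Ci)); [apply Pol_const | apply Pol_id].
    + apply VPol_lin; [apply regen_lin; [exact UV | apply mesh_pos] | exact IH].
Qed.

Lemma vapprox_semigroup R0 w : 0 < R0 -> vapprox (upper_disc R0) (fun z => S z w).
Proof.
  intros HR eps He; destruct (semigroup_unif V k UV Hk Hgen R0 w eps HR He) as [m H0].
  exists (fun z => euler V m z w); split; [apply VPol_euler |].
  intros z Dz; rewrite hnorm_sub_comm; apply H0; auto.
Qed.

Lemma approx_semigroup R0 phi psi : 0 < R0 -> approx (upper_disc R0) (fun z => ip phi (S z psi)).
Proof.
  intros HR.
  apply (approx_pairing (upper_disc R0) (fun _ => phi) (fun z => S z psi) (fun x => x)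
    (Rmax (hnorm phi) (growth k R0 * hnorm psi))).
  - apply vapprox_const.
  - apply vapprox_semigroup, HR.
  - split; auto.
  - intros x; lra.
  - intros; apply Rmax_l.
  - intros z Dz; eapply Rle_trans; [| apply Rmax_r]; apply semigroup_norm; auto.
Qed.

Lemma upper_disc_im R0 z : upper_disc R0 z -> Im z <= R0.
Proof. intros [A _]; assert (B := im_le_Cmod z); apply Rabs_le_between in B; lra. Qed.

(** Approximability on the closed half-disc includes continuity up to the real axis, so zeros inside
    pass to the boundary. *)
Lemma semigroup_boundary_zero phi psi (t : R) : (exists d, 0 < d /\ forall c, 0 < c < d -> ip phi (S (t, c) psi) = 0%C) ->
  ip phi (V t psi) = 0%C.
Proof.
  intros [d [Hd Z]].
  rewrite <- (semigroup_real V k UV Hk Hgen).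
  set (R0 := Rabs t + 1); assert (Pt := Rabs_pos t).
  assert (Dt : upper_disc R0 (RtoC t)) by (split; [rewrite Cmod_R; unfold R0; lra | simpl; lra]).
  apply (Cmod_small_eq0 _ 1); [lra |]; intros eps He.
  destruct (approx_cts _ _ (RtoC t) (approx_semigroup R0 phi psi ltac:(unfold R0; lra)) Dt eps ltac:(lra)) as [d' [Hd' D]].
  set (c := Rmin 1 (Rmin d d') / 2).
  assert (Pc : 0 < Rmin 1 (Rmin d d')) by (repeat apply Rmin_glb_lt; lra).
  assert (c1 : Rmin 1 (Rmin d d') <= 1) by apply Rmin_l.
  assert (c2 : Rmin 1 (Rmin d d') <= Rmin d d') by apply Rmin_r.
  assert (c3 := Rmin_l d d'); assert (c4 := Rmin_r d d').
  assert (Ec : (t, c) = (RtoC t + (0, c))%C) by (cring).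
  specialize (D (t, c)); rewrite Z in D by (unfold c; lra).
  assert (Q : Cmod (0 - ip phi (S (RtoC t) psi)) < eps).
  { apply D.
    - split; [| simpl; unfold c; lra].
      rewrite Ec; le_trans Cmod_triangle.
      rewrite Cmod_R, pure_im_Cmod by (unfold c; lra); unfold R0, c; lra.
    - rewrite Ec; replace (RtoC t + (0, c) - RtoC t)%C with ((0, c) : C) by (cring).
      rewrite pure_im_Cmod; unfold c; lra. }
  replace (0 - ip phi (S (RtoC t) psi))%C with (- ip phi (S (RtoC t) psi))%C in Q by ring.
  rewrite Cmod_opp in Q; lra.
Qed.

(** Zeros on a real interval first spread into the open half plane by [half_disc_zero]. They then
    spread along the line Im z = c, where discs of radius c fit above the axis, and finally return
    to the boundary at the desired t. *)
Lemma orbit_coefficient_zero phi psi r : 0 < r -> (forall t, Rabs t < r -> ip phi (V t psi) = 0%C) ->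
  forall t, ip phi (V t psi) = 0%C.
Proof.
  intros Hr Z t0; apply semigroup_boundary_zero; exists (r / 2); split; [lra |]; intros c Hc.
  assert (Base : forall t, Rabs t < r / 2 -> ip phi (S (t, c) psi) = 0%C).
  { intros t Ht.
    assert (Pt := Rabs_pos t).
    assert (E := half_disc_zero (r / 2) (fun z => ip phi (S (z + RtoC t) psi)) c Hc).
    cbv beta in E; replace (t, c) with ((0, c) + RtoC t)%C by (cring).
    apply E.
    - apply (approx_comp _ (upper_disc r) (fun z => ip phi (S z psi))).
      + apply (Pol_add (fun z => z)); [apply Pol_id | apply Pol_const].
      + intros z [Hz1 Hz2]; split.
        * le_trans Cmod_triangle; rewrite Cmod_R; lra.
        * destruct z; simpl in *; lra.
      + apply approx_semigroup; lra.
    - intros x Hx; rewrite <- RtoC_plus, (semigroup_real V k UV Hk Hgen); apply Z.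
      eapply Rle_lt_trans; [apply Rabs_triang |]; lra. }
  (* Zeros at distance between c/8 and c/4 on the side towards 0 force a zero at the centre, so the
     known interval grows by c/8 each time; it is already longer than c/4 since c < r/2. *)
  assert (Step : forall n t, Rabs t < r / 2 + INR n * (c / 8) -> ip phi (S (t, c) psi) = 0%C).
  { induction n as [| n IH]; intros t Ht; [apply Base; simpl in Ht; lra |].
    rewrite S_INR in Ht; assert (Pn := pos_INR n); assert (Pnc : 0 <= INR n * (c / 8)) by nra.
    assert (Ap : approx (disc c) (fun z => ip phi (S (z + (t, c)) psi))).
    { apply (approx_comp _ (upper_disc (2 * c + Rabs t + 1)) (fun z => ip phi (S z psi))).
      - apply (Pol_add (fun z => z)); [apply Pol_id | apply Pol_const].
      - intros z Hz; unfold disc in Hz; split.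
        + replace (t, c) with ((0, c) + RtoC t)%C by (cring).
          le_trans Cmod_triangle.
          eapply Rle_trans; [apply Rplus_le_compat_l, Cmod_triangle |].
          rewrite Cmod_R, pure_im_Cmod; lra.
        + assert (B := im_le_Cmod z); apply Rabs_le_between in B; destruct z; simpl in *; lra.
      - apply approx_semigroup; generalize (Rabs_pos t); lra. }
    replace (t, c) with (RtoC 0 + (t, c))%C by ring.
    assert (Ht' := Ht); apply Rabs_lt_between in Ht'.
    assert (Zx : forall x, Rabs (x + t) < r / 2 + INR n * (c / 8) -> ip phi (S (RtoC x + (t, c)) psi) = 0%C).
    { intros x Hx; replace (RtoC x + (t, c))%C with ((x + t, c) : C) by (cring).
      apply IH, Hx. }
    destruct (Rle_dec 0 t) as [Pt | Nt].
    - apply (center_zero c (fun z => ip phi (S (z + (t, c)) psi)) (- (c / 4)) (- (c / 8)) Ap); [lra | | |].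
      + rewrite Rabs_Ropp, Rabs_pos_eq; lra.
      + rewrite Rabs_Ropp, Rabs_pos_eq; lra.
      + intros x Hx; apply Zx, Rabs_lt_between; lra.
    - apply (center_zero c (fun z => ip phi (S (z + (t, c)) psi)) (c / 8) (c / 4) Ap); [lra | | |].
      + rewrite Rabs_pos_eq; lra.
      + rewrite Rabs_pos_eq; lra.
      + intros x Hx; apply Zx, Rabs_lt_between; lra. }
  destruct (INR_unbounded (Rabs t0 / (c / 8))) as [n Hn].
  apply (Step n).
  apply (Rmult_lt_compat_r (c / 8)) in Hn; [| lra].
  replace (Rabs t0 / (c / 8) * (c / 8)) with (Rabs t0) in Hn by (field; lra); lra.
Qed.

(** If v is orthogonal to the range of S(i s), then <v, S(z) v> vanishes on the line Im z = s,
    because S(i s + t) = S(i s) V(t). Reflecting the strip below that line into an upper half-disc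
    moves the zeros down to Im z > 0 near 0, and the boundary value at 0 is <v, v>. *)
Lemma semigroup_range_dense s v : 0 < s -> (forall x, ip v (S (0, s) x) = 0%C) -> v = hzero.
Proof.
  intros Hs Z.
  assert (E : ip v (V 0 v) = 0%C).
  { apply semigroup_boundary_zero; exists s; split; [exact Hs |]; intros c Hc.
    (* Conjugation reflects the lower half-disc hanging from i s; the point i (s - c) goes to i
       c. *)
    assert (Q := half_disc_zero s (fun z => Cconj (ip v (S (Cconj z + (0, s)) v))) (s - c) ltac:(lra)).
    cbv beta in Q.
    assert (Q' : Cconj (ip v (S (Cconj (0, s - c) + (0, s)) v)) = 0%C).
    { apply Q.
      - apply (approx_conj (upper_disc s) (fun z => upper_disc s (Cconj z)) (fun z => ip v (S (z + (0, s)) v))).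
        { intros z Dz; rewrite Cconj_conj; auto. }
        apply (approx_comp _ (upper_disc (2 * s)) (fun z => ip v (S z v))).
        + apply (Pol_add (fun z => z)); [apply Pol_id | apply Pol_const].
        + intros z Dz; assert (B := upper_disc_im _ _ Dz); destruct Dz as [D1 D2].
          rewrite Cmod_conj in D1; split.
          * le_trans Cmod_triangle; rewrite pure_im_Cmod; lra.
          * destruct z; simpl in *; lra.
        + apply approx_semigroup; lra.
      - intros x _.
        replace (Cconj (RtoC x) + (0, s))%C with ((0, s) + RtoC x)%C by (cring).
        rewrite (semigroup_shift V k UV Hk Hgen), <- (semigroup_ug V k UV Hk Hgen), Z by (simpl; lra).
        cring. }
    replace (Cconj (0, (s - c)%R) + (0, s))%C with ((0, c) : C) in Q' by (cring).
    rewrite <- (Cconj_conj (ip v _)), Q'; cring. }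
  rewrite (ug_0 V UV) in E; apply ip_def; rewrite E; reflexivity.
Qed.

(** * Borchers' lemma for two orthogonal projections *)

Variables (p q : H -> H) (eps : R).
Hypothesis Lp : lin p.
Hypothesis Bp : bnd 1 p.
Hypothesis Bq : bnd 1 q.
Hypothesis Sp : selfadj p.
Hypothesis Sq : selfadj q.
Hypothesis Ip : forall x, p (p x) = p x.
Hypothesis Opq : forall x, p (q x) = hzero.
Hypothesis Heps : 0 < eps.

Definition moved (t : R) (x : H) : H := V (- t) (p (V t x)).
Hypothesis Cpq : forall t x, Rabs t < eps -> moved t (q x) = q (moved t x).

Fixpoint moved_prod (l : list R) (x : H) : H :=
  match l with nil => x | a :: l' => moved a (moved_prod l' x) end.

Lemma moved_lin t : lin (moved t).
Proof.
  apply (lin_comp (V (- t)) (fun x => p (V t x))); [apply (ug_lin V UV) |].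
  apply (lin_comp p (V t)); [exact Lp | apply (ug_lin V UV)].
Qed.

Lemma moved_norm t x : hnorm (moved t x) <= hnorm x.
Proof.
  unfold moved; rewrite (ug_norm V UV).
  assert (B := Bp (V t x)); rewrite (ug_norm V UV) in B; lra.
Qed.

Lemma moved_selfadj t : selfadj (moved t).
Proof.
  intros x y; unfold moved; rewrite (ug_adj V UV), Ropp_involutive, Sp.
  rewrite (ug_adj V UV); reflexivity.
Qed.

Lemma moved_idem t x : moved t (moved t x) = moved t x.
Proof. unfold moved; rewrite (ug_inv' V UV), Ip; reflexivity. Qed.

Lemma moved_0 x : moved 0 x = p x.
Proof. unfold moved; rewrite Ropp_0, !(ug_0 V UV); reflexivity. Qed.

Lemma moved_cts t x e : 0 < e -> exists d, 0 < d /\ forall s, Rabs (s - t) < d ->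
  hnorm (hsub (moved s x) (moved t x)) < e.
Proof.
  intros He; unfold moved.
  destruct (ug_cts_at V UV x t (e / 2) ltac:(lra)) as [d1 [P1 D1]].
  destruct (ug_cts_at V UV (p (V t x)) (- t) (e / 2) ltac:(lra)) as [d2 [P2 D2]].
  exists (Rmin d1 d2); split; [apply Rmin_glb_lt; auto |]; intros s Hs.
  assert (M1 := Rmin_l d1 d2); assert (M2 := Rmin_r d1 d2).
  eapply Rle_lt_trans; [apply (hnorm_sub_tri (V (- s) (p (V t x)))) |].
  rewrite (ug_norm_sub V UV), <- (lin_sub p) by auto.
  assert (B := Bp (hsub (V s x) (V t x))).
  specialize (D1 s ltac:(lra)); specialize (D2 (- s)).
  replace (- s - - t) with (- (s - t)) in D2 by ring; rewrite Rabs_Ropp in D2.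
  specialize (D2 ltac:(lra)); lra.
Qed.

Lemma moved_prod_lin l : lin (moved_prod l).
Proof.
  induction l as [| a l IH]; simpl; [split; auto |].
  apply (lin_comp (moved a) (moved_prod l)); auto using moved_lin.
Qed.

Lemma moved_prod_norm l x : hnorm (moved_prod l x) <= hnorm x.
Proof.
  induction l as [| a l IH]; simpl; [lra |].
  eapply Rle_trans; [apply moved_norm | exact IH].
Qed.

Lemma moved_prod_comm l x : (forall a, In a l -> Rabs a < eps) -> moved_prod l (q x) = q (moved_prod l x).
Proof.
  induction l as [| a l IH]; simpl; intros Hl; auto.
  rewrite IH, Cpq by auto; reflexivity.
Qed.

(** At the parameter 0 the factor is p itself; q is carried up to it and p q = 0. *)
Lemma moved_prod_zero l x : (forall a, In a l -> Rabs a < eps) -> In 0 l -> moved_prod l (q x) = hzero.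
Proof.
  induction l as [| a l IH]; simpl; intros Hl I0; [contradiction |].
  destruct I0 as [E | I0].
  - subst a; rewrite moved_prod_comm by auto; rewrite moved_0; apply Opq.
  - rewrite IH by auto; apply lin_0, moved_lin.
Qed.

(** Time translation only shifts the parameters, which is why the function f has its zeros at their
    negatives. *)
Lemma ug_moved_prod t l x : V (- t) (moved_prod l (V t x)) = moved_prod (map (fun a => a + t) l) x.
Proof.
  induction l as [| a l IH]; simpl; [apply (ug_inv V UV) |].
  rewrite <- IH; unfold moved.
  rewrite (ug_add V UV a t), (ug_inv' V UV), <- (ug_add V UV).
  f_equal; ring.
Qed.

(** Factors with parameters close to c act like powers of the projection [moved c], which by
    idempotence equal its first power. One needs at least one factor, hence length n + 1. *)
Lemma moved_prod_limit c n x : forall e, 0 < e -> exists d, 0 < d /\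
  forall l : list R, length l = Datatypes.S n -> (forall a, In a l -> Rabs (a - c) < d) ->
    hnorm (hsub (moved_prod l x) (moved c x)) <= e.
Proof.
  induction n as [| n IH]; intros e He.
  - destruct (moved_cts c x e He) as [d [Hd D]]; exists d; split; auto.
    intros [| a [| a' l]] El Hl; simpl in El; try lia; simpl.
    left; apply D, Hl; left; auto.
  - destruct (IH (e / 2) ltac:(lra)) as [d1 [P1 D1]].
    destruct (moved_cts c (moved c x) (e / 2) ltac:(lra)) as [d2 [P2 D2]].
    exists (Rmin d1 d2); split; [apply Rmin_glb_lt; auto |].
    assert (M1 := Rmin_l d1 d2); assert (M2 := Rmin_r d1 d2).
    intros [| a l] El Hl; simpl in El; [lia |]; simpl moved_prod.
    le_trans (hnorm_sub_tri (moved a (moved c x))).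
    rewrite <- lin_sub by apply moved_lin.
    assert (X1 := moved_norm a (hsub (moved_prod l x) (moved c x))).
    assert (X2 : hnorm (hsub (moved_prod l x) (moved c x)) <= e / 2).
    { apply D1; [lia |]; intros a' Ha'; assert (Y := Hl a' (or_intror Ha')); lra. }
    assert (X3 : hnorm (hsub (moved a (moved c x)) (moved c (moved c x))) < e / 2).
    { apply D2; assert (Y := Hl a (or_introl eq_refl)); lra. }
    rewrite (moved_idem c) in X3; lra.
Qed.

                                                                           
                                                                               
                                                                                   
(** This is the Schwarz lemma [center_bound] applied to f. The condition r + rho < eps keeps every
    shifted parameter a + t with |t| <= r in the range where commutation holds, and the bound on f
    is the same for all lengths of l because each factor is a contraction. *)
Lemma moved_prod_bound x y r rho l : 0 <= rho < r -> r + rho < eps -> NoDup l ->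
  (forall a, In a l -> Rabs a <= rho) ->
  Cmod (ip (S (0, r) x) (moved_prod l (q (S (0, r) y)))) <=
    2 * (growth k (2 * r) ^ 3 * (hnorm x * hnorm y)) * (rho / (r - rho)) ^ length l.
Proof.
  intros Hrho Hr ND Hl.
  assert (Pr : 0 < r) by lra.
  set (Mr := growth k (2 * r)).
  assert (HM : 1 <= Mr) by (apply growth_ge1; [exact Hk | lra]).
  assert (Px := hnorm_pos x); assert (Py := hnorm_pos y).
  assert (HS : forall z w, upper_disc (2 * r) z -> hnorm (S z w) <= Mr * hnorm w).
  { intros z w Dz; apply semigroup_norm; auto; lra. }
  assert (D0 : upper_disc (2 * r) (0, r)) by (split; [rewrite pure_im_Cmod | simpl]; lra).
  assert (BQ : forall w, hnorm (q w) <= hnorm w) by (intros w; generalize (Bq w); lra).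
  assert (LB : forall a, In a l -> Rabs a < eps) by (intros a Ha; specialize (Hl a Ha); lra).
  assert (Dup : forall z, upper_disc r z -> upper_disc (2 * r) z) by (intros z [A B]; split; lra).
  assert (Dsh : forall z, Cmod z <= r -> upper_disc (2 * r) (z + (0, r))).
  { intros z Hz; split.
    - le_trans Cmod_triangle; rewrite pure_im_Cmod; lra.
    - assert (B := im_le_Cmod z); apply Rabs_le_between in B; destruct z; simpl in *; lra. }
  (* In [u] the vector behind q moves by S(z), which needs Im z >= 0, while the other one carries
     the shift i r that makes conj z admissible. In [v] q has passed to the left and the roles are
     exchanged, which suits Im z <= 0. *)
  set (u := fun z => ip (S (Cconj z + (0, r)) x) (moved_prod l (S z (q (S (0, r) y))))).
  set (v := fun z => ip (S (Cconj z) (q (S (0, r) x))) (moved_prod l (S (z + (0, r)) y))).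
  assert (BM : bnd 1 (moved_prod l)) by (intros w; generalize (moved_prod_norm l w); lra).
  assert (LM := moved_prod_lin l).
  assert (Psh : Pol (fun z => (z + (0, r))%C)) by (apply (Pol_add (fun z => z)); [apply Pol_id | apply Pol_const]).
  assert (Bx : forall z, Cmod z <= r -> hnorm (S (z + (0, r)) x) <= Mr * hnorm x) by auto.
  assert (By : forall z, Cmod z <= r -> hnorm (S (z + (0, r)) y) <= Mr * hnorm y) by auto.
  assert (Bqx : forall z, upper_disc r z -> hnorm (S z (q (S (0, r) x))) <= Mr * Mr * hnorm x).
  { intros z Dz; eapply Rle_trans; [apply HS; auto |]; rewrite Rmult_assoc.
    apply Rmult_le_compat_l; [lra |]; eapply Rle_trans; [apply BQ | apply HS, D0]. }
  assert (Bqy : forall z, upper_disc r z -> hnorm (S z (q (S (0, r) y))) <= Mr * Mr * hnorm y).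
  { intros z Dz; eapply Rle_trans; [apply HS; auto |]; rewrite Rmult_assoc.
    apply Rmult_le_compat_l; [lra |]; eapply Rle_trans; [apply BQ | apply HS, D0]. }
  assert (Cup : forall z, lower_disc r z -> upper_disc r (Cconj z)).
  { intros z [A B]; split; [rewrite Cmod_conj; auto | destruct z; simpl in *; lra]. }
  assert (PM2 : Mr <= Mr * Mr) by nra.
  set (K0 := Mr * Mr * (hnorm x + hnorm y)).
  assert (Kx : Mr * hnorm x <= K0) by (unfold K0; nra).
  assert (Ky : Mr * hnorm y <= K0) by (unfold K0; nra).
  assert (PMM : 0 <= Mr * Mr) by nra.
  assert (Kxx : Mr * Mr * hnorm x <= K0) by (unfold K0; nra).
  assert (Kyy : Mr * Mr * hnorm y <= K0) by (unfold K0; nra).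
  assert (Au : approx (upper_disc r) u).
  { apply (approx_pairing (upper_disc r) (fun z => S (z + (0, r)) x) (fun z => S z (q (S (0, r) y))) _ K0); auto.
    - apply (vapprox_comp _ (upper_disc (2 * r)) (fun z => S z x)); [exact Psh | | apply vapprox_semigroup; lra].
      intros z [A _]; rewrite Cmod_conj in A; auto.
    - apply vapprox_semigroup, Pr.
    - intros z [A _]; eapply Rle_trans; [apply Bx; rewrite Cmod_conj; auto | auto].
    - intros z Dz; eapply Rle_trans; [apply Bqy; auto | auto]. }
  assert (Av : approx (lower_disc r) v).
  { apply (approx_pairing (lower_disc r) (fun z => S z (q (S (0, r) x))) (fun z => S (z + (0, r)) y) _ K0); auto.
    - apply (vapprox_comp _ (upper_disc r) (fun z => S z (q (S (0, r) x))) (fun z => z)); [apply Pol_id | | apply vapprox_semigroup; lra].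
      intros z Dz; apply Cup in Dz; rewrite Cconj_conj in Dz; exact Dz.
    - apply (vapprox_comp _ (upper_disc (2 * r)) (fun z => S z y)); [exact Psh | | apply vapprox_semigroup; lra].
      intros z [A _]; auto.
    - intros z Dz; eapply Rle_trans; [apply Bqx; auto | auto].
    - intros z [A _]; eapply Rle_trans; [apply By; auto | auto]. }
  assert (Rsh : forall (t : R) w, S (Cconj (RtoC t) + (0, r)) w = V t (S (0, r) w)).
  { intros t w; replace (Cconj (RtoC t) + (0, r))%C with ((0, r) + RtoC t)%C by (cring).
    apply (semigroup_shift V k UV Hk Hgen); simpl; lra. }
  assert (Eu : forall t : R, u (RtoC t) =
     ip (S (0, r) x) (moved_prod (map (fun a => a + t) l) (q (S (0, r) y)))).
  { intros t; unfold u; rewrite Rsh, (semigroup_real V k UV Hk Hgen), (ug_adj V UV), ug_moved_prod; reflexivity. }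
  assert (Lt : forall t, Rabs t <= r -> forall b, In b (map (fun a => a + t) l) -> Rabs b < eps).
  { intros t Ht b Hb; apply in_map_iff in Hb as [a [<- Ha]].
    eapply Rle_lt_trans; [apply Rabs_triang |]; specialize (Hl a Ha); lra. }
  assert (Huv : forall t : R, Rabs t <= r -> u (RtoC t) = v (RtoC t)).
  { intros t Ht; rewrite Eu; unfold v.
    replace (Cconj (RtoC t)) with (RtoC t) by (cring).
    replace (RtoC t + (0, r))%C with (Cconj (RtoC t) + (0, r))%C by (cring).
    rewrite Rsh, (semigroup_real V k UV Hk Hgen), (ug_adj V UV), ug_moved_prod, Sq, moved_prod_comm by (apply Lt; auto).
    reflexivity. }
  (* One factor of [Mr] for the vector without q, and two for the vector that is evolved, hit by q
     and evolved again. *)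
  set (K := Mr ^ 3 * (hnorm x * hnorm y)).
  assert (Bu : forall z, upper_disc r z -> Cmod (u z) <= K).
  { intros z Dz; unfold u; le_trans cauchy_schwarz.
    replace K with ((Mr * hnorm x) * (Mr * Mr * hnorm y)) by (unfold K; ring).
    apply Rmult_le_compat; auto using hnorm_pos.
    - apply Bx; rewrite Cmod_conj; apply Dz.
    - eapply Rle_trans; [apply moved_prod_norm | apply Bqy, Dz]. }
  assert (Bv : forall z, lower_disc r z -> Cmod (v z) <= K).
  { intros z Dz; unfold v; le_trans cauchy_schwarz.
    replace K with ((Mr * Mr * hnorm x) * (Mr * hnorm y)) by (unfold K; ring).
    apply Rmult_le_compat; auto using hnorm_pos.
    eapply Rle_trans; [apply moved_prod_norm | apply By, Dz]. }
  (* The zeros of u are the negatives of the parameters. *)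
  assert (NDo : NoDup (map Ropp l)).
  { apply NoDup_map_NoDup_ForallPairs; [| exact ND]; intros a b _ _ E; lra. }
  assert (B := center_bound r u v Pr Au Av Huv (map Ropp l) K rho Hrho NDo).
  rewrite length_map in B.
  replace (moved_prod l (q (S (0, r) y))) with (moved_prod (map (fun a => a + 0) l) (q (S (0, r) y))).
  2: { f_equal; transitivity (map (fun a => a) l); [apply map_ext; intros; ring | apply map_id]. }
  rewrite <- Eu; apply B; auto.
  intros b Hb; apply in_map_iff in Hb as [a [<- Ha]]; specialize (Hl a Ha).
  rewrite Rabs_Ropp; split; [exact Hl |].
  rewrite Eu, moved_prod_zero, ip_0r; auto.
  - apply Lt; rewrite Rabs_Ropp; lra.
  - apply in_map_iff; exists a; split; [ring | exact Ha].
Qed.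

Lemma borchers c x : Rabs c < eps / 8 -> p (V c (q x)) = hzero.
Proof.
  (* With rho = eps/8 this gives the ratio rho / (r - rho) = 1/3 and r + rho < eps. *)
  intros Hc; set (r := eps / 2).
  assert (Pr : 0 < r) by (unfold r; lra).
  assert (Weak : forall x y, ip (S (0, r) x) (moved c (q (S (0, r) y))) = 0%C).
  { clear x; intros x y; apply Cmod_eq_0.
    set (A := 2 * (growth k (2 * r) ^ 3 * (hnorm x * hnorm y))).
    apply geometric_zero with (A / 3) (/ 3); [apply Cmod_ge_0 | lra |]; intros n.
    apply Rle_trans with (A * (/ 3) ^ Datatypes.S n); [| right; simpl; field].
    apply le_epsilon; intros e He.
    assert (Px := hnorm_pos (S (0, r) x)).
    destruct (moved_prod_limit c n (q (S (0, r) y)) (e / (hnorm (S (0, r) x) + 1))) as [d [Hd D]];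
      [apply Rdiv_lt_0_compat; lra |].
    (* All parameters must be close to c for the limit and also stay within rho = eps/8 of 0. *)
    set (d' := Rmin d (eps / 8 - Rabs c)).
    assert (Pd : 0 < d') by (apply Rmin_glb_lt; lra).
    assert (d1 : d' <= d) by apply Rmin_l; assert (d2 : d' <= eps / 8 - Rabs c) by apply Rmin_r.
    destruct (distinct_points (c - d') (c + d') (Datatypes.S n) ltac:(lra)) as [l [ND [Ll Hl]]].
    assert (Hl1 : forall a, In a l -> Rabs (a - c) < d').
    { intros a Ha; specialize (Hl a Ha); apply Rabs_lt_between; lra. }
    assert (B := moved_prod_bound x y r (eps / 8) l ltac:(unfold r; lra) ltac:(unfold r; lra) ND).
    fold A in B; rewrite Ll in B.
    replace (eps / 8 / (r - eps / 8)) with (/ 3) in B by (unfold r; field; lra).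
    assert (B' : Cmod (ip (S (0, r) x) (moved_prod l (q (S (0, r) y)))) <= A * (/ 3) ^ Datatypes.S n).
    { apply B; intros a Ha; specialize (Hl1 a Ha).
      replace a with ((a - c) + c) by ring; le_trans Rabs_triang; lra. }
    specialize (D l Ll (fun a Ha => Rlt_le_trans _ _ _ (Hl1 a Ha) d1)).
    assert (E := hnorm_sub_comm (moved_prod l (q (S (0, r) y))) (moved c (q (S (0, r) y)))).
    rewrite E in D; clear E.
    replace (moved c (q (S (0, r) y))) with
      (hadd (moved_prod l (q (S (0, r) y))) (hsub (moved c (q (S (0, r) y))) (moved_prod l (q (S (0, r) y))))) by vec.
    rewrite ip_addr; le_trans Cmod_triangle.
    apply Rplus_le_compat; [exact B' |].
    le_trans cauchy_schwarz.
    eapply Rle_trans; [apply Rmult_le_compat_l; [exact Px | exact D] |].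
    apply Rmult_le_reg_r with (hnorm (S (0, r) x) + 1); [lra |].
    replace (hnorm (S (0, r) x) * (e / (hnorm (S (0, r) x) + 1)) * (hnorm (S (0, r) x) + 1))
      with (hnorm (S (0, r) x) * e) by (field; lra).
    nra. }
  assert (Weak1 : forall y, moved c (q (S (0, r) y)) = hzero).
  { intros y; apply (semigroup_range_dense r); [exact Pr |]; intros x0.
    rewrite ip_conj, Weak; cring. }
  (* Density has removed the left vector; the right one is removed by taking adjoints and using
     density once more. Commutation then restores the order of the factors. *)
  assert (Weak2 : q (moved c x) = hzero).
  { apply (semigroup_range_dense r); [exact Pr |]; intros y.
    rewrite Sq, moved_selfadj, Weak1; apply ip_0r. }
  rewrite <- Cpq in Weak2 by lra; unfold moved in Weak2.
  apply (f_equal (V c)) in Weak2; rewrite (ug_inv' V UV) in Weak2; rewrite Weak2.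
  apply lin_0, (ug_lin V UV).
Qed.
End Uniqueness.

                                                          

(** * The projection of an effect onto its eigenvalue 1 *)

Section Effect.
Context {H : HilbertSpace}.
Variable E : H -> H.
Hypothesis HE : is_effect E.

Lemma effect_lin : lin E.
Proof. destruct HE as [L _]; apply lin_of_linear, L. Qed.

Lemma effect_selfadj : selfadj E.
Proof. destruct HE as [_ [_ [A _]]]; intros x y; unfold ip; rewrite (A x y); reflexivity. Qed.

Lemma effect_pos x : 0 <= Re (ip x (E x)).
Proof. destruct HE as [_ [_ [_ A]]]; apply (A x). Qed.

Lemma effect_le x : Re (ip x (E x)) <= Re (ip x x).
Proof. destruct HE as [_ [_ [_ A]]]; apply (A x). Qed.

                                                              
(** The inequality E^2 <= E without square roots: add E <= 1 at the vector E x to E >= 0 at the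
    vector x - E x. *)
Lemma effect_square_le x : Re (ip (E x) (E x)) <= Re (ip x (E x)).
Proof.
  assert (A := effect_le (E x)); assert (B := effect_pos (hsub x (E x))).
  rewrite (lin_sub E) in B by apply effect_lin.
  rewrite ip_subl, !ip_subr in B.
  rewrite <- (effect_selfadj x (E x)) in B.
  simpl in *; unfold Re in *; lra.
Qed.

Lemma effect_bnd : bnd 1 E.
Proof.
  intros x; rewrite Rmult_1_l; apply hnorm_le; [apply hnorm_pos |].
  assert (A := effect_square_le x); assert (B := effect_le x); rewrite hnorm_sqr; lra.
Qed.

Lemma effect_zero x : Re (ip x (E x)) = 0 -> E x = hzero.
Proof.
  intros Z; apply ip_def; assert (A := effect_square_le x); assert (B := ip_pos (E x)); lra.
Qed.

Lemma effect_iter_selfadj n x y : ip (Nat.iter n E x) y = ip x (Nat.iter n E y).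
Proof.
  revert y; induction n as [| n IH]; intros y; simpl; auto.
  rewrite effect_selfadj, IH; f_equal; apply iter_comm; auto.
Qed.

Lemma effect_iter_ip m n x : ip (Nat.iter m E x) (Nat.iter n E x) = ip x (Nat.iter (m + n) E x).
Proof. rewrite effect_iter_selfadj, Nat.iter_add; reflexivity. Qed.

Definition moment (x : H) (n : nat) : R := Re (ip x (Nat.iter n E x)).

Lemma moment_even x n : moment x (n + n) = Re (ip (Nat.iter n E x) (Nat.iter n E x)).
Proof. unfold moment; rewrite effect_iter_ip; reflexivity. Qed.

Lemma moment_odd x n : moment x (S (n + n)) = Re (ip (Nat.iter n E x) (E (Nat.iter n E x))).
Proof.
  unfold moment; change (E (Nat.iter n E x)) with (Nat.iter (S n) E x).
  rewrite effect_iter_ip; do 3 f_equal; lia.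
Qed.

Lemma moment_spec x n : 0 <= moment x n /\ moment x (S n) <= moment x n.
Proof.
  destruct (Nat.Even_or_Odd n) as [[m ->] | [m ->]].
  - replace (2 * m)%nat with (m + m)%nat by lia.
    rewrite moment_odd, moment_even; split; [apply ip_pos | apply effect_le].
  - replace (2 * m + 1)%nat with (S (m + m)) by lia.
    replace (S (S (m + m))) with (S m + S m)%nat by lia.
    rewrite moment_odd, moment_even; split; [apply effect_pos | apply effect_square_le].
Qed.

(** The moments <x, E^n x> decrease and are nonnegative, hence converge; the squared distance of E^m
    x and E^n x is the combination of the moments of order 2m, 2n and m + n with coefficients 1, 1
    and - 2. *)
Lemma effect_iter_converges x : exists l, hlim (fun n => Nat.iter n E x) l.
Proof.
  apply hlim_complete; intros eps He.
  destruct (ex_finite_lim_seq_decr (moment x) 0) as [a Ha];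
    [intros n; apply moment_spec | intros n; apply moment_spec |].
  assert (Pe : 0 < eps * eps / 8) by nra.
  apply is_lim_seq_spec in Ha; destruct (Ha (mkposreal _ Pe)) as [N HN]; simpl in HN.
  exists N; intros m n Hm Hn.
  assert (A1 := HN (m + m)%nat ltac:(lia)); assert (A2 := HN (n + n)%nat ltac:(lia)); assert (A3 := HN (m + n)%nat ltac:(lia)).
  apply Rabs_lt_between in A1, A2, A3.
  set (w := hsub (Nat.iter m E x) (Nat.iter n E x)).
  assert (W : hnorm w * hnorm w = moment x (m + m) + moment x (n + n) - 2 * moment x (m + n)).
  { rewrite hnorm_sqr; unfold w; rewrite ip_subl, !ip_subr, !effect_iter_ip.
    unfold moment; rewrite (Nat.add_comm n m); unfold Re; simpl; ring. }
  assert (Pw := hnorm_pos w); apply Rnot_le_lt; intros Hle; nra.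
Qed.

(** The strong limit of E^n is the spectral projection onto ker(1 - E), obtained here without
    spectral calculus. *)
Definition eigenproj (x : H) : H := epsilon (inhabits hzero) (fun l => hlim (fun n => Nat.iter n E x) l).

Lemma eigenproj_hlim x : hlim (fun n => Nat.iter n E x) (eigenproj x).
Proof.
  apply (epsilon_spec (inhabits hzero) (fun l => hlim (fun n => Nat.iter n E x) l)), effect_iter_converges.
Qed.

Lemma eigenproj_unique x l : hlim (fun n => Nat.iter n E x) l -> eigenproj x = l.
Proof. apply hlim_unique, eigenproj_hlim. Qed.

Lemma eigenproj_lin : lin eigenproj.
Proof.
  split.
  - intros x y; apply eigenproj_unique.
    eapply hlim_ext; [| apply hlim_add; apply eigenproj_hlim]; intros n; simpl.
    symmetry; apply (iter_lin n E effect_lin).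
  - intros a x; apply eigenproj_unique.
    eapply hlim_ext; [| apply hlim_sc; apply eigenproj_hlim]; intros n; simpl.
    symmetry; apply (iter_lin n E effect_lin).
Qed.

Lemma eigenproj_bnd : bnd 1 eigenproj.
Proof.
  intros x; apply hlim_norm_le with (1 := eigenproj_hlim x); intros n; rewrite Rmult_1_l.
  induction n as [| n IH]; simpl; [lra |].
  assert (B := effect_bnd (Nat.iter n E x)); lra.
Qed.

Lemma eigenproj_selfadj : selfadj eigenproj.
Proof.
  intros x y; apply (hlim_ip_eq _ _ _ _ _ _ (eigenproj_hlim x) (eigenproj_hlim y)).
  intros n; apply effect_iter_selfadj.
Qed.

(** Commutation with E passes to the limit of its powers. It is used for E itself, for an effect of
    a separated region, and for a translated projection. *)
Lemma eigenproj_commute A K x : lin A -> bnd K A -> (forall x, A (E x) = E (A x)) ->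
  eigenproj (A x) = A (eigenproj x).
Proof.
  intros LA BA CA; apply eigenproj_unique.
  eapply hlim_ext; [| apply (hlim_lin A K); [exact LA | exact BA | apply eigenproj_hlim]].
  intros n; simpl; symmetry; apply iter_comm; auto.
Qed.

Lemma eigenproj_fixed x : E x = x -> eigenproj x = x.
Proof.
  intros Ex; apply eigenproj_unique; intros eps He; exists 0%nat; intros n _.
  replace (Nat.iter n E x) with x.
  - replace (hsub x x) with (@hzero H) by vec; rewrite hnorm_0; exact He.
  - symmetry; clear He; induction n as [| n IH]; simpl; [auto | rewrite IH; auto].
Qed.

Lemma eigenproj_eigen x : E (eigenproj x) = eigenproj x.
Proof.
  rewrite <- (eigenproj_commute E 1) by auto using effect_lin, effect_bnd.
  apply eigenproj_unique; intros eps He.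
  destruct (eigenproj_hlim x eps He) as [N HN]; exists N; intros n Hn.
  rewrite <- iter_S_r; apply HN; lia.
Qed.

Lemma eigenproj_kernel x : E x = hzero -> eigenproj x = hzero.
Proof.
  intros Ex; rewrite <- eigenproj_eigen, <- (eigenproj_commute E 1), Ex by auto using effect_lin, effect_bnd.
  apply lin_0, eigenproj_lin.
Qed.
End Effect.

                           

(** * Geometry of spacelike hyperplanes *)

Definition quad (v : M) : R := - mink v v.

(** On vectors parallel to the hyperplanes [quad] is the squared Euclidean length. Cauchy-Schwarz
    applied to the spatial parts of n and v shows that it controls all coordinates, with constants
    depending on n. *)
Lemma spatial_coordinates n v : timelike n -> mink n v = 0 ->
  (Mx1 v * Mx1 v + Mx2 v * Mx2 v + Mx3 v * Mx3 v) * mink n n <= Mt n * Mt n * quad v /\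
  Mt v * Mt v <= Mx1 v * Mx1 v + Mx2 v * Mx2 v + Mx3 v * Mx3 v.
Proof.
  intros Hn Hv; unfold timelike, quad, mink in *.
  destruct n as [n0 n1 n2 n3], v as [v0 v1 v2 v3]; simpl in *.
  set (N := n1 * n1 + n2 * n2 + n3 * n3); set (X := v1 * v1 + v2 * v2 + v3 * v3).
  assert (CS : (n0 * v0) * (n0 * v0) <= N * X).
  { replace (n0 * v0) with (n1 * v1 + n2 * v2 + n3 * v3) by lra.
    assert (A : 0 <= (n1 * v2 - n2 * v1) * (n1 * v2 - n2 * v1)) by apply Rle_0_sqr.
    assert (B : 0 <= (n1 * v3 - n3 * v1) * (n1 * v3 - n3 * v1)) by apply Rle_0_sqr.
    assert (D : 0 <= (n2 * v3 - n3 * v2) * (n2 * v3 - n3 * v2)) by apply Rle_0_sqr.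
    unfold N, X; lra. }
  assert (PX : 0 <= X) by (unfold X; nra).
  assert (PN : N < n0 * n0) by (unfold N; lra).
  split.
  - replace (n0 * n0 - n1 * n1 - n2 * n2 - n3 * n3) with (n0 * n0 - N) by (unfold N; ring).
    replace (- (v0 * v0 - v1 * v1 - v2 * v2 - v3 * v3)) with (X - v0 * v0) by (unfold X; ring).
    lra.
  - assert (P0 : 0 < n0 * n0) by (unfold N in PN; nra).
    apply Rmult_le_reg_l with (n0 * n0); [exact P0 |].
    assert (N * X <= n0 * n0 * X) by (apply Rmult_le_compat_r; lra); lra.
Qed.

Lemma quad_spatial_pos n v : timelike n -> mink n v = 0 -> 0 <= quad v.
Proof.
  intros Hn Hv; destruct (spatial_coordinates n v Hn Hv) as [A _].
  unfold timelike in Hn.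
  assert (P0 : 0 < Mt n * Mt n).
  { assert (Q := Hn); unfold mink in Q.
    assert (Q1 := Rle_0_sqr (Mx1 n)); assert (Q2 := Rle_0_sqr (Mx2 n)); assert (Q3 := Rle_0_sqr (Mx3 n)).
    unfold Rsqr in *; lra. }
  assert (PX : 0 <= Mx1 v * Mx1 v + Mx2 v * Mx2 v + Mx3 v * Mx3 v) by nra.
  assert (0 <= (Mx1 v * Mx1 v + Mx2 v * Mx2 v + Mx3 v * Mx3 v) * mink n n) by (apply Rmult_le_pos; lra).
  apply Rmult_le_reg_l with (Mt n * Mt n); [exact P0 | lra].
Qed.

Lemma spatial_mink_bound n a B : timelike n -> exists K, 0 < K /\
  forall v, mink n v = 0 -> quad v <= B -> Rabs (mink v a) <= K.
Proof.
  intros Hn.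
  set (A := Mt a * Mt a + Mx1 a * Mx1 a + Mx2 a * Mx2 a + Mx3 a * Mx3 a).
  set (K0 := 2 * (Mt n * Mt n * Rabs B / mink n n) * A).
  assert (PA : 0 <= A) by (unfold A; nra).
  assert (Pn : 0 < mink n n) by exact Hn.
  assert (PK0 : 0 <= K0).
  { unfold K0; apply Rmult_le_pos; [| exact PA]; apply Rmult_le_pos; [lra |].
    apply Rdiv_le_0_compat; [| exact Pn]; apply Rmult_le_pos; [nra | apply Rabs_pos]. }
  exists (K0 + 1); split; [lra |]; intros v Hv HB.
  destruct (spatial_coordinates n v Hn Hv) as [H1 H2].
  set (X := Mx1 v * Mx1 v + Mx2 v * Mx2 v + Mx3 v * Mx3 v) in *.
  assert (HX : X <= Mt n * Mt n * Rabs B / mink n n).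
  { apply Rmult_le_reg_r with (mink n n); [exact Pn |].
    replace (Mt n * Mt n * Rabs B / mink n n * mink n n) with (Mt n * Mt n * Rabs B) by (field; lra).
    apply Rle_trans with (1 := H1); apply Rmult_le_compat_l; [nra |].
    assert (L := Rle_abs B); lra. }
  assert (CS : mink v a * mink v a <= (Mt v * Mt v + X) * A).
  { unfold mink, X, A; destruct v as [v0 v1 v2 v3], a as [a0 a1 a2 a3]; simpl.
    assert (S1 := Rle_0_sqr (v0 * a1 + v1 * a0)); assert (S2 := Rle_0_sqr (v0 * a2 + v2 * a0)).
    assert (S3 := Rle_0_sqr (v0 * a3 + v3 * a0)); assert (S4 := Rle_0_sqr (v1 * a2 - v2 * a1)).
    assert (S5 := Rle_0_sqr (v1 * a3 - v3 * a1)); assert (S6 := Rle_0_sqr (v2 * a3 - v3 * a2)).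
    unfold Rsqr in *; lra. }
  assert (Q : mink v a * mink v a <= K0).
  { apply Rle_trans with (1 := CS); unfold K0; apply Rmult_le_compat_r; lra. }
  apply Rabs_le; nra.
Qed.

Lemma mink_sub_l a b c : mink (Msub a b) c = mink a c - mink b c.
Proof. unfold mink, Msub; simpl; ring. Qed.
Lemma mink_sub_r a b c : mink c (Msub a b) = mink c a - mink c b.
Proof. unfold mink, Msub; simpl; ring. Qed.
Lemma mink_add_r a b c : mink c (Madd a b) = mink c a + mink c b.
Proof. unfold mink, Madd; simpl; ring. Qed.
Lemma mink_scal_l r a b : mink (Mscal r a) b = r * mink a b.
Proof. unfold mink, Mscal; simpl; ring. Qed.
Lemma mink_scal_r r a b : mink b (Mscal r a) = r * mink b a.
Proof. unfold mink, Mscal; simpl; ring. Qed.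

Lemma parallelogram v w : quad (Msub v w) + quad (Madd v w) = 2 * quad v + 2 * quad w.
Proof. unfold quad, mink, Msub, Madd; simpl; ring. Qed.

Lemma M_ext a b : Mt a = Mt b -> Mx1 a = Mx1 b -> Mx2 a = Mx2 b -> Mx3 a = Mx3 b -> a = b.
Proof. destruct a, b; simpl; intros; subst; reflexivity. Qed.

(** Two parallelogram identities, for d, b and for d, d - b, with one nonnegative term dropped in
    each. The second gives 2 quad (d - b) >= quad b - 2 quad d, whence the threshold 2 B + 2. *)
Lemma far_difference n B b d : timelike n -> 0 <= B -> mink n b = 0 -> mink n d = 0 ->
  quad d <= B -> 2 * B + 2 <= quad b ->
  1 <= quad (Msub d b) /\ quad (Msub d b) <= 2 * B + 2 * quad b.
Proof.
  intros Hn HB Hb Hd Qd Qb.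
  assert (A1 := parallelogram d b).
  assert (A2 := parallelogram d (Msub d b)).
  replace (Msub d (Msub d b)) with b in A2 by (apply M_ext; simpl; ring).
  assert (P1 : 0 <= quad (Madd d b)).
  { apply (quad_spatial_pos n); [exact Hn |]; rewrite mink_add_r; lra. }
  assert (P2 : 0 <= quad (Madd d (Msub d b))).
  { apply (quad_spatial_pos n); [exact Hn |]; rewrite mink_add_r, mink_sub_r; lra. }
  lra.
Qed.

(** Differences of points of D and its translate by b have squared length at least 1 and stay
    bounded, so a time shift t a changes their Minkowski square by at most a multiple of |t|,
    uniformly over the region. *)
Lemma spacelike_separated_translates n c D B b a : timelike n -> 0 <= B ->
  (forall x, D x -> hyperplane n c x) ->
  (forall x y, D x -> D y -> quad (Msub x y) <= B) ->
  mink n b = 0 -> 2 * B + 2 <= quad b -> mink a a = 1 ->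
  exists eps, 0 < eps /\ forall t, Rabs t < eps ->
    spacelike_separated D (translate (translate D b) (Mscal t a)).
Proof.
  intros Hn HB HD HQ Hb Qb Ha.
  destruct (spatial_mink_bound n a (2 * B + 2 * quad b) Hn) as [K [PK HK]].
  exists (Rmin 1 (/ (4 * K + 4))).
  assert (Pi : 0 < / (4 * K + 4)) by (apply Rinv_0_lt_compat; lra).
  split; [apply Rmin_glb_lt; lra |]; intros t Ht x y Dx Dy.
  assert (T1 := Rlt_le_trans _ _ _ Ht (Rmin_l _ _)); assert (T2 := Rlt_le_trans _ _ _ Ht (Rmin_r _ _)).
  assert (T3 : Rabs t * (4 * K + 4) < 1).
  { apply (Rmult_lt_compat_r (4 * K + 4)) in T2; [| lra]; rewrite Rinv_l in T2; lra. }
  unfold translate in Dy; set (y' := Msub (Msub y (Mscal t a)) b) in *.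
  set (w := Msub (Msub x y') b).
  assert (Hd : mink n (Msub x y') = 0).
  { rewrite mink_sub_r; assert (E1 := HD x Dx); assert (E2 := HD y' Dy); unfold hyperplane in *; lra. }
  destruct (far_difference n B b (Msub x y') Hn HB Hb Hd (HQ x y' Dx Dy) Qb) as [W1 W2]; fold w in W1, W2.
  assert (Hw : mink n w = 0) by (unfold w; rewrite mink_sub_r; lra).
  assert (Kw := HK w Hw W2).
  unfold spacelike.
  replace (Msub x y) with (Msub w (Mscal t a)) by (apply M_ext; simpl; ring).
  assert (E : mink (Msub w (Mscal t a)) (Msub w (Mscal t a)) = - quad w - 2 * (t * mink w a) + t * t).
  { rewrite !mink_sub_l, !mink_sub_r, !mink_scal_l, !mink_scal_r, Ha; unfold quad.
    replace (mink a w) with (mink w a) by (unfold mink; ring); ring. }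
  rewrite E.
  assert (X1 : Rabs (t * mink w a) <= Rabs t * K).
  { rewrite Rabs_mult; apply Rmult_le_compat_l; [apply Rabs_pos | exact Kw]. }
  apply Rabs_le_between in X1.
  assert (X2 : t * t <= Rabs t) by (generalize (Rabs_pos t); intros; rewrite <- (Rabs_pos_eq (t * t)), Rabs_mult by nra; nra).
  assert (Pt := Rabs_pos t).
  lra.
Qed.

(** The time coordinate 0 is demanded so that subtracting b from a future vector keeps it
    future-directed. *)
Lemma exists_spatial n B : exists b, mink n b = 0 /\ Mt b = 0 /\ B <= quad b /\ 0 < quad b.
Proof.
  assert (Q : exists v, mink n v = 0 /\ Mt v = 0 /\ 0 < quad v).
  { destruct n as [n0 n1 n2 n3].
    destruct (Req_dec n2 0) as [Z | NZ].
    - exists (mkM 0 0 1 0); unfold quad, mink; simpl; subst; lra.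
    - exists (mkM 0 n2 (- n1) 0); unfold quad, mink; simpl; repeat split; try ring.
      assert (0 < n2 * n2) by (apply Rsqr_pos_lt; auto); nra. }
  destruct Q as [v [Q1 [Q2 Q3]]].
  set (r := Rabs B / quad v + 1).
  assert (Pr : 0 <= Rabs B / quad v) by (apply Rdiv_le_0_compat; [apply Rabs_pos | auto]).
  assert (E : quad (Mscal r v) = r * r * quad v) by (unfold quad; rewrite mink_scal_l, mink_scal_r; ring).
  exists (Mscal r v); rewrite mink_scal_r, Q1, E; repeat split.
  - ring.
  - simpl; rewrite Q2; ring.
  - assert (F : Rabs B = Rabs B / quad v * quad v) by (field; lra).
    assert (L := Rle_abs B).
    assert (G : Rabs B / quad v <= r * r) by (unfold r; nra).
    apply (Rmult_le_compat_r (quad v)) in G; lra.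
  - unfold r; apply Rmult_lt_0_compat; [nra | auto].
Qed.

Lemma exists_future n : timelike n -> exists e r, e = Mscal r n /\ future_timelike_unit e.
Proof.
  intros Hn; assert (Pn : 0 < mink n n) by exact Hn.
  assert (N0 : Mt n <> 0).
  { intros Z; unfold mink in Pn; rewrite Z in Pn.
    assert (Q1 := Rle_0_sqr (Mx1 n)); assert (Q2 := Rle_0_sqr (Mx2 n)); assert (Q3 := Rle_0_sqr (Mx3 n)).
    unfold Rsqr in *; lra. }
  assert (Ps := sqrt_lt_R0 _ Pn); assert (Es := sqrt_sqrt _ (Rlt_le _ _ Pn)).
  assert (Pi : 0 < / sqrt (mink n n)) by (apply Rinv_0_lt_compat, Ps).
  assert (E : / sqrt (mink n n) * / sqrt (mink n n) * mink n n = 1).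
  { rewrite <- Es at 3; field; lra. }
  destruct (Rdichotomy _ _ N0) as [Neg | Pos].
  - exists (Mscal (- / sqrt (mink n n)) n), (- / sqrt (mink n n)); split; [reflexivity |]; split.
    + rewrite mink_scal_l, mink_scal_r; lra.
    + simpl; nra.
  - exists (Mscal (/ sqrt (mink n n)) n), (/ sqrt (mink n n)); split; [reflexivity |]; split.
    + rewrite mink_scal_l, mink_scal_r; lra.
    + simpl; nra.
Qed.

(** Since b is orthogonal to e, the square of s e - b is s^2 - quad b > 0; normalising this vector
    gives a. *)
Lemma future_decomposition n e b s : future_timelike_unit e -> (exists r, e = Mscal r n) ->
  mink n b = 0 -> Mt b = 0 -> 0 < s -> quad b < s * s ->
  exists a t, future_timelike_unit a /\ Mscal s e = Madd (Mscal t a) b.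
Proof.
  intros [He1 He2] [r Er] Hb Hb0 Hs Qs.
  assert (Eb : mink e b = 0) by (rewrite Er, mink_scal_l, Hb; ring).
  set (q := s * s - quad b).
  assert (Pq : 0 < q) by (unfold q; lra).
  assert (Ps := sqrt_lt_R0 _ Pq); assert (Es := sqrt_sqrt _ (Rlt_le _ _ Pq)).
  assert (Pi : 0 < / sqrt q) by (apply Rinv_0_lt_compat, Ps).
  exists (Mscal (/ sqrt q) (Msub (Mscal s e) b)), (sqrt q); split; [split |].
  - rewrite mink_scal_l, mink_scal_r, mink_sub_l, !mink_sub_r, !mink_scal_l, !mink_scal_r, He1, Eb.
    replace (mink b e) with (mink e b) by (unfold mink; ring); rewrite Eb.
    replace (s * (s * 1) - s * 0 - (s * 0 - mink b b)) with (sqrt q * sqrt q)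
      by (rewrite Es; unfold q, quad; ring).
    field; lra.
  - simpl; rewrite Hb0; apply Rmult_lt_0_compat; [exact Pi |]; nra.
  - apply M_ext; simpl; field; lra.
Qed.

                                        

(** * The translation group along a fixed timelike direction *)

Section Representation.
Context {H : HilbertSpace}.
Variable U : M -> H -> H.
Hypothesis HU : unitary_rep U.
Hypothesis HUc : strongly_continuous U.
Hypothesis Hspec : spectrum_condition U.

Lemma rep_group a : unitary_group (fun t => U (Mscal t a)).
Proof.
  destruct HU as [U1 [U2 U3]].
  assert (Z : Mscal 0 a = M0) by (apply M_ext; simpl; ring).
  split.
  - intros t; apply lin_of_linear, (U1 (Mscal t a)).
  - intros t x y; unfold ip; rewrite (proj1 (proj2 (U1 (Mscal t a)))); reflexivity.
  - intros x; rewrite Z; apply U2.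
  - intros s t x; rewrite <- U3; f_equal; apply M_ext; simpl; ring.
  - intros x eps He; destruct (HUc x M0 eps He) as [d [Hd D]].
    assert (Pa : 0 <= Mnorm a) by apply sqrt_pos.
    exists (d / (Mnorm a + 1)); split; [apply Rdiv_lt_0_compat; lra |]; intros t Ht.
    rewrite <- (U2 x) at 2; apply D.
    assert (E : Mnorm (Msub (Mscal t a) M0) = Rabs t * Mnorm a).
    { unfold Mnorm; rewrite <- sqrt_Rsqr_abs, <- sqrt_mult_alt by apply Rle_0_sqr.
      f_equal; unfold Rsqr; simpl; ring. }
    rewrite E; apply (Rmult_lt_compat_r (Mnorm a + 1)) in Ht; [| lra].
    replace (d / (Mnorm a + 1) * (Mnorm a + 1)) with d in Ht by (field; lra).
    assert (Pt := Rabs_pos t); nra.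
Qed.

Lemma rep_generator_bounded a : future_timelike_unit a -> exists k, 0 <= k /\
  forall phi psi, is_gen (fun t => U (Mscal t a)) phi psi -> - k * (hnorm phi * hnorm phi) <= Re (ip phi psi).
Proof.
  intros Ha; destruct (Hspec a Ha) as [c Hc].
  exists (Rabs c); split; [apply Rabs_pos |]; intros phi psi G.
  apply Rle_trans with (c * Re (ip phi phi)); [| apply Rge_le, Hc, G].
  rewrite hnorm_sqr; apply Rmult_le_compat_r; [apply ip_pos |].
  assert (A := Rle_abs (- c)); rewrite Rabs_Ropp in A; lra.
Qed.

Lemma rep_coefficient_zero a r phi psi : future_timelike_unit a -> 0 < r ->
  (forall t, Rabs t < r -> ip phi (U (Mscal t a) psi) = 0%C) ->
  forall t, ip phi (U (Mscal t a) psi) = 0%C.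
Proof.
  intros Ha Hr Z; destruct (rep_generator_bounded a Ha) as [k [Hk G]].
  exact (orbit_coefficient_zero (fun t => U (Mscal t a)) k (rep_group a) Hk G phi psi r Hr Z).
Qed.

Lemma Mopp_inv_l a x : U (Mscal (-1) a) (U a x) = x.
Proof.
  destruct HU as [_ [U2 U3]]; rewrite <- U3; etransitivity; [| apply U2].
  f_equal; apply M_ext; simpl; ring.
Qed.

Lemma Mopp_inv_r a x : U a (U (Mscal (-1) a) x) = x.
Proof.
  destruct HU as [_ [U2 U3]]; rewrite <- U3; etransitivity; [| apply U2].
  f_equal; apply M_ext; simpl; ring.
Qed.

Lemma rep_adjoint a : is_adjoint (U a) (U (Mscal (-1) a)).
Proof.
  intros x y; destruct HU as [U1 _]; destruct (U1 a) as [_ [A _]].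
  rewrite <- A, Mopp_inv_r; reflexivity.
Qed.
End Representation.

(** * Absence of eigenvectors with eigenvalue 1 for bounded regions *)

Theorem theorem3
  (H : HilbertSpace) (U : M -> H -> H)
  (HU : unitary_rep U) (HUc : strongly_continuous U) (Hspec : spectrum_condition U)
  (n : M) (Hn : timelike n)
  (F : R -> Mset -> Prop)
  (HFsub : forall c D, F c D -> forall x, D x -> hyperplane n c x)
  (HFcov : forall c x, hyperplane n c x ->
             exists D, F c D /\ bounded_in_hyperplane D /\ D x)
  (HFtr : forall c a D', F (c + mink n a) D' <-> exists D, F c D /\ D' = translate D a)
  (E : Mset -> H -> H)
  (HEeff : forall c D, F c D -> is_effect (E D))
  (Hcov : forall c D a, F c D -> forall Ustar, is_adjoint (U a) Ustar ->
             forall x, U a (E D (Ustar x)) = E (translate D a) x)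
  (Hloc : forall c D1 D2, F c D1 -> F c D2 -> disjoint D1 D2 ->
             forall phi : H, hnorm phi = 1 -> hinner phi (E D1 phi) = Cone ->
             hinner phi (E D2 phi) = Czero)
  (Hcomm : forall c1 c2 D1 D2, F c1 D1 -> F c2 D2 -> spacelike_separated D1 D2 ->
             forall x, E D1 (E D2 x) = E D2 (E D1 x)) :
  forall c D, F c D -> bounded_in_hyperplane D ->
    forall phi : H, E D phi = phi -> phi = hzero.
Proof.
  intros c D FD [B0 HB0] phi Hphi.
  assert (Hcov' : forall c D a x, F c D -> U a (E D x) = E (translate D a) (U a x)).
  { intros c' D' a x FD'; rewrite <- (Hcov c' D' a FD' _ (rep_adjoint U HU a)).
    rewrite (Mopp_inv_l U HU); reflexivity. }
  assert (HF : forall c D a, F c D -> F (c + mink n a) (translate D a)).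
  { intros c' D' a FD'; apply HFtr; exists D'; auto. }
  (* For empty D the given bound may be negative. *)
  set (B := Rabs B0); assert (PB : 0 <= B) by apply Rabs_pos.
  assert (HB : forall x y, D x -> D y -> quad (Msub x y) <= B).
  { intros x y Dx Dy; apply Rle_trans with B0; [apply HB0; auto | apply Rle_abs]. }
  destruct (exists_spatial n (2 * B + 2)) as [b [Hb [Hb0 [Qb _]]]].
  set (Db := translate D b).
  assert (FDb : F c Db) by (assert (A := HF c D b FD); rewrite Hb, Rplus_0_r in A; exact A).
  assert (E1 := HEeff c D FD); assert (E2 := HEeff c Db FDb).
  assert (Dis : disjoint Db D).
  { intros x [Dx1 Dx2]; unfold Db, translate in Dx1.
    assert (A := HB x (Msub x b) Dx2 Dx1).
    replace (Msub x (Msub x b)) with b in A by (apply M_ext; simpl; ring); lra. }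
  set (p := eigenproj (E D)); set (q := eigenproj (E Db)).
  (* Localizability is stated for unit vectors, so a nonzero psi is normalised first; expectation 0
     of a positive operator then means that the vector is in its kernel. *)
  assert (Hker : forall psi, E Db psi = psi -> E D psi = hzero).
  { intros psi Epsi.
    destruct (Req_dec (hnorm psi) 0) as [Z | NZ].
    { apply hnorm_eq0 in Z; subst psi; apply lin_0, effect_lin, E1. }
    assert (NZC : RtoC (hnorm psi) <> 0%C) by (intros Z; apply RtoC_inj in Z; contradiction).
    set (w := sc (/ RtoC (hnorm psi))%C psi).
    assert (Nw : hnorm w = 1).
    { unfold w; rewrite hnorm_sc, <- RtoC_inv, Cmod_R, Rabs_pos_eq by
        (try exact NZ; left; apply Rinv_0_lt_compat; generalize (hnorm_pos psi); lra).
      field; exact NZ. }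
    assert (Ew : E Db w = w) by (unfold w; rewrite (proj2 (effect_lin _ E2)), Epsi; reflexivity).
    assert (Iw : hinner w (E Db w) = Cone).
    { rewrite Ew; assert (A := hnorm_sqr w); rewrite Nw in A; assert (A' := ip_xx_im w).
      unfold ip in A, A'; simpl in A, A'; destruct (hinner w w) as [x y]; simpl in *.
      unfold Cone; f_equal; lra. }
    assert (Zw := Hloc c Db D FDb FD Dis w Nw Iw).
    assert (Ez : E D w = hzero).
    { apply (effect_zero _ E1); unfold ip; rewrite Zw; reflexivity. }
    replace psi with (sc (RtoC (hnorm psi)) w).
    - rewrite (proj2 (effect_lin _ E1)), Ez; vec.
    - unfold w; apply ip_ext; intros v; ipall; field; exact NZC. }
  assert (Opq : forall x, p (q x) = hzero).
  { intros x; apply (eigenproj_kernel _ E1), Hker, (eigenproj_eigen _ E2). }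
  set (psi := U b phi).
  assert (Hpsi : E Db psi = psi).
  { unfold Db, psi; rewrite <- (Hcov' c), Hphi by exact FD; reflexivity. }
  assert (Hfar : forall a, future_timelike_unit a -> forall t, ip phi (U (Mscal t a) psi) = 0%C).
  { intros a Ha.
    destruct (spacelike_separated_translates n c D B b a Hn PB (HFsub c D FD) HB Hb Qb (proj1 Ha)) as [eps [Heps Sep]].
    set (V := fun t => U (Mscal t a)).
    assert (UV : unitary_group V) by (apply rep_group; auto).
    destruct (rep_generator_bounded U Hspec a Ha) as [k [Hk G]].
    apply (rep_coefficient_zero U HU HUc Hspec a (eps / 8)); [exact Ha | lra |]; intros t Ht.
    (* Covariance turns the effect of D + b into that of D + b + t a when V(t) passes it. This
       region is spacelike to D for small t, so p commutes with its effect, and passing back through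
       V(-t) restores the effect of D + b. *)
    assert (Cpq : forall t x, Rabs t < eps -> moved V p t (q x) = q (moved V p t x)).
    { clear t Ht; intros t x Ht.
      symmetry; apply (eigenproj_commute _ E2 (moved V p t) 1).
      - apply moved_lin; [exact UV | apply eigenproj_lin, E1].
      - intros y; rewrite Rmult_1_l; apply moved_norm; [exact UV | apply eigenproj_bnd, E1].
      - intros y; unfold moved.
        set (Dt := translate Db (Mscal t a)).
        assert (FDt : F (c + mink n (Mscal t a)) Dt) by (apply HF, FDb).
        assert (Et := HEeff _ _ FDt).
        assert (CV : forall y, V t (E Db y) = E Dt (V t y)) by (intros; apply (Hcov' c), FDb).
        rewrite CV; unfold p; rewrite (eigenproj_commute _ E1 (E Dt) 1).
        + rewrite <- (ug_inv' V UV t (eigenproj _ (V t y))) at 1.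
          rewrite <- CV, (ug_inv V UV); reflexivity.
        + apply effect_lin, Et.
        + apply effect_bnd, Et.
        + intros z; symmetry; apply (Hcomm c _ D Dt FD FDt (Sep t Ht)). }
    assert (Bo := borchers V k UV Hk G p q eps (eigenproj_lin _ E1)
      (eigenproj_bnd _ E1) (eigenproj_bnd _ E2) (eigenproj_selfadj _ E1) (eigenproj_selfadj _ E2)).
    assert (Ip : forall x, p (p x) = p x).
    { intros x; apply (eigenproj_fixed _ E1), (eigenproj_eigen _ E1). }
    specialize (Bo Ip Opq Heps Cpq t psi Ht).
    replace psi with (q psi) by (apply (eigenproj_fixed _ E2), Hpsi).
    replace phi with (p phi) at 1 by (apply (eigenproj_fixed _ E1), Hphi).
    unfold p; rewrite (eigenproj_selfadj _ E1); fold p.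
    change (U (Mscal t a) (q psi)) with (V t (q psi)); rewrite Bo; apply ip_0r. }
  destruct (exists_future n Hn) as [e [r [He Fe]]].
  set (s0 := sqrt (quad b)).
  assert (Ps0 : 0 <= s0) by apply sqrt_pos.
  assert (Es0 : s0 * s0 = quad b) by (apply sqrt_sqrt; lra).
  destruct HU as [U1 [U2 U3]].
  (* Each s needs its own direction a, with its own lower bound and time interval; [Hfar] covers all
     times for every a. The value of s0 is the Euclidean length of b. *)
  assert (Haxis : forall s, s0 < s -> ip phi (U (Mscal s e) phi) = 0%C).
  { intros s Hs.
    destruct (future_decomposition n e b s Fe (ex_intro _ r He) Hb Hb0 ltac:(lra) ltac:(nra)) as [a [t [Fa Et]]].
    rewrite Et, U3; apply Hfar, Fa. }
  (* Starting from time s0 + 1 makes the vanishing hold for |t| < 1, as the continuation lemma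
     requires; t = - (s0 + 1) undoes the shift. *)
  assert (Hall : forall t, ip phi (U (Mscal t e) (U (Mscal (s0 + 1) e) phi)) = 0%C).
  { apply (rep_coefficient_zero U (conj U1 (conj U2 U3)) HUc Hspec e 1); [exact Fe | lra |].
    intros t Ht; apply Rabs_lt_between in Ht.
    rewrite <- U3; replace (Madd (Mscal t e) (Mscal (s0 + 1) e)) with (Mscal (t + (s0 + 1)) e)
      by (apply M_ext; simpl; ring).
    apply Haxis; lra. }
  specialize (Hall (- (s0 + 1))).
  rewrite <- U3 in Hall.
  replace (Madd (Mscal (- (s0 + 1)) e) (Mscal (s0 + 1) e)) with M0 in Hall by (apply M_ext; simpl; ring).
  rewrite U2 in Hall; apply ip_def; rewrite Hall; reflexivity.
Qed.
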